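(* The correspondence $\mathfrak g\mapsto S(\mathfrak g[-1])$ from $L_\infty$-algebras (with $L_\infty$-morphisms) to $BV_\infty$-algebras which are free as graded commutative algebras (with pure $BV_\infty$-morphisms) is functorial. This functor establishes an equivalence between the category of $L_\infty$-algebras and the full subcategory of pure $BV_\infty$-algebras of the category of $BV_\infty$-algebras free as graded commutative algebras with pure $BV_\infty$-morphisms. The functor $(S(U),\Delta)\mapsto U[1]$, where $U[1]$ carries the $L_\infty$-structure given by the derived brackets $l_n(a_1,\dots,a_n)=[[\dots[\Delta_n,L_{a_1}],\dots],L_{a_n}]1$ for $a_1,\dots,a_n\in U$, provides a weak inverse to this equivalence.
   Context: Conventions. $k$ is a field of characteristic zero; everything is $\mathbb Z$-graded over $k$ with the Koszul sign rule (commutators, symmetric algebras $S(-)$, etc. are graded). $V[n]^p:=V^{n+p}$. $\hbar$ is a formal variable of degree $2$, and $V[[\hbar]]$ is the graded $k[[\hbar]]$-module of formal power series in $\hbar$ with values in $V$ (graded by total degree). Graded commutative algebras are unital. $L_\infty$-algebras. $S(\mathfrak g[1])$ is the cofree cocommutative coalgebra with the shuffle comultiplication. An $L_\infty$-algebra structure on a graded vector space $\mathfrak g$ is a coderivation $D$ of $S(\mathfrak g[1])$ of degree one with $D^2=0$, $D(1)=0$. Write $D=D_1+D_2+\dots$, where $D_n$ is the coderivation extending the component $l_n:S^n(\mathfrak g[1])\to\mathfrak g[1]$ of $D$: for $m\ge n$, $$D_n(x_1\cdots x_m)=\sum_{\sigma\in \mathrm{Sh}_{n,m-n}}(-1)^{|x_\sigma|}l_n(x_{\sigma(1)},\dots,x_{\sigma(n)})\,x_{\sigma(n+1)}\cdots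 x_{\sigma(m)},$$ and $D_n=0$ on $S^m$ for $m<n$ ($\mathrm{Sh}_{n,m-n}$ are the $(n,m-n)$-shuffles, $(-1)^{|x_\sigma|}$ is the Koszul sign). An $L_\infty$-morphism $\mathfrak g\to\mathfrak g'$ is a morphism $\Phi:S(\mathfrak g[1])\to S(\mathfrak g'[1])$ of counital graded coalgebras commuting with the codifferentials and with $\Phi(1)=1$; it is determined by its projection $\varphi:S(\mathfrak g[1])\to\mathfrak g'[1]$ to cogenerators. $BV_\infty$-algebras. A linear operator $D$ on a graded commutative algebra $V$ is a differential operator of order $\le n$ if $[[\dots[D,L_{a_0}],\dots],L_{a_n}]=0$ for all $a_0,\dots,a_n\in V$, where $L_a(b)=ab$. A $BV_\infty$-algebra is a graded commutative algebra $V$ with a $k$-linear degree-one map $\Delta=\frac1\hbar\sum_{n\ge1}\hbar^n\Delta_n:V\to V[[\hbar]]$, where $\Delta_n$ is a differential operator of order $\le n$ on $V$, such that $\Delta^2=0$ (after continuous $k[[\hbar]]$-linear extension to $V[[\hbar]]$) and $\Delta(1)=0$. A pure $BV_\infty$-algebra is a free graded commutative algebra $S(U)$ on a graded vector space $U$ with a $BV_\infty$ operator $\Delta$ such that for each $n\ge1$, $\Delta_n$ maps $S^n(U)$ to $U$ and $S^{<n}(U)$ to $0$. $BV_\infty$-morphisms. For a degree-zero linear map $\varphi:S(U)\to V'[[\hbar]]$ with $\varphi(1)=0$, the map $\exp(\varphi):S(U)[[\hbar]]\to V'[[\hbar]]$ is the continuous $k[[\hbar]]$-linear map with $\exp(\varphi)(1)=1$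 and, for $x_i\in U$, $m\ge1$, $$\exp(\varphi)(x_1\cdots x_m)=\sum_{k=1}^m\frac1{k!}\sum_{\substack{i_1,\dots,i_k\ge1\\ i_1+\dots+i_k=m}}\frac1{i_1!\cdots i_k!}\sum_{\sigma\in S_m}(-1)^{|x_\sigma|}\varphi(x_{\sigma(1)}\cdots x_{\sigma(i_1)})\cdots\varphi(x_{\sigma(m-i_k+1)}\cdots x_{\sigma(m)}).$$ For a degree-zero $\Phi:S(U)\to V'[[\hbar]]$ with $\Phi(1)=1$, $\log(\Phi)$ is defined by the same formula with $\varphi$ replaced by $\Phi$ and $\frac1{k!}$ replaced by $\frac{(-1)^{k-1}}{k}$, and $\log(\Phi)(1)=0$; $\log$ is inverse to $\exp$. A $BV_\infty$-morphism from $(S(U),\Delta)$ to $(V',\Delta')$ is a degree-zero $k$-linear map $\varphi:S(U)\to V'[[\hbar]]$ such that (1) $\varphi(1)=0$; (2) $\exp(\varphi)\Delta=\Delta'\exp(\varphi)$; (3) $\varphi=\frac1\hbar\sum_{n\ge1}\hbar^n\varphi_n$ with $\varphi_n:S(U)\to V'$ vanishing on $S^{>n}(U)$. A $BV_\infty$-morphism $\varphi:S(U)\to S(U')$ is pure if each $\varphi_n$ maps $S^n(U)$ to $U'$ and all other $S^j(U)$ to $0$. $BV_\infty$-algebras free as graded commutative algebras (objects $(U,\Delta)$ with $\Delta$ a $BV_\infty$ operator on $S(U)$) form a category under pure $BV_\infty$-morphisms, with composition $\psi\diamond\varphi:=\log(\exp(\psi)\circ\exp(\varphi))$ and identity $\varphi=\varphi_1=\mathrm{id}_U$.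 The functors. $S^m(\mathfrak g[1])$ and $S^m(\mathfrak g[-1])$ are identified by the $m$-fold double suspension (shifting degree by $2m$, no signs). An $L_\infty$-algebra $\mathfrak g$ is sent to $S(\mathfrak g[-1])$ with the $BV_\infty$ operator $\Delta=\frac1\hbar\sum_{n\ge1}\hbar^nD_n$. An $L_\infty$-morphism with projection $\varphi$ is sent to $\varphi_\hbar=\frac1\hbar\sum_{n\ge1}\hbar^n\varphi_n$, where $\varphi_n$ is $\varphi|_{S^n(\mathfrak g[1])}$ regarded (via double suspension) as a map $S^n(\mathfrak g[-1])\to\mathfrak g'[-1]$, extended by zero to the other symmetric powers. In the other direction, a pure $BV_\infty$-algebra $S(U)$ is sent to $U[1]$ with the derived brackets $l_n$, viewed as maps $S^n(U[2])\to U[2]$, and a pure $BV_\infty$-morphism $\frac1\hbar\sum_n\hbar^n\varphi_n$ is sent to the coalgebra morphism $S(U[2])\to S(U'[2])$ with projection $\sum_n\varphi_n$. *)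

(* Defs.v *)
From HB Require Import structures.
From mathcomp Require Import all_boot all_order all_algebra perm.
From mathcomp Require Import zify.
From mathcomp Require Import boolp classical_sets.

Set Implicit Arguments.
Unset Strict Implicit.
Unset Printing Implicit Defensive.

Import GRing.Theory.
Local Open Scope ring_scope.

Section Presented.
Variables (k : fieldType) (X : choiceType).

(* A formal sum [:: (c_1, x_1); ...; (c_r, x_r)] stands for \sum_i c_i x_i. *)
Definition fsum := seq (k * X).
Definition fscale (c : k) (s : fsum) : fsum := [seq (c * a.1, a.2) | a <- s].
Definition feval (W : lmodType k) (f : X -> W) (s : fsum) : W :=
  \sum_(a <- s) a.1 *: f a.2.

Variable rel : fsum -> Prop.

Inductive presEq : fsum -> fsum -> Prop :=
| PresRefl s : presEq s s
| PresSym s t : presEq s t -> presEq t s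
| PresTrans s t u : presEq s t -> presEq t u -> presEq s u
| PresCat s1 s2 t1 t2 :
    presEq s1 s2 -> presEq t1 t2 -> presEq (s1 ++ t1) (s2 ++ t2)
| PresComm s t : presEq (s ++ t) (t ++ s)
| PresScale c s t : presEq s t -> presEq (fscale c s) (fscale c t)
| PresAdd a b x : presEq [:: (a, x); (b, x)] [:: (a + b, x)]
| PresZero x : presEq [:: (0, x)] [::]
| PresRel s : rel s -> presEq s [::].

Definition presEqb s t := `[< presEq s t >].

Lemma presEqb_refl : reflexive presEqb.
Proof. by move=> s; apply/asboolP; constructor. Qed.
Lemma presEqb_sym : symmetric presEqb.
Proof. by move=> s t; apply/asboolP/asboolP; exact: PresSym. Qed.
Lemma presEqb_trans : transitive presEqb.
Proof.
move=> s t u /asboolP ts /asboolP su; apply/asboolP; exact: PresTrans ts su.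
Qed.

Definition pres_equiv := EquivRel presEqb presEqb_refl presEqb_sym presEqb_trans.

Definition pres := {eq_quot pres_equiv}%qT.
HB.instance Definition _ := Choice.on pres.

Definition pcls (s : fsum) : pres := \pi_pres%qT s.
Definition pgen (x : X) : pres := pcls [:: (1, x)].

Lemma pclsP s t : presEq s t <-> pcls s = pcls t.
Proof. by split=> [st|/eqmodP/asboolP//]; apply/eqmodP/asboolP. Qed.

Lemma repr_pcls s : presEq (repr (pcls s)) s.
Proof. by apply/pclsP; rewrite /pcls reprK. Qed.

Lemma pclsK x : pcls (repr x) = x.
Proof. by rewrite /pcls reprK. Qed.

Definition padd (x y : pres) : pres := pcls (repr x ++ repr y).
Definition pscale (c : k) (x : pres) : pres := pcls (fscale c (repr x)).
Definition pzero : pres := pcls [::].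
Definition popp : pres -> pres := pscale (-1).

Lemma padd_cls s t : padd (pcls s) (pcls t) = pcls (s ++ t).
Proof. by apply/pclsP; apply: PresCat; apply: repr_pcls. Qed.
Lemma pscale_cls c s : pscale c (pcls s) = pcls (fscale c s).
Proof. by apply/pclsP; apply: PresScale; apply: repr_pcls. Qed.

Lemma pres_ind_cls (P : pres -> Prop) : (forall s, P (pcls s)) -> forall x, P x.
Proof. by move=> H x; rewrite -(pclsK x). Qed.

Lemma paddA : associative padd.
Proof.
elim/pres_ind_cls=> s; elim/pres_ind_cls=> t; elim/pres_ind_cls=> u.
by rewrite !padd_cls catA.
Qed.
Lemma paddC : commutative padd.
Proof.
elim/pres_ind_cls=> s; elim/pres_ind_cls=> t.
by rewrite !padd_cls; apply/pclsP; constructor.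
Qed.
Lemma padd0 : left_id pzero padd.
Proof. by elim/pres_ind_cls=> s; rewrite padd_cls. Qed.

Lemma fscaleDl a b s : presEq (fscale (a + b) s) (fscale a s ++ fscale b s).
Proof.
elim: s => [|[c x] s IH]; first exact: PresRefl.
apply: (@PresTrans _ ([:: (a * c, x); (b * c, x)] ++ (fscale a s ++ fscale b s))).
  apply: (@PresCat [:: _]) => //.
  by rewrite /= mulrDl; apply: PresSym; constructor.
rewrite /=; apply: (@PresCat [:: _] [:: _]); first exact: PresRefl.
rewrite -[_ :: fscale b s]cat1s catA.
by apply: (@PresCat (_ :: _) _ _ _); [exact: (@PresComm [:: _]) | exact: PresRefl].
Qed.

Lemma pscaleDl x : {morph pscale^~ x : a b / a + b >-> padd a b}.
Proof.
move=> a b /=; move: x; elim/pres_ind_cls=> s.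
by rewrite !pscale_cls padd_cls; apply/pclsP/fscaleDl.
Qed.
Lemma pscaleDr : right_distributive pscale padd.
Proof.
move=> a; elim/pres_ind_cls=> s; elim/pres_ind_cls=> t.
by rewrite !(padd_cls, pscale_cls) /fscale map_cat.
Qed.
Lemma pscaleA a b x : pscale a (pscale b x) = pscale (a * b) x.
Proof.
move: x; elim/pres_ind_cls=> s; rewrite !pscale_cls /fscale -map_comp.
by congr pcls; apply: eq_map => -[c x] /=; rewrite mulrA.
Qed.
Lemma pscale1 : left_id 1 pscale.
Proof.
elim/pres_ind_cls=> s; rewrite pscale_cls /fscale.
by rewrite (eq_map (g := id)) ?map_id // => -[c x] /=; rewrite mul1r.
Qed.
Lemma pscale0 x : pscale 0 x = pzero.
Proof.
move: x; elim/pres_ind_cls=> s; rewrite pscale_cls; apply/pclsP.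
elim: s => [|[c x] s IH]; first exact: PresRefl.
by apply: (@PresCat [:: _] [::]) => //=; rewrite mul0r; constructor.
Qed.
Lemma paddN : left_inverse pzero popp padd.
Proof.
by move=> x; rewrite /popp -{2}[x]pscale1 -pscaleDl addNr pscale0.
Qed.

HB.instance Definition _ := GRing.isZmodule.Build pres paddA paddC padd0 paddN.
HB.instance Definition _ := GRing.Zmodule_isLmodule.Build k pres
  pscaleA pscale1 pscaleDr pscaleDl.

(* The linear map on the presented module with prescribed values on generators;
   meaningful when f kills every relator, see plift_linear and plift_gen. *)
Definition plift (W : lmodType k) (f : X -> W) (x : pres) : W :=
  feval f (repr x).

Lemma feval_cat (W : lmodType k) (f : X -> W) s t :
  feval f (s ++ t) = feval f s + feval f t.
Proof. exact: big_cat. Qed.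
Lemma feval_scale (W : lmodType k) (f : X -> W) c s :
  feval f (fscale c s) = c *: feval f s.
Proof.
rewrite /feval /fscale big_map scaler_sumr.
by apply: eq_bigr => a _; rewrite scalerA.
Qed.

Definition respects (W : lmodType k) (f : X -> W) :=
  forall s, rel s -> feval f s = 0.

Section Lift.
Variables (W : lmodType k) (f : X -> W).
Hypothesis fP : respects f.

Lemma feval_presEq s t : presEq s t -> feval f s = feval f t.
Proof.
elim=> {s t} //.
- by move=> s t u _ -> _ ->.
- by move=> s1 s2 t1 t2 _ H1 _ H2; rewrite !feval_cat H1 H2.
- by move=> s t; rewrite !feval_cat addrC.
- by move=> c s t _ H; rewrite !feval_scale H.
- by move=> a b x; rewrite /feval !big_cons !big_nil /= !addr0 scalerDl.
- by move=> x; rewrite /feval big_cons !big_nil /= scale0r addr0.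
- by move=> s /fP ->; rewrite /feval big_nil.
Qed.

Lemma plift_cls s : plift f (pcls s) = feval f s.
Proof. by apply: feval_presEq; apply: repr_pcls. Qed.

Lemma plift_gen x : plift f (pgen x) = f x.
Proof. by rewrite plift_cls /feval big_seq1 scale1r. Qed.

Lemma plift_linear : linear (plift f).
Proof.
move=> a; elim/pres_ind_cls=> s; elim/pres_ind_cls=> t.
have -> : a *: pcls s + pcls t = pcls (fscale a s ++ t).
  by rewrite -padd_cls -pscale_cls.
by rewrite !plift_cls feval_cat feval_scale.
Qed.

End Lift.

Lemma pcls_gen s : pcls s = \sum_(a <- s) a.1 *: pgen a.2.
Proof.
elim: s => [|[c x] s IH]; first by rewrite big_nil.
rewrite big_cons -IH /= -cat1s -padd_cls; congr padd.
by rewrite -[RHS]/(pscale _ _) pscale_cls /fscale /= mulr1.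
Qed.

Lemma feval_gen s : feval pgen s = pcls s.
Proof. by rewrite pcls_gen. Qed.

Lemma respects_gen : respects pgen.
Proof. by move=> s rs; rewrite feval_gen; apply/pclsP; constructor. Qed.

Lemma pres_span (P : pres -> Prop) :
  P 0 -> (forall a x y, P y -> P (a *: pgen x + y)) -> forall x, P x.
Proof.
move=> P0 PS; elim/pres_ind_cls=> s; rewrite pcls_gen.
by elim: s => [|a s IH]; rewrite ?big_nil // big_cons; apply: PS.
Qed.

Lemma linear_presP (W : lmodType k) (f g : pres -> W) :
  linear f -> linear g -> (forall x, f (pgen x) = g (pgen x)) -> f =1 g.
Proof.
move=> lf lg fg x.
pose f' := GRing.isLinear.Build _ _ _ _ f lf.
pose g' := GRing.isLinear.Build _ _ _ _ g lg.
pose F : {linear pres -> W} := HB.pack f f'.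
pose G : {linear pres -> W} := HB.pack g g'.
rewrite -[f]/(F : _ -> _) -[g]/(G : _ -> _).
elim/pres_span: x => [|a x y IH]; first by rewrite !linear0.
by rewrite !linearP IH [F _]fg.
Qed.

End Presented.

Section Graded.
Variable k : fieldType.

(* A decomposition V = \bigoplus_p V^p, given by the projections V -> V^p. *)
Record grading (V : lmodType k) := Grading {
  gproj : int -> V -> V;
  gproj_linear : forall p, linear (gproj p);
  gproj_comp : forall p q v,
    gproj p (gproj q v) = if p == q then gproj q v else 0;
  gproj_sum : forall v, exists2 s : seq int, uniq s &
    v = \sum_(p <- s) gproj p v
}.

Record gvect := Gvect { gcar :> lmodType k; ggr : grading gcar }.

Definition homog (V : gvect) (p : int) (v : V) : bool := gproj (ggr V) p v == v.

(* V[n]^p = V^(n+p), on the same underlying space. *)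
Section Shift.
Variables (n : int) (V : gvect).

Let sproj (p : int) : V -> V := gproj (ggr V) (n + p).

Fact shift_comp p q v : sproj p (sproj q v) = if p == q then sproj q v else 0.
Proof. by rewrite /sproj gproj_comp (inj_eq (addrI n)). Qed.

Fact shift_sum v : exists2 s : seq int, uniq s & v = \sum_(p <- s) sproj p v.
Proof.
have [s us vE] := gproj_sum (ggr V) v.
exists [seq p - n | p <- s]; first by rewrite map_inj_uniq //; exact: addIr.
by rewrite big_map {1}vE; apply: eq_bigr => p _; rewrite /sproj addrC subrK.
Qed.

Definition shift : gvect :=
  Gvect (Grading (fun p => gproj_linear (ggr V) (n + p)) shift_comp shift_sum).

End Shift.

Definition has_degree (V W : gvect) (d : int) (f : V -> W) :=
  forall p v, homog p v -> homog (p + d) (f v).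

Definition koszul (p q : int) : k := (-1) ^+ (absz p * absz q)%N.

(* v |-> (-1)^|v| v *)
Definition parity (V : gvect) (v : V) : V :=
  \sum_(p <- s2val (cid2 (gproj_sum (ggr V) v))) koszul p 1 *: gproj (ggr V) p v.

Definition helt (V : gvect) := {x : int * V | homog x.1 x.2}.
Definition hdeg (V : gvect) (x : helt V) : int := (val x).1.
Definition hval (V : gvect) (x : helt V) : V := (val x).2.

Record gcalg := Gcalg {
  gcaA :> algType k;
  gcagr : grading gcaA;
  gca1 : gproj gcagr 0 1 = 1;
  gcaM : forall p q (a b : gcaA), gproj gcagr p a = a -> gproj gcagr q b = b ->
    gproj gcagr (p + q) (a * b) = a * b;
  gcaC : forall p q (a b : gcaA), gproj gcagr p a = a -> gproj gcagr q b = b ->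
    a * b = koszul p q *: (b * a)
}.

Definition gvect_of_gcalg (A : gcalg) : gvect := Gvect (gcagr A).

Lemma koszulD p p' q : koszul (p + p') q = koszul p q * koszul p' q.
Proof.
rewrite /koszul -exprD -mulnDl -signr_odd -[in RHS]signr_odd !oddM.
congr (_ ^+ (_ && _)).
by case: p p' => [p|p] [p'|p'] /=; rewrite ?oddD //=;
  rewrite -?(oddD, addnS) //; lia.
Qed.

Lemma koszulC p q : koszul p q = koszul q p.
Proof. by rewrite /koszul mulnC. Qed.

Lemma koszul0 q : koszul 0 q = 1. Proof. by []. Qed.

Lemma koszulK p q : koszul p q * koszul p q = 1.
Proof. by rewrite /koszul -expr2 sqrr_sign. Qed.

End Graded.

Coercion gvect_of_gcalg : gcalg >-> gvect.

Section Tensor.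
Variable k : fieldType.

Inductive tensRel (V W : lmodType k) : fsum k (V * W)%type -> Prop :=
| TensL a x y w :
    tensRel [:: (1, (a *: x + y, w)); (- a, (x, w)); (-1, (y, w))]
| TensR a v x y :
    tensRel [:: (1, (v, a *: x + y)); (- a, (v, x)); (-1, (v, y))].

Definition tens (V W : lmodType k) := pres (@tensRel V W).
HB.instance Definition _ V W := GRing.Lmodule.on (tens V W).

Definition tmk (V W : lmodType k) (v : V) (w : W) : tens V W := pgen _ (v, w).

Definition tlift (V W M : lmodType k) (f : V -> W -> M) : tens V W -> M :=
  plift (fun vw => f vw.1 vw.2).

End Tensor.

Section Sym.
Variables (k : fieldType) (V : gvect k).

(* Generators: words of homogeneous elements of V. *)
Inductive symRel : fsum k (seq (helt V)) -> Prop :=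
| SymLin s t a (x y z : helt V) :
    hdeg x = hdeg z -> hdeg y = hdeg z -> hval z = a *: hval x + hval y ->
    symRel [:: (1, s ++ z :: t); (- a, s ++ x :: t); (-1, s ++ y :: t)]
| SymSwap s t (x y : helt V) :
    symRel [:: (1, s ++ x :: y :: t);
               (- koszul k (hdeg x) (hdeg y), s ++ y :: x :: t)].

Definition sym := pres symRel.
HB.instance Definition _ := GRing.Lmodule.on sym.

Definition word (w : seq (helt V)) : sym := pgen _ w.
Definition slift (W : lmodType k) (f : seq (helt V) -> W) : sym -> W := plift f.

Lemma symRespectsP (W : lmodType k) (f : seq (helt V) -> W) :
  (forall s t a (x y z : helt V), hdeg x = hdeg z -> hdeg y = hdeg z ->
     hval z = a *: hval x + hval y ->
     f (s ++ z :: t) = a *: f (s ++ x :: t) + f (s ++ y :: t)) ->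
  (forall s t (x y : helt V),
     f (s ++ x :: y :: t) =
     koszul k (hdeg x) (hdeg y) *: f (s ++ y :: x :: t)) ->
  respects symRel f.
Proof.
move=> fL fS _ [s t a x y z xz yz zE|s t x y];
  rewrite /feval !big_cons big_nil /= addr0 scale1r ?scaleN1r scaleNr.
- by rewrite (fL _ _ _ _ _ _ xz yz zE) -opprD subrr.
- by rewrite fS subrr.
Qed.

Lemma wordL s t a (x y z : helt V) :
  hdeg x = hdeg z -> hdeg y = hdeg z -> hval z = a *: hval x + hval y ->
  word (s ++ z :: t) = a *: word (s ++ x :: t) + word (s ++ y :: t).
Proof.
move=> xz yz zE; have := respects_gen (SymLin s t xz yz zE).
rewrite /feval !big_cons big_nil /= addr0 scale1r scaleN1r scaleNr -opprD.
by move/subr0_eq.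
Qed.

Lemma wordS s t (x y : helt V) :
  word (s ++ x :: y :: t) =
  koszul k (hdeg x) (hdeg y) *: word (s ++ y :: x :: t).
Proof.
have := respects_gen (SymSwap s t x y).
rewrite /feval !big_cons big_nil /= addr0 scale1r scaleNr.
by move/subr0_eq.
Qed.

Lemma sym_eqP (W : lmodType k) (f g : sym -> W) :
  linear f -> linear g -> (forall w, f (word w) = g (word w)) -> f =1 g.
Proof. exact: linear_presP. Qed.

Section Slift.
Variables (W : lmodType k) (f : seq (helt V) -> W).
Hypothesis fP : respects symRel f.
Lemma slift_linear : linear (slift f). Proof. exact: plift_linear. Qed.
Lemma slift_word w : slift f (word w) = f w. Proof. exact: plift_gen. Qed.
End Slift.

Definition smul (x y : sym) : sym :=
  slift (fun v => slift (fun w => word (v ++ w)) y) x.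

Fact smul_respr v : respects symRel (fun w => word (v ++ w)).
Proof.
apply: symRespectsP => [s t a x y z xz yz zE|s t x y]; rewrite !catA.
- exact: wordL.
- exact: wordS.
Qed.

Fact smul_respl y : respects symRel (fun v => slift (fun w => word (v ++ w)) y).
Proof.
apply: symRespectsP => [s t a x x' z xz yz zE|s t x x'].
- apply: (sym_eqP (f := slift _) (g := fun y => a *: slift _ y + slift _ y)).
  + exact/slift_linear/smul_respr.
  + move=> b u v; rewrite !(slift_linear (smul_respr _)) !scalerDr !scalerA.
    by rewrite [a * b]mulrC addrACA.
  + move=> w; rewrite !(slift_word (smul_respr _)) -!catA.
    exact: wordL.
- apply: (sym_eqP (f := slift _) (g := fun y => _ *: slift _ y)).
  + exact/slift_linear/smul_respr.
  + move=> b u v; rewrite !(slift_linear (smul_respr _)) !scalerDr !scalerA.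
    by rewrite [_ * b]mulrC.
  + move=> w; rewrite !(slift_word (smul_respr _)) -!catA.
    exact: wordS.
Qed.

Lemma smul_word v w : smul (word v) (word w) = word (v ++ w).
Proof. by rewrite /smul (slift_word (smul_respl _)) (slift_word (smul_respr _)). Qed.

Lemma smul_linl y : linear (smul^~ y).
Proof. exact/slift_linear/smul_respl. Qed.

Lemma smul_linr x : linear (smul x).
Proof.
move=> a y z; move: x; apply: (sym_eqP (g := fun x => a *: smul x y + smul x z)).
- exact: smul_linl.
- move=> b u v; rewrite /= !(smul_linl _ b u v) !scalerDr !scalerA.
  by rewrite [a * b]mulrC addrACA.
- by move=> w; rewrite /smul !(slift_word (smul_respl _)) (slift_linear (smul_respr _)).
Qed.

Lemma linear_comp (A B C : lmodType k) (f : B -> C) (g : A -> B) :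
  linear f -> linear g -> linear (fun x => f (g x)).
Proof. by move=> lf lg a x y; rewrite lg lf. Qed.

Lemma smulA : associative smul.
Proof.
move=> x y z; move: x.
apply: (sym_eqP (f := fun x => smul x (smul y z))
                (g := fun x => smul (smul x y) z)) => [||v].
- exact: smul_linl.
- exact: (linear_comp (smul_linl z) (smul_linl y)).
move: y; apply: (sym_eqP (f := fun y => smul (word v) (smul y z))
                (g := fun y => smul (smul (word v) y) z)) => [||w].
- exact: (linear_comp (smul_linr _) (smul_linl z)).
- exact: (linear_comp (smul_linl z) (smul_linr _)).
move: z; apply: sym_eqP => [||u].
- exact: (linear_comp (smul_linr _) (smul_linr _)).
- exact: smul_linr.
by rewrite !smul_word catA.
Qed.

Lemma smul1x : left_id (word [::]) smul.
Proof.
apply: (sym_eqP (g := idfun)) => [||w]; [exact: smul_linr | by [] |].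
by rewrite smul_word.
Qed.

Lemma smulx1 : right_id (word [::]) smul.
Proof.
move=> x; move: x; apply: (sym_eqP (f := smul^~ _) (g := idfun)) => [||w].
- exact: smul_linl.
- by [].
- by rewrite smul_word cats0.
Qed.

Lemma smulDl : left_distributive smul +%R.
Proof. by move=> x y z; have := smul_linl z 1 x y; rewrite !scale1r. Qed.
Lemma smulDr : right_distributive smul +%R.
Proof. by move=> x y z; have := smul_linr x 1 y z; rewrite !scale1r. Qed.

(* The counit, i.e. the projection onto S^0(V) = k. *)
Definition counit : sym -> k^o := slift (fun w => (w == [::])%:R : k^o).

Fact counit_resp : respects symRel (fun w => (w == [::])%:R : k^o).
Proof.
by apply: symRespectsP => [[|? ?] t a x y z _ _ _|[|? ?] t x y];
  rewrite /= ?addr0 scaler0.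
Qed.

Fact sym1_neq0 : word [::] != 0.
Proof.
apply/eqP => /(congr1 counit); rewrite /counit (slift_word counit_resp) eqxx.
have := slift_linear counit_resp (-1) 0 0.
rewrite scaler0 addr0 scaleN1r addNr => -> /eqP.
by rewrite oner_eq0.
Qed.

HB.instance Definition _ := GRing.Zmodule_isNzRing.Build sym
  smulA smul1x smulx1 smulDl smulDr sym1_neq0.

Fact sscalerAl (a : k) (u v : sym) : a *: (u * v) = (a *: u) * v.
Proof.
have /= := smul_linl v a u 0; rewrite addr0 -[smul 0 v]/(0 * v) mul0r addr0.
exact: esym.
Qed.
HB.instance Definition _ := GRing.Lmodule_isLalgebra.Build k sym sscalerAl.

Fact sscalerAr (a : k) (u v : sym) : a *: (u * v) = u * (a *: v).
Proof.
have /= := smul_linr u a v 0; rewrite addr0 -[smul u 0]/(u * 0) mulr0 addr0.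
exact: esym.
Qed.
HB.instance Definition _ := GRing.Lalgebra_isAlgebra.Build k sym sscalerAr.

Lemma wordM v w : word v * word w = word (v ++ w).
Proof. exact: smul_word. Qed.

(* The projection onto the symmetric power S^n(V). *)
Definition wproj (n : nat) : sym -> sym :=
  slift (fun w => if size w == n then word w else 0).

Definition wdeg (w : seq (helt V)) : int := \sum_(x <- w) hdeg x.

Definition sproj (p : int) : sym -> sym :=
  slift (fun w => if wdeg w == p then word w else 0).

Fact sproj_resp p : respects symRel (fun w => if wdeg w == p then word w else 0).
Proof.
apply: symRespectsP => [s t a x y z xz yz zE|s t x y].
- rewrite /wdeg !big_cat !big_cons /= xz yz.
  by case: eqP => _; rewrite 1?(wordL _ _ xz yz zE) // scaler0 addr0.
- rewrite /wdeg !big_cat !big_cons /= [hdeg y + (hdeg x + _)]addrCA.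
  by case: eqP => _; rewrite 1?wordS // scaler0.
Qed.

Lemma sproj_word p w : sproj p (word w) = if wdeg w == p then word w else 0.
Proof. exact/slift_word/sproj_resp. Qed.

Fact sproj_linear p : linear (sproj p).
Proof. exact/slift_linear/sproj_resp. Qed.

Lemma linear0_of (A B : lmodType k) (f : A -> B) : linear f -> f 0 = 0.
Proof.
by move=> lf; have := lf (-1) 0 0; rewrite scaler0 addr0 scaleN1r addNr.
Qed.

Fact sproj_comp p q x : sproj p (sproj q x) = if p == q then sproj q x else 0.
Proof.
move: x; apply: (sym_eqP (f := fun x => sproj p (sproj q x))
   (g := fun x => if p == q then sproj q x else 0)) => [||w].
- exact: (linear_comp (sproj_linear p) (sproj_linear q)).
- by case: eqP => _; [exact: sproj_linear | move=> a u v; rewrite scaler0 addr0].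
rewrite !sproj_word; case: (wdeg w =P q) => [<-|_].
  by rewrite sproj_word eq_sym.
by rewrite (linear0_of (sproj_linear p)) if_same.
Qed.

Fact sproj_sum x : exists2 s : seq int, uniq s & x = \sum_(p <- s) sproj p x.
Proof.
rewrite -(pclsK x) pcls_gen; set s := repr x.
exists (undup [seq wdeg a.2 | a <- s]); first exact: undup_uniq.
have prE p (r : seq (k * seq (helt V))) :
    sproj p (\sum_(a <- r) a.1 *: word a.2) =
    \sum_(a <- r) a.1 *: sproj p (word a.2).
  elim: r => [|a r IH]; first by rewrite !big_nil (linear0_of (sproj_linear p)).
  by rewrite !big_cons sproj_linear IH.
under [RHS]eq_bigr do rewrite prE.
rewrite exchange_big big_seq [RHS]big_seq; apply: eq_bigr => a ars /=.
rewrite -scaler_sumr; congr (_ *: _).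
rewrite (bigD1_seq (wdeg a.2)) ?undup_uniq ?mem_undup //=; last exact: (map_f (fun a => wdeg a.2) ars).
rewrite sproj_word eqxx big1 ?addr0 // => p pa.
by rewrite sproj_word eq_sym (negbTE pa).
Qed.

Definition sym_grading : grading sym := Grading sproj_linear sproj_comp sproj_sum.

Fact sproj1 : sproj 0 1 = 1.
Proof. by rewrite [LHS]sproj_word /wdeg big_nil. Qed.

Fact sprojM p q (a b : sym) : sproj p a = a -> sproj q b = b ->
  sproj (p + q) (a * b) = a * b.
Proof.
move=> <- <-; move: a; apply: (sym_eqP
   (f := fun a => sproj (p + q) (sproj p a * sproj q b))
   (g := fun a => sproj p a * sproj q b)) => [||v].
- apply: (linear_comp (sproj_linear _)).
  exact: (linear_comp (smul_linl _) (sproj_linear _)).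
- exact: (linear_comp (smul_linl _) (sproj_linear _)).
move: b; apply: (sym_eqP
   (f := fun b => sproj (p + q) (sproj p (word v) * sproj q b))
   (g := fun b => sproj p (word v) * sproj q b)) => [||w].
- apply: (linear_comp (sproj_linear _)).
  exact: (linear_comp (smul_linr _) (sproj_linear _)).
- exact: (linear_comp (smul_linr _) (sproj_linear _)).
rewrite !sproj_word; case: eqP => [vp|_]; case: eqP => [wq|_];
  rewrite ?(mul0r, mulr0, linear0_of (sproj_linear _)) //.
by rewrite wordM sproj_word /wdeg big_cat -/(wdeg v) -/(wdeg w) vp wq eqxx.
Qed.

Lemma wordC v w : word (v ++ w) = koszul k (wdeg v) (wdeg w) *: word (w ++ v).
Proof.
have swap1 x s t u : word (s ++ x :: t ++ u) =
    koszul k (hdeg x) (wdeg t) *: word (s ++ t ++ x :: u).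
  elim: t s => [|y t IH] s.
    by rewrite /wdeg big_nil koszulC koszul0 scale1r.
  rewrite /= wordS -cat_rcons IH scalerA cat_rcons; congr (_ *: _).
  by rewrite ![koszul k (hdeg x) _]koszulC /wdeg big_cons koszulD.
elim: v w => [|x v IH] w; first by rewrite /wdeg big_nil koszul0 scale1r cats0.
have -> : (x :: v) ++ w = [:: x] ++ (v ++ w) by [].
rewrite -wordM IH -scalerAr wordM cat1s -[x :: w ++ v]cat0s swap1 scalerA.
by rewrite /wdeg big_cons koszulD mulrC.
Qed.

Fact sprojC p q (a b : sym) : sproj p a = a -> sproj q b = b ->
  a * b = koszul k p q *: (b * a).
Proof.
move=> <- <-; move: a; apply: (sym_eqP
   (f := fun a => sproj p a * sproj q b)
   (g := fun a => koszul k p q *: (sproj q b * sproj p a))) => [||v].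
- exact: (linear_comp (smul_linl _) (sproj_linear _)).
- move=> c u v; rewrite sproj_linear mulrDr -scalerAr scalerDr !scalerA.
  by rewrite [c * _]mulrC.
move: b; apply: (sym_eqP
   (f := fun b => sproj p (word v) * sproj q b)
   (g := fun b => koszul k p q *: (sproj q b * sproj p (word v)))) => [||w].
- exact: (linear_comp (smul_linr _) (sproj_linear _)).
- move=> c u u'; rewrite sproj_linear mulrDl -scalerAl scalerDr !scalerA.
  by rewrite [c * _]mulrC.
rewrite !sproj_word; case: eqP => [<-|_]; case: eqP => [<-|_];
  rewrite ?(mul0r, mulr0, scaler0) //.
by rewrite !wordM wordC.
Qed.

Definition symalg : gcalg k := @Gcalg k sym sym_grading sproj1 sprojM sprojC.

End Sym.

(* The algebra morphism S(V) -> S(W) induced by a linear map V -> W of degree d;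
   for d = +-2 and the identity map this is the double (de)suspension. *)
Section SymMap.
Variables (k : fieldType) (V W : gvect k) (d : int) (f : V -> W).
Hypothesis fd : has_degree d f.

Definition helt_map (x : helt V) : helt W :=
  exist (fun y : int * W => homog y.1 y.2) (hdeg x + d, f (hval x)) (fd (valP x)).

Definition sym_map : sym V -> sym W := slift (fun w => word (map helt_map w)).

End SymMap.

Section Coalgebra.
Variables (k : fieldType) (V : gvect k).

(* x_s(1), ..., x_s(m) *)
Definition rearr (w : seq (helt V)) (s : 'S_(size w)) : seq (helt V) :=
  [seq tnth (in_tuple w) (s i) | i <- enum 'I_(size w)].

(* The Koszul sign: x_1 ... x_m = ksgn * x_s(1) ... x_s(m). *)
Definition ksgn (w : seq (helt V)) (s : 'S_(size w)) : k :=
  \prod_(i < size w) \prod_(j < size w | (i < j)%N && (s j < s i)%N)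
    koszul k (hdeg (tnth (in_tuple w) (s i))) (hdeg (tnth (in_tuple w) (s j))).

Definition is_shuffle (n m : nat) (s : 'S_m) : bool :=
  [forall i : 'I_m, forall j : 'I_m,
    ((i < j)%N && ((j < n)%N || (n <= i)%N)) ==> (s i < s j)%N].

Definition comult : sym V -> tens (sym V) (sym V) :=
  slift (fun w => \sum_(n < (size w).+1) \sum_(s : 'S_(size w) | is_shuffle n s)
    ksgn s *: tmk (word (take n (rearr s))) (word (drop n (rearr s)))).

Definition is_coderivation (D : sym V -> sym V) : Prop :=
  [/\ linear D, has_degree (V := symalg V) (W := symalg V) 1 D &
      forall x, comult (D x) =
        tlift (fun a b => tmk (D a) b + tmk (parity (V := symalg V) a) (D b))
              (comult x)].

(* The coderivation extending a component l : S^n(V) -> V = S^1(V), where l is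
   given by its values on words of length n. *)
Definition codext_word (n : nat) (l : seq (helt V) -> sym V) w : sym V :=
  if (n <= size w)%N then
    \sum_(s : 'S_(size w) | is_shuffle n s)
      ksgn s *: (l (take n (rearr s)) * word (drop n (rearr s)))
  else 0.

Definition codext n l : sym V -> sym V := slift (codext_word n l).

Definition in_pow (n : nat) (x : sym V) : Prop := wproj n x = x.

End Coalgebra.

Definition is_coalg_morphism (k : fieldType) (V W : gvect k)
    (Phi : sym V -> sym W) : Prop :=
  [/\ linear Phi, has_degree (V := symalg V) (W := symalg W) 0 Phi,
      forall x, comult (Phi x) = tlift (fun a b => tmk (Phi a) (Phi b)) (comult x) &
      forall x, counit (Phi x) = counit x].

(* Objects and arrows are cut out by predicates from ambient types. *)
Record precategory := Precategory {
  obj : Type;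
  is_obj : obj -> Prop;
  arr : obj -> obj -> Type;
  is_arr : forall X Y, arr X Y -> Prop;
  idarr : forall X, arr X X;
  comp : forall X Y Z, arr Y Z -> arr X Y -> arr X Z
}.
Arguments is_obj : clear implicits.
Arguments arr : clear implicits.
Arguments idarr : clear implicits.
Arguments comp {p X Y Z}.

Definition is_category (C : precategory) : Prop :=
  [/\ forall X, is_obj C X -> is_arr (idarr C X),
      forall X Y Z (g : arr C Y Z) (f : arr C X Y),
        is_obj C X -> is_obj C Y -> is_obj C Z ->
        is_arr g -> is_arr f -> is_arr (comp g f),
      forall X Y (f : arr C X Y), is_obj C X -> is_obj C Y -> is_arr f ->
        comp f (idarr C X) = f /\ comp (idarr C Y) f = f &
      forall X Y Z T (h : arr C Z T) (g : arr C Y Z) (f : arr C X Y),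
        is_obj C X -> is_obj C Y -> is_obj C Z -> is_obj C T ->
        is_arr h -> is_arr g -> is_arr f ->
        comp h (comp g f) = comp (comp h g) f].

Definition full_sub (C : precategory) (P : obj C -> Prop) : precategory :=
  @Precategory (obj C) (fun X => is_obj C X /\ P X) (arr C)
    (@is_arr C) (idarr C) (@comp C).

Record prefunctor (C D : precategory) := Prefunctor {
  fobj : obj C -> obj D;
  farr : forall X Y, arr C X Y -> arr D (fobj X) (fobj Y)
}.

Definition is_functor (C D : precategory) (F : prefunctor C D) : Prop :=
  [/\ forall X, is_obj C X -> is_obj D (fobj F X),
      forall X Y (f : arr C X Y), is_obj C X -> is_obj C Y -> is_arr f ->
        is_arr (farr F f),
      forall X, is_obj C X -> farr F (idarr C X) = idarr D (fobj F X) &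
      forall X Y Z (g : arr C Y Z) (f : arr C X Y),
        is_obj C X -> is_obj C Y -> is_obj C Z -> is_arr g -> is_arr f ->
        farr F (comp g f) = comp (farr F g) (farr F f)].

Definition idfunctor (C : precategory) : prefunctor C C :=
  @Prefunctor C C id (fun X Y f => f).

Definition compfunctor (C D E : precategory) (G : prefunctor D E)
    (F : prefunctor C D) : prefunctor C E :=
  @Prefunctor C E (fun X => fobj G (fobj F X)) (fun X Y f => farr G (farr F f)).

Definition corestrict (C D : precategory) (P : obj D -> Prop)
    (F : prefunctor C D) : prefunctor C (full_sub P) :=
  @Prefunctor C (full_sub P) (fobj F) (@farr C D F).

Definition nat_iso (C D : precategory) (F G : prefunctor C D) : Prop :=
  exists (eta : forall X, arr D (fobj F X) (fobj G X))
         (eta' : forall X, arr D (fobj G X) (fobj F X)),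
    (forall X, is_obj C X ->
      [/\ is_arr (eta X), is_arr (eta' X),
          comp (eta' X) (eta X) = idarr D (fobj F X) &
          comp (eta X) (eta' X) = idarr D (fobj G X)]) /\
    (forall X Y (f : arr C X Y), is_obj C X -> is_obj C Y -> is_arr f ->
      comp (farr G f) (eta X) = comp (eta Y) (farr F f)).

Definition weak_inverse (C D : precategory)
    (F : prefunctor C D) (G : prefunctor D C) : Prop :=
  nat_iso (idfunctor C) (compfunctor G F) /\
  nat_iso (compfunctor F G) (idfunctor D).

Definition is_equivalence (C D : precategory) (F : prefunctor C D) : Prop :=
  is_functor F /\
  exists G : prefunctor D C, is_functor G /\ weak_inverse F G.

Section LInfinity.
Variable k : fieldType.

Record linf_data := LinfData {
  linfV : gvect k;
  linfD : sym (shift 1 linfV) -> sym (shift 1 linfV)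
}.

Arguments linfD : clear implicits.

Definition is_linf (g : linf_data) : Prop :=
  [/\ is_coderivation (linfD g), forall x, linfD g (linfD g x) = 0 &
      linfD g 1 = 0].

Definition linf_arr (g h : linf_data) :=
  sym (shift 1 (linfV g)) -> sym (shift 1 (linfV h)).

Definition is_linf_morphism (g h : linf_data) (Phi : linf_arr g h) : Prop :=
  [/\ is_coalg_morphism Phi, forall x, Phi (linfD g x) = linfD h (Phi x) &
      Phi 1 = 1].

Definition Linf : precategory :=
  @Precategory linf_data is_linf linf_arr is_linf_morphism
    (fun g x => x) (fun g h i Psi Phi x => Psi (Phi x)).

End LInfinity.

Arguments linfD {k}.

Section BVInfinity.
Variable k : fieldType.

(* A continuous k[[hbar]]-linear map V[[hbar]] -> W[[hbar]] is given by its
   restriction Phi : V -> W[[hbar]], where Phi v n is the coefficient of hbar^n. *)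
Definition hmap (V W : Type) := V -> nat -> W.

Definition hext (V W : gvect k) (Phi : hmap V W) (f : nat -> V) : nat -> W :=
  fun n => \sum_(i < n.+1) Phi (f (n - i)%N) i.

Definition hcomp (U V W : gvect k) (Psi : hmap V W) (Phi : hmap U V) : hmap U W :=
  fun u => hext Psi (Phi u).

Definition hlinear (V W : gvect k) (Phi : hmap V W) : Prop :=
  forall n, linear (fun v => Phi v n).

(* hbar has degree 2 *)
Definition hdegree (V W : gvect k) (d : int) (Phi : hmap V W) : Prop :=
  forall n : nat, has_degree (d - n.*2%:Z) (fun v => Phi v n).

(* [[...[P, L_(a_1)], ...], L_(a_r)] for P of degree d and s listing the pairs
   (|a_i|, a_i). *)
Fixpoint nested_comm (A : gcalg k) (d : int) (P : A -> A) (s : seq (int * A))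
    : A -> A :=
  if s is (p, a) :: s' then
    nested_comm (d + p) (fun b => P (a * b) - koszul k d p *: (a * P b)) s'
  else P.

(* P, homogeneous of degree d, is a differential operator of order <= n. *)
Definition is_diffop (A : gcalg k) (d : int) (n : nat) (P : A -> A) : Prop :=
  linear P /\
  forall s : seq (int * A), size s = n.+1 ->
    all (fun pa => homog (V := A) pa.1 pa.2) s ->
    forall b, nested_comm d P s b = 0.

(* Delta = 1/hbar \sum_(n >= 1) hbar^n Delta_n, so Delta_(n+1) is the
   coefficient of hbar^n. *)
Definition is_bv (A : gcalg k) (Delta : hmap A A) : Prop :=
  [/\ hlinear (V := A) (W := A) Delta, hdegree (V := A) (W := A) 1 Delta,
      forall n : nat, is_diffop (1 - n.*2%:Z) n.+1 (fun a => Delta a n),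
      forall a n, hcomp (U := A) (V := A) (W := A) Delta Delta a n = 0 &
      forall n, Delta 1 n = 0].

Definition is_pure_bv (U : gvect k) (Delta : hmap (sym U) (sym U)) : Prop :=
  is_bv (A := symalg U) Delta /\
  forall (n j : nat) (x : sym U), in_pow j x ->
    (j = n.+1 -> in_pow 1 (Delta x n)) /\ ((j < n.+1)%N -> Delta x n = 0).

(* The commutative power series product and unit of A[[hbar]]. *)
Definition hmul (A : gcalg k) (f g : nat -> A) : nat -> A :=
  fun n => \sum_(i < n.+1) f i * g (n - i)%N.
Definition hone (A : gcalg k) : nat -> A := fun n => (n == 0%N)%:R.

(* \sum_r c_r \sum_(i_1 + ... + i_r = m) 1/(i_1! ... i_r!)
     \sum_s ksgn s * phi(x_s(1) ... x_s(i_1)) ... phi(... x_s(m)) *)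
Definition block_sum (U : gvect k) (A : gcalg k) (c : nat -> k)
    (phi : hmap (sym U) A) (w : seq (helt U)) : nat -> A := fun n =>
  \sum_(1 <= r < (size w).+1) c r *:
  \sum_(t : r.-tuple 'I_(size w).+1 |
        all (fun i : 'I__ => 0 < i)%N t && (sumn [seq val i | i <- t] == size w))
    (\prod_(i <- t) (i`!%:R : k)^-1) *:
  \sum_(s : 'S_(size w)) ksgn s *:
    (\big[@hmul A/hone A]_(b <- reshape [seq val i | i <- t] (rearr s))
       phi (word b)) n.

Definition hexp (U : gvect k) (A : gcalg k) (phi : hmap (sym U) A)
    : hmap (sym U) A := fun x n =>
  slift (fun w => if w is [::] then hone A n
                  else block_sum (fun r => (r`!%:R)^-1) phi w n) x.

Definition hlog (U : gvect k) (A : gcalg k) (Phi : hmap (sym U) A)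
    : hmap (sym U) A := fun x n =>
  slift (fun w => if w is [::] then 0
                  else block_sum (fun r => (-1) ^+ r.-1 / r%:R) Phi w n) x.

Definition is_bv_morphism (U : gvect k) (Delta : hmap (sym U) (sym U))
    (A : gcalg k) (Delta' : hmap A A) (phi : hmap (sym U) A) : Prop :=
  [/\ hlinear (V := symalg U) (W := A) phi,
      hdegree (V := symalg U) (W := A) 0 phi,
      forall n, phi 1 n = 0,
      hcomp (U := symalg U) (V := symalg U) (W := A) (hexp phi) Delta =
      hcomp (U := symalg U) (V := A) (W := A) Delta' (hexp phi) &
      forall (n j : nat) (x : sym U), (n.+1 < j)%N -> in_pow j x -> phi x n = 0].

Definition is_pure_map (U U' : gvect k) (phi : hmap (sym U) (sym U')) : Prop :=
  forall (n j : nat) (x : sym U), in_pow j x ->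
    (j = n.+1 -> in_pow 1 (phi x n)) /\ (j <> n.+1 -> phi x n = 0).

Record bv_data := BvData {
  bvU : gvect k;
  bvDelta : hmap (sym bvU) (sym bvU)
}.

Arguments bvDelta : clear implicits.

Definition bv_arr (X Y : bv_data) := hmap (sym (bvU X)) (sym (bvU Y)).

Definition bv_id (X : bv_data) : bv_arr X X :=
  fun x n => if n is 0%N then wproj 1 x else 0.

Definition bv_comp (X Y Z : bv_data) (psi : bv_arr Y Z) (phi : bv_arr X Y)
    : bv_arr X Z :=
  hlog (A := symalg (bvU Z))
    (hcomp (U := symalg (bvU X)) (V := symalg (bvU Y)) (W := symalg (bvU Z))
       (hexp (A := symalg (bvU Z)) psi) (hexp (A := symalg (bvU Y)) phi)).

Definition BVfree : precategory :=
  @Precategory bv_data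
    (fun X => is_bv (A := symalg (bvU X)) (bvDelta X)) bv_arr
    (fun X Y phi =>
       is_bv_morphism (A := symalg (bvU Y)) (bvDelta X) (bvDelta Y) phi /\
       is_pure_map phi)
    bv_id bv_comp.

Definition PureBV : precategory :=
  @full_sub BVfree (fun X => is_pure_bv (bvDelta X)).

End BVInfinity.

Arguments bvDelta {k}.

Section Functors.
Variable k : fieldType.

Fact susp_degree (g : gvect k) :
  has_degree (V := shift 1 g) (W := shift (-1) g) 2 (fun v => v).
Proof.
move=> p v; rewrite /homog /=.
by have -> : -1 + (p + 2) = 1 + p :> int by lia.
Qed.
Fact desusp_degree (g : gvect k) :
  has_degree (V := shift (-1) g) (W := shift 1 g) (-2) (fun v => v).
Proof.
move=> p v; rewrite /homog /=.
by have -> : 1 + (p - 2) = -1 + p :> int by lia.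
Qed.
Fact up_degree (U : gvect k) :
  has_degree (V := U) (W := shift 1 (shift 1 U)) (-2) (fun v => v).
Proof.
move=> p v; rewrite /homog /=.
by have -> : 1 + (1 + (p - 2)) = p :> int by lia.
Qed.
Fact down_degree (U : gvect k) :
  has_degree (V := shift 1 (shift 1 U)) (W := U) 2 (fun v => v).
Proof.
move=> p v; rewrite /homog /=.
by have -> : p + 2 = 1 + (1 + p) :> int by lia.
Qed.

(* S(g[1]) <-> S(g[-1]) *)
Definition susp (g : gvect k) := sym_map (@susp_degree g).
Definition desusp (g : gvect k) := sym_map (@desusp_degree g).
(* S(U) <-> S(U[2]) *)
Definition up (U : gvect k) := sym_map (@up_degree U).
Definition down (U : gvect k) := sym_map (@down_degree U).

(* g |-> S(g[-1]), Delta_n = D_n with D_n extending the component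
   l_n : S^n(g[1]) -> g[1] of D *)
Definition bv_of_linf_obj (g : obj (Linf k)) : obj (BVfree k) :=
  @BvData k (shift (-1) (linfV g)) (fun x n =>
    susp (codext n.+1 (fun w => wproj 1 (linfD g (word w))) (desusp x))).

Definition bv_of_linf_arr (g h : obj (Linf k)) (Phi : arr (Linf k) g h)
    : arr (BVfree k) (bv_of_linf_obj g) (bv_of_linf_obj h) :=
  fun x n => susp (wproj 1 (Phi (wproj n.+1 (desusp x)))).

Definition bv_of_linf : prefunctor (Linf k) (BVfree k) :=
  Prefunctor bv_of_linf_arr.

Definition pure_bv_of_linf : prefunctor (Linf k) (PureBV k) :=
  corestrict (fun X : obj (BVfree k) => is_pure_bv (bvDelta X)) bv_of_linf.

(* l_n(a_1, ..., a_n) = [[...[Delta_n, L_(a_1)], ...], L_(a_n)] 1, n >= 1 *)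
Definition derived_bracket (U : gvect k) (Delta : hmap (sym U) (sym U))
    (n : nat) (w : seq (helt U)) : sym U :=
  nested_comm (A := symalg U) (3 - n.*2%:Z) (fun x => Delta x n.-1)
    [seq (hdeg a, word [:: a]) | a <- w] 1.

Definition linf_of_bv_obj (X : obj (PureBV k)) : obj (Linf k) :=
  @LinfData k (shift 1 (bvU X)) (slift (fun w =>
    \sum_(1 <= n < (size w).+1)
      codext_word n (fun v => up (derived_bracket (bvDelta X) n
                                    (map (helt_map (@down_degree (bvU X))) v)))
                    w)).

(* \sum_n phi_n; as phi_n vanishes outside S^n(U), only the terms with
   n <= m contribute on S^m(U). *)
Definition hsum (U U' : gvect k) (phi : hmap (sym U) (sym U')) : sym U -> sym U' :=
  slift (fun w => \sum_(n < size w) phi (word w) n).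

(* The coalgebra morphism S(U[2]) -> S(U'[2]) with projection \sum_n phi_n. *)
Definition linf_of_bv_arr (X Y : obj (PureBV k)) (phi : arr (PureBV k) X Y)
    : arr (Linf k) (linf_of_bv_obj X) (linf_of_bv_obj Y) :=
  xget (fun _ => 0)
    [set Phi : sym (shift 1 (shift 1 (bvU X))) -> sym (shift 1 (shift 1 (bvU Y))) |
      [/\ is_coalg_morphism Phi, Phi 1 = 1 &
          forall x, wproj 1 (Phi x) = up (hsum phi (down x))]]%classic.

Definition linf_of_bv : prefunctor (PureBV k) (Linf k) :=
  Prefunctor linf_of_bv_arr.

End Functors.

(* Main.v *)
(* The double suspension identifies both sides with the cofree coalgebra S(U[2]),
   and hbar only records how much an operator lowers the word length: for a
   length-nonincreasing map Psi of symmetric coalgebras, let H(Psi) be the series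
   whose coefficient of hbar^n on S^m is the component S^m -> S^(m-n) of Psi.
   Then H(Psi Phi) = H(Psi) H(Phi), H is injective, and exp H = H exp, log H = H log.

   Coalgebra morphisms Phi satisfy exp(p Phi) = Phi and log(Phi) = p Phi, where p is
   the projection onto cogenerators, since convolution powers commute with Phi; and
   exp(phi) is a coalgebra morphism when phi takes values in the cogenerators.  So pure
   BV morphisms are exactly the log H(Phi), composed as the Phi are.

   A coderivation D is the coextension of p D, and the coefficients of H(D) are
   differential operators of the right order since commuting \sum +-l(x')x'' with the
   multiplication by a replaces l by l(a' -), a' <> 1.  Conversely a differential
   operator of order <= n is determined on S^(<=n), so every pure BV operator is
   H(D) for the coderivation D built from its derived brackets. *)

Require Import Defs.
From HB Require Import structures.
From mathcomp Require Import all_boot all_algebra perm.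
From mathcomp Require Import zify ring.
From mathcomp Require Import boolp classical_sets.

Set Implicit Arguments.
Unset Strict Implicit.
Unset Printing Implicit Defensive.

Import GRing.Theory.
Local Open Scope ring_scope.

(** * Linear maps and tensors *)

(** The definitions sum over permutations, shuffles and compositions, none of which suits induction
    on a word. All these sums are rewritten through [ssum], which sends the first letter to the left
    or to the right block; coassociativity, cocommutativity and all signs then follow letter by
    letter. The translation works with lists of positions instead of letters, because letters may
    repeat while inversions must be decided. In this form prepending a letter acts as a derivation
    on convolution powers, so the exponential satisfies a first-order recursion, and its
    compatibility with the coproduct needs no set partitions.

    Characteristic zero enters twice: factorials and the denominators of the logarithm are inverted,
    and 2 ^ n differs from 2 for n <> 1, which forces primitive elements into S^1 and so makes a
    coderivation unique given its corestriction.

    The double suspension is abstracted as [eshift], with V and U independent. The pairs g[1], g[-1]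
    and U[2], U are two instances, and the comparison isomorphisms of the equivalence arise by using
    different instances at the two ends of one map. *)

Section LinearPredicate.
Variables (R : fieldType) (A B : lmodType R).
Implicit Types (f g : A -> B).

Lemma lin0 f : linear f -> f 0 = 0. Proof. exact: linear0_of. Qed.
Lemma linD f : linear f -> {morph f : x y / x + y}.
Proof. by move=> lf x y; have := lf 1 x y; rewrite !scale1r. Qed.
Lemma linZ f c : linear f -> {morph f : x / c *: x}.
Proof. by move=> lf x; have := lf c x 0; rewrite !addr0 lin0 // addr0. Qed.
Lemma linB f : linear f -> {morph f : x y / x - y}.
Proof. by move=> lf x y; rewrite -!scaleN1r (linD lf) (linZ _ lf). Qed.
Lemma lin_sum f I (r : seq I) (P : pred I) (F : I -> A) : linear f ->
  f (\sum_(i <- r | P i) F i) = \sum_(i <- r | P i) f (F i).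
Proof. by move=> lf; apply: (big_morph f (linD lf) (lin0 lf)). Qed.
Lemma lin_if f (b : bool) x : linear f -> f (if b then x else 0) = if b then f x else 0.
Proof. by move=> lf; case: b; rewrite ?lin0. Qed.

Lemma linear_add f g : linear f -> linear g -> linear (fun x => f x + g x).
Proof. by move=> lf lg a x y; rewrite lf lg scalerDr addrACA. Qed.
Lemma linear_sub f g : linear f -> linear g -> linear (fun x => f x - g x).
Proof. by move=> lf lg a x y; rewrite lf lg scalerBr opprD addrACA. Qed.
Lemma linear_scale f c : linear f -> linear (fun x => c *: f x).
Proof. by move=> lf a x y; rewrite lf scalerDr !scalerA mulrC. Qed.
Lemma linear_zero : linear (fun _ : A => 0 : B).
Proof. by move=> a x y; rewrite scaler0 addr0. Qed.
Lemma linear_suml I (r : seq I) (P : pred I) (F : I -> A -> B) :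
  (forall i, linear (F i)) -> linear (fun x => \sum_(i <- r | P i) F i x).
Proof.
move=> lF a x y; rewrite scaler_sumr -big_split /=.
by apply: eq_bigr => i _; rewrite lF.
Qed.
Lemma linear_cond f (b : bool) : linear f -> linear (fun x => if b then f x else 0).
Proof. by case: b => // _; apply: linear_zero. Qed.

End LinearPredicate.

Lemma linear_mull (R : fieldType) (A : lmodType R) (B : algType R) (f : A -> B) b :
  linear f -> linear (fun x => b * f x).
Proof. by move=> lf a x y; rewrite lf mulrDr scalerAr. Qed.
Lemma linear_mulr (R : fieldType) (A : lmodType R) (B : algType R) (f : A -> B) b :
  linear f -> linear (fun x => f x * b).
Proof. by move=> lf a x y; rewrite lf mulrDl scalerAl. Qed.
Lemma linear_idfun (R : fieldType) (A : lmodType R) : linear (fun x : A => x).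
Proof. by []. Qed.

Lemma koszulDr (k : fieldType) p q q' :
  koszul k p (q + q') = koszul k p q * koszul k p q'.
Proof. by rewrite koszulC koszulD ![koszul k _ p]koszulC. Qed.
Lemma koszulKC (k : fieldType) p q : koszul k p q * koszul k q p = 1.
Proof. by rewrite [koszul k q p]koszulC koszulK. Qed.
Lemma koszul0r (k : fieldType) p : koszul k p 0 = 1.
Proof. by rewrite koszulC koszul0. Qed.
Lemma koszul_even (k : fieldType) (q : int) (n : nat) : koszul k (n.*2)%:Z q = 1.
Proof. by rewrite /koszul absz_nat -signr_odd oddM odd_double. Qed.
Lemma koszul_evenN (k : fieldType) (q : int) (n : nat) : koszul k (- (n.*2)%:Z) q = 1.
Proof. by rewrite /koszul abszN absz_nat -signr_odd oddM odd_double. Qed.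

Section Tensors.
Variables (k : fieldType) (A B M : lmodType k).

Definition bilinear (F : A -> B -> M) :=
  (forall b, linear (F^~ b)) /\ (forall a, linear (F a)).

Lemma bilinear_respects F : bilinear F ->
  respects (@tensRel k A B) (fun p => F p.1 p.2).
Proof.
move=> [Fl Fr] _ [a x y w|a v x y]; rewrite /feval !big_cons big_nil /=.
- by rewrite (Fl w) addr0 scale1r scaleN1r scaleNr -opprD subrr.
- by rewrite (Fr v) addr0 scale1r scaleN1r scaleNr -opprD subrr.
Qed.

Lemma tlift_linear F : bilinear F -> linear (tlift F).
Proof. by move=> bF; apply: plift_linear; apply: bilinear_respects. Qed.
Lemma tlift_tmk F a b : bilinear F -> tlift F (tmk a b) = F a b.
Proof. by move=> bF; rewrite /tlift plift_gen //; apply: bilinear_respects. Qed.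

End Tensors.

Lemma bilinear_tmk (k : fieldType) (A B : lmodType k) : bilinear (@tmk k A B).
Proof.
split=> [b|v] a x y.
- have := respects_gen (TensL a x y b).
  rewrite /feval !big_cons big_nil /= addr0 scale1r scaleN1r scaleNr -opprD.
  by move/subr0_eq.
- have := respects_gen (TensR a v x y).
  rewrite /feval !big_cons big_nil /= addr0 scale1r scaleN1r scaleNr -opprD.
  by move/subr0_eq.
Qed.

(** * Words and word length *)

Section Words.
Variables (k : fieldType) (V : gvect k).
Implicit Types (w u v s t : seq (helt V)) (x y z : helt V).

Lemma word_nil : word [::] = 1 :> sym V. Proof. by []. Qed.
Lemma word_cons x w : word (x :: w) = word [:: x] * word w.
Proof. by rewrite wordM. Qed.

Lemma wdeg_nil : wdeg ([::] : seq (helt V)) = 0. Proof. exact: big_nil. Qed.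
Lemma wdeg_cons x w : wdeg (x :: w) = hdeg x + wdeg w. Proof. exact: big_cons. Qed.
Lemma wdeg_cat v w : wdeg (v ++ w) = wdeg v + wdeg w. Proof. exact: big_cat. Qed.
Lemma wdeg1 x : wdeg [:: x] = hdeg x. Proof. exact: big_seq1. Qed.

Variable W : lmodType k.
Implicit Types f g : seq (helt V) -> W.

Definition wlinear f := forall s t a x y z,
  hdeg x = hdeg z -> hdeg y = hdeg z -> hval z = a *: hval x + hval y ->
  f (s ++ z :: t) = a *: f (s ++ x :: t) + f (s ++ y :: t).
Definition wsymmetric f := forall s t x y,
  f (s ++ x :: y :: t) = koszul k (hdeg x) (hdeg y) *: f (s ++ y :: x :: t).
(** These two conditions say that the relators of [symRel] are killed, so that [slift f] is well
    defined. The sign rule is kept separate because the permutation arguments use it alone. *)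
Definition wresp f := wlinear f /\ wsymmetric f.

Lemma wresp_word (F : sym V -> W) : linear F -> wresp (fun w => F (word w)).
Proof.
move=> lF; split=> [s t a x y z xz yz zE|s t x y].
- by rewrite (wordL s t xz yz zE) lF.
- by rewrite wordS (linZ _ lF).
Qed.

Lemma slift_lin f : wresp f -> linear (slift f).
Proof. by case=> fl fs; apply: slift_linear; apply: symRespectsP. Qed.
Lemma slift_wordE f w : wresp f -> slift f (word w) = f w.
Proof. by case=> fl fs; apply: slift_word; apply: symRespectsP. Qed.

Lemma wresp_ext f g : f =1 g -> wresp f -> wresp g.
Proof. by move=> /funext ->. Qed.

Lemma slift_ext f g : f =1 g -> slift f = slift g.
Proof. by move=> /funext ->. Qed.

Lemma wresp_if f (P : nat -> int -> bool) : wresp f ->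
  wresp (fun w => if P (size w) (wdeg w) then f w else 0).
Proof.
move=> [fl fs]; split=> [s t a x y z xz yz zE|s t x y].
- rewrite !size_cat /= !wdeg_cat !wdeg_cons xz yz.
  by case: ifP => _; [apply: fl zE | rewrite scaler0 addr0].
- rewrite !size_cat /= !wdeg_cat !wdeg_cons [hdeg y + (hdeg x + _)]addrCA.
  by case: ifP => _; [apply: fs | rewrite scaler0].
Qed.

End Words.

Section Projections.
Variables (k : fieldType) (V : gvect k).
Implicit Types (w u v : seq (helt V)) (x : helt V) (a b : sym V).

Lemma wresp_wproj n : wresp (fun w => if size w == n then word w else 0 : sym V).
Proof.
apply: (wresp_if (fun m _ => m == n)).
exact: wresp_word (@linear_idfun _ (sym V)).
Qed.

Lemma wproj_word n w : wproj n (word w) = if size w == n then word w else 0.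
Proof. exact/slift_wordE/wresp_wproj. Qed.
Lemma wproj_linear n : linear (@wproj k V n).
Proof. exact/slift_lin/wresp_wproj. Qed.

Lemma wproj_comp m n a : wproj m (wproj n a) = if m == n then wproj n a else 0.
Proof.
move: a; apply: sym_eqP.
- exact: linear_comp (wproj_linear m) (wproj_linear n).
- by apply: linear_cond; apply: wproj_linear.
move=> w; rewrite !wproj_word (lin_if _ _ (wproj_linear m)) wproj_word.
by have [<-|] := eqVneq (size w) n; rewrite ?if_same // eq_sym.
Qed.

Lemma wproj1_1 : wproj 1 (1 : sym V) = 0.
Proof. by rewrite -word_nil wproj_word. Qed.

(** The filtration step S^(<= n)(V). Written with projections it is visibly a linear condition, with
    no choice of a representation by words. *)
Definition fil (n : nat) a := forall j, (n < j)%N -> wproj j a = 0.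

Lemma fil_word n w : (size w <= n)%N -> fil n (word w).
Proof. by move=> wn j nj; rewrite wproj_word; case: eqP => // E; lia. Qed.
Lemma fil0 n : fil n 0. Proof. by move=> j _; rewrite lin0 //; apply: wproj_linear. Qed.
Lemma filD n a b : fil n a -> fil n b -> fil n (a + b).
Proof. by move=> fa fb j nj; rewrite (linD (wproj_linear j)) fa ?fb ?addr0. Qed.
Lemma filZ n c a : fil n a -> fil n (c *: a).
Proof. by move=> fa j nj; rewrite (linZ _ (wproj_linear j)) fa ?scaler0. Qed.

Lemma fil_le n m a : (n <= m)%N -> fil n a -> fil m a.
Proof. by move=> nm fa j mj; apply: fa; apply: leq_ltn_trans mj. Qed.

Lemma sum_wproj_word N w : (size w < N)%N -> \sum_(j < N) wproj j (word w) = word w.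
Proof.
move=> wN; rewrite (bigD1 (Ordinal wN)) //= wproj_word eqxx big1 ?addr0 // => i.
rewrite -val_eqE /= wproj_word => ni; case: eqP => // E.
by rewrite E eqxx in ni.
Qed.

Lemma wproj_bounded a : exists N, fil N a /\ a = \sum_(j < N.+1) wproj j a.
Proof.
(* Asking for all larger M lets the bounds of two summands be merged by [maxn]. *)
suff [N H] : exists N, forall M, (N <= M)%N ->
    fil M a /\ a = \sum_(j < M.+1) wproj j a by exists N; apply: H.
elim/pres_span: a => [|c w y [N IH]].
  exists 0%N => M _; split; first exact: fil0.
  by rewrite big1 // => i _; rewrite lin0 //; apply: wproj_linear.
exists (maxn N (size w)) => M; rewrite geq_max => /andP[NM wM].
have [fy yE] := IH _ NM; split.
  by apply: filD => //; apply: filZ; apply: fil_word.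
rewrite -[pgen _ w]/(word w).
under eq_bigr do rewrite wproj_linear.
rewrite big_split /= -scaler_sumr -yE sum_wproj_word //.
Qed.

Lemma sum_wproj N a : fil N a -> a = \sum_(j < N.+1) wproj j a.
Proof.
have [M [fM aE]] := wproj_bounded a => fN.
have E m n : fil m a -> (m <= n)%N ->
    \sum_(j < n.+1) wproj j a = \sum_(j < m.+1) wproj j a.
  move=> fm mn; rewrite -!(big_mkord xpredT (fun j => wproj j a)).
  rewrite (@big_cat_nat _ _ _ m.+1 _ n.+1) //= [X in _ + X]big_nat_cond.
  by rewrite [X in _ + X]big1 ?addr0 // => j /andP[/andP[mj _] _]; apply: fm.
by rewrite {1}aE -(E _ _ fM (leq_maxl M N)) (E _ _ fN (leq_maxr M N)).
Qed.

Lemma wproj_inj a b : (forall j, wproj j a = wproj j b) -> a = b.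
Proof.
move=> E; have [M [fM _]] := wproj_bounded a; have [N [fN _]] := wproj_bounded b.
have fa := fil_le (leq_maxl M N) fM; have fb := fil_le (leq_maxr M N) fN.
by rewrite (sum_wproj fa) (sum_wproj fb); apply: eq_bigr => i _; rewrite E.
Qed.

Lemma bilinear_mul : bilinear (fun a b : sym V => a * b).
Proof. by split=> c; [apply: linear_mulr|apply: linear_mull]. Qed.

Lemma sym_eqP2 (W : lmodType k) (F G : sym V -> sym V -> W) :
  bilinear F -> bilinear G ->
  (forall u v, F (word u) (word v) = G (word u) (word v)) ->
  forall a b, F a b = G a b.
Proof.
move=> [Fl Fr] [Gl Gr] FG a b.
move: a; apply: (sym_eqP (Fl b) (Gl b)) => u.
by move: b; apply: (sym_eqP (Fr _) (Gr _)) => v.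
Qed.

Lemma wprojM n a b :
  wproj n (a * b) = \sum_(i < n.+1) wproj i a * wproj (n - i) b.
Proof.
move: a b; apply: sym_eqP2.
- split=> c.
  + exact: linear_comp (wproj_linear n) (bilinear_mul.1 c).
  + exact: linear_comp (wproj_linear n) (bilinear_mul.2 c).
- split=> c; apply: linear_suml => i.
  + by apply: linear_mulr; apply: wproj_linear.
  + by apply: linear_mull; apply: wproj_linear.
move=> u v; rewrite wordM !wproj_word size_cat.
case: eqP => [E|nE].
  have un : (size u < n.+1)%N by lia.
  rewrite (bigD1 (Ordinal un)) //= !wproj_word eqxx ifT; last by apply/eqP; lia.
  rewrite wordM big1 ?addr0 // => i; rewrite -val_eqE /= wproj_word eq_sym => /negbTE ->.
  by rewrite mul0r.
rewrite big1 // => i _; rewrite !wproj_word; case: eqP => [Ei|_]; last by rewrite mul0r.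
have := ltn_ord i; case: eqP => [E|_]; last by rewrite mulr0.
by move=> ?; case: nE; lia.
Qed.

Lemma filM m n a b : fil m a -> fil n b -> fil (m + n) (a * b).
Proof.
move=> fa fb j mnj; rewrite wprojM big1 // => i _.
have [mi|im] := ltnP m i; first by rewrite fa ?mul0r.
by rewrite (fb (j - i)%N) ?mulr0 //; lia.
Qed.

Lemma in_pow_fil n a : in_pow n a -> fil n a.
Proof.
by move=> <- j nj; rewrite wproj_comp; case: eqP => // E; rewrite E ltnn in nj.
Qed.

End Projections.

(** * Unshuffles *)

Section Unshuffle.
Variables (k : fieldType) (V : gvect k).
Local Notation wd := (seq (helt V)).

(* The signed sum of G u v over all unshuffles of w into two subwords u and v. *)
Fixpoint ssum (W : lmodType k) (G : wd -> wd -> W) (w : wd) : W :=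
  if w is x :: w' then
    ssum (fun u v => G (x :: u) v) w' +
    ssum (fun u v => koszul k (hdeg x) (wdeg u) *: G u (x :: v)) w'
  else G [::] [::].

Lemma eq_ssum_perm (W : lmodType k) (G G' : wd -> wd -> W) w :
  (forall u v, perm_eq (u ++ v) w -> G u v = G' u v) -> ssum G w = ssum G' w.
Proof.
elim: w G G' => [|x w IH] G G' E /=; first exact: E.
congr (_ + _); apply: IH => u v uv; first by apply: E; rewrite /= perm_cons.
congr (_ *: _); apply: E.
by rewrite -cat1s perm_catCA cat1s perm_cons.
Qed.

Lemma eq_ssum (W : lmodType k) (G G' : wd -> wd -> W) w :
  (forall u v, (size u + size v)%N = size w -> wdeg u + wdeg v = wdeg w ->
     G u v = G' u v) -> ssum G w = ssum G' w.
Proof.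
move=> E; apply: eq_ssum_perm => u v uv; apply: E.
- by rewrite -size_cat (perm_size uv).
- by rewrite -wdeg_cat; apply: perm_big.
Qed.

Lemma ssum_ext (W : lmodType k) (G G' : wd -> wd -> W) w :
  (forall u v, G u v = G' u v) -> ssum G w = ssum G' w.
Proof. by move=> E; apply: eq_ssum => u v _ _; apply: E. Qed.

Lemma ssum0 (W : lmodType k) w : ssum (fun _ _ => 0 : W) w = 0.
Proof.
elim: w => //= x w IH; rewrite IH add0r -[RHS]IH.
by apply: ssum_ext => u v; rewrite scaler0.
Qed.

Lemma ssumD (W : lmodType k) (G G' : wd -> wd -> W) w :
  ssum (fun u v => G u v + G' u v) w = ssum G w + ssum G' w.
Proof.
elim: w G G' => //= x w IH G G'; rewrite IH addrACA; congr (_ + _).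
by rewrite -IH; apply: ssum_ext => u v; rewrite scalerDr.
Qed.

Lemma ssum_lin (W W' : lmodType k) (F : W -> W') (G : wd -> wd -> W) w :
  linear F -> F (ssum G w) = ssum (fun u v => F (G u v)) w.
Proof.
move=> lF; elim: w G => //= x w IH G; rewrite (linD lF) !IH; congr (_ + _).
by apply: ssum_ext => u v; rewrite (linZ _ lF).
Qed.

Lemma ssumZ (W : lmodType k) c (G : wd -> wd -> W) w :
  ssum (fun u v => c *: G u v) w = c *: ssum G w.
Proof. by rewrite (ssum_lin (F := fun x => c *: x)) //; apply: linear_scale. Qed.

Lemma ssumB (W : lmodType k) (G G' : wd -> wd -> W) w :
  ssum (fun u v => G u v - G' u v) w = ssum G w - ssum G' w.
Proof.
rewrite ssumD; congr (_ + _); rewrite -scaleN1r -ssumZ.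
by apply: ssum_ext => u v; rewrite scaleN1r.
Qed.

Lemma ssum_sum (W : lmodType k) I (r : seq I) (P : pred I) (G : I -> wd -> wd -> W) w :
  ssum (fun u v => \sum_(i <- r | P i) G i u v) w = \sum_(i <- r | P i) ssum (G i) w.
Proof.
elim: w G => //= x w IH G; rewrite IH big_split /=.
rewrite -(IH (fun i u v => koszul k (hdeg x) (wdeg u) *: G i u (x :: v))).
congr (_ + _).
by apply: ssum_ext => u v; rewrite scaler_sumr.
Qed.

(** Induction on the prefix s: each prefix letter is absorbed into one argument of G, and the sign
    it produces depends only on degrees, which the two relators preserve. Linearity and symmetry are
    carried through separately. *)
Lemma ssum_resp (W : lmodType k) (G : wd -> wd -> W) :
  (forall v, wresp (G^~ v)) -> (forall u, wresp (G u)) -> wresp (ssum G).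
Proof.
move=> Gl Gr; split.
- have {Gl Gr} : (forall v, wlinear (G^~ v)) /\ (forall u, wlinear (G u)).
    by split=> c; [case: (Gl c) | case: (Gr c)].
  move=> GG s; elim: s G GG => [|c s IH] G [Gl Gr] t a x y z xz yz zE /=.
  + rewrite scalerDr addrACA; congr (_ + _); rewrite -ssumZ -ssumD;
      apply: ssum_ext => u v.
    * exact: (Gl v [::] u a x y z).
    * rewrite (Gr u [::] v a x y z) //= scalerDr !scalerA xz yz.
      by rewrite [a * _]mulrC.
  rewrite scalerDr addrACA; congr (_ + _); apply: IH => //; split.
  + by move=> v s' t' *; apply: (Gl v (c :: s')).
  + by move=> u s' t' *; apply: (Gr (c :: u) s').
  + move=> v s' t' a' x' y' z' xz' yz' zE'.
    rewrite (Gl _ s' t' a' x' y' z') // !wdeg_cat !wdeg_cons xz' yz'.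
    by rewrite scalerDr !scalerA [a' * _]mulrC.
  + move=> u s' t' a' x' y' z' xz' yz' zE'.
    by rewrite (Gr u (c :: s') t' a' x' y' z') // scalerDr !scalerA [a' * _]mulrC.
- have {Gl Gr} : (forall v, wsymmetric (G^~ v)) /\ (forall u, wsymmetric (G u)).
    by split=> c; [case: (Gl c) | case: (Gr c)].
  move=> GG s; elim: s G GG => [|c s IH] G [Gl Gr] t x y /=.
  (* There are four placements of x and y. Both left or both right is handled by the symmetry of G;
     the two mixed placements are exchanged with each other. *)
  + rewrite !scalerDr -!addrA; congr (_ + _).
      by rewrite -ssumZ; apply: ssum_ext => u v; apply: (Gl v [::]).
    rewrite addrCA; congr (_ + _).
      rewrite -ssumZ; apply: ssum_ext => u v.
      by rewrite wdeg_cons koszulDr scalerA.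
    congr (_ + _).
      rewrite -ssumZ; apply: ssum_ext => u v.
      by rewrite wdeg_cons koszulDr !scalerA; congr (_ *: _); rewrite mulrA koszulKC mul1r.
    rewrite -ssumZ; apply: ssum_ext => u v.
    rewrite (Gr u [::]) /= !scalerA; congr (_ *: _).
    by ring.
  rewrite scalerDr; congr (_ + _); apply: IH; split.
  + by move=> v s' t' x' y'; apply: (Gl v (c :: s')).
  + by move=> u s' t' x' y'; apply: (Gr (c :: u) s').
  + move=> v s' t' x' y'; rewrite Gl !scalerA.
    by rewrite !wdeg_cat !wdeg_cons [hdeg y' + (hdeg x' + _)]addrCA mulrC.
  + by move=> u s' t' x' y'; rewrite (Gr u (c :: s')) !scalerA mulrC.
Qed.

(** The first letter ends up in one of three legs, which gives three terms on each side; in the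
    third leg the letter passes two blocks and the signs multiply by [koszulDr]. *)
Lemma ssum_coassoc (W : lmodType k) (G : wd -> wd -> wd -> W) w :
  ssum (fun u v => ssum (fun u1 u2 => G u1 u2 v) u) w =
  ssum (fun u v => ssum (fun v1 v2 => G u v1 v2) v) w.
Proof.
elim: w G => //= x w IH G; rewrite ssumD.
rewrite -addrA (IH (fun u1 u2 v => G (x :: u1) u2 v)).
congr (_ + _).
under [X in _ = X]ssum_ext do rewrite scalerDr.
rewrite ssumD; congr (_ + _).
  rewrite (IH (fun u1 u2 v => koszul k (hdeg x) (wdeg u1) *: G u1 (x :: u2) v)).
  by apply: ssum_ext => u v; rewrite -ssumZ.
under [RHS]ssum_ext do rewrite -ssumZ.
rewrite -(IH (fun u v1 v2 => koszul k (hdeg x) (wdeg u) *: (koszul k (hdeg x) (wdeg v1) *: G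
  u v1 (x :: v2)))).
apply: ssum_ext => u v; rewrite -ssumZ.
apply: eq_ssum => u1 u2 _ E.
by rewrite -E koszulDr scalerA.
Qed.

Lemma ssum_cocomm (W : lmodType k) (G : wd -> wd -> W) w :
  ssum G w = ssum (fun u v => koszul k (wdeg u) (wdeg v) *: G v u) w.
Proof.
elim: w G => [|x w IH] G /=; first by rewrite !wdeg_nil koszul0 scale1r.
rewrite addrC; congr (_ + _).
- rewrite IH; apply: ssum_ext => u v; rewrite scalerA; congr (_ *: _).
  by rewrite wdeg_cons koszulD mulrC.
- rewrite IH; apply: ssum_ext => u v; rewrite scalerA; congr (_ *: _).
  by rewrite wdeg_cons koszulDr mulrA koszulKC mul1r.
Qed.

(* Cocommutativity applied to the first two legs of the iterated coproduct. *)
Lemma ssum_swap12 (W : lmodType k) (G : wd -> wd -> wd -> W) w :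
  ssum (fun u v => ssum (fun v1 v2 => G u v1 v2) v) w =
  ssum (fun u v => ssum (fun v1 v2 => koszul k (wdeg u) (wdeg v1) *: G v1 u v2) v) w.
Proof.
rewrite -!ssum_coassoc; apply: ssum_ext => u v.
exact: (ssum_cocomm (fun a b => G a b v)).
Qed.

Lemma ssum_nill (W : lmodType k) (G : wd -> wd -> W) w :
  (forall u v, u != [::] -> G u v = 0) -> ssum G w = G [::] w.
Proof.
elim: w G => //= x w IH G G0.
rewrite (ssum_ext _ (G' := fun _ _ => 0)) ?ssum0 ?add0r; last by move=> u v; apply: G0.
rewrite IH; first by rewrite wdeg_nil koszul0r scale1r.
by move=> u v u0; rewrite G0 ?scaler0.
Qed.

Lemma ssum_nilr (W : lmodType k) (G : wd -> wd -> W) w :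
  (forall u v, v != [::] -> G u v = 0) -> ssum G w = G w [::].
Proof.
move=> G0; rewrite ssum_cocomm ssum_nill; first by rewrite wdeg_nil koszul0 scale1r.
by move=> u v u0; rewrite G0 ?scaler0.
Qed.

End Unshuffle.
(** * Sums over permutations as sums over unshuffles *)

(** Adjacent transpositions generate all rearrangements. Testing distinct neighbours suffices, and
    this is what lets [lsign_perm] decide which of two positions is the smaller. *)
Lemma perm_adjacent (T : eqType) (S : Type) (f : seq T -> S) :
  (forall s t x y, x != y -> f (s ++ x :: y :: t) = f (s ++ y :: x :: t)) ->
  forall l p, perm_eq l p -> f l = f p.
Proof.
move=> fS.
have fS' s t x y : f (s ++ x :: y :: t) = f (s ++ y :: x :: t).
  by have [->|] := eqVneq x y => //; apply: fS.
have mv s x u t : f (s ++ x :: u ++ t) = f (s ++ u ++ x :: t).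
  elim: u s => //= y u IH s; rewrite fS' -cat_rcons IH cat_rcons.
  by [].
suff H l p s : perm_eq l p -> f (s ++ l) = f (s ++ p) by move=> l p /(H l p [::]).
elim: l p s => [|x l IH] p s lp.
  by move: lp; rewrite perm_sym => /perm_nilP ->.
have xp : x \in p by rewrite -(perm_mem lp) mem_head.
case/splitPr: xp lp => p1 p2; rewrite -[x :: p2]cat1s perm_sym perm_catCA /= perm_cons
  perm_sym => lp.
by rewrite -cat_rcons (IH _ _ lp) cat_rcons mv.
Qed.

Section Splits.
Variable T : eqType.
Implicit Types (p l : seq T) (q : seq T * seq T).

Fixpoint splits p : seq (seq T * seq T) :=
  if p is i :: p' then
    [seq (i :: q.1, q.2) | q <- splits p'] ++ [seq (q.1, i :: q.2) | q <- splits p']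
  else [:: ([::], [::])].

Lemma mem_splits (a : pred T) p : (filter a p, filter (predC a) p) \in splits p.
Proof.
elim: p => //= i p IH; rewrite mem_cat.
case: (a i) => /=; apply/orP; [left|right].
- exact: (map_f (fun q => (i :: q.1, q.2)) IH).
- exact: (map_f (fun q => (q.1, i :: q.2)) IH).
Qed.

Lemma splits_subseq p q : q \in splits p ->
  [/\ perm_eq (q.1 ++ q.2) p, subseq q.1 p & subseq q.2 p].
Proof.
elim: p q => [|i p IH] q /=; first by rewrite inE => /eqP ->.
rewrite mem_cat => /orP[] /mapP[q' /IH[qp q1 q2] ->] /=.
- by split; rewrite ?perm_cons ?eqxx //; apply: subseq_trans q2 (subseq_cons p i).
- split; rewrite ?eqxx //; last exact: subseq_trans q1 (subseq_cons p i).
  by rewrite -cat1s perm_catCA /= perm_cons.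
Qed.

Lemma count_splits p n : count (fun q => size q.1 == n) (splits p) = 'C(size p, n).
Proof.
elim: p n => [|i p IH] [|n] //=; rewrite count_cat !count_map /preim /=.
- by rewrite (eq_count (a2 := pred0)) // count_pred0 IH !bin0.
- by rewrite binS addnC -!IH.
Qed.

(** Cutting an ordering of p after n entries amounts to choosing the set of the first n entries and
    ordering both blocks. *)
Lemma sum_permutations_split (W : nmodType) (G : seq T -> seq T -> W) p n :
  uniq p -> (n <= size p)%N ->
  \sum_(l <- permutations p) G (take n l) (drop n l) =
  \sum_(q <- splits p | size q.1 == n)
    \sum_(l1 <- permutations q.1) \sum_(l2 <- permutations q.2) G l1 l2.
Proof.
move=> up np.
pose L := [seq (take n l, drop n l) | l <- permutations p].
pose R := flatten [seq [seq (l1, l2) | l1 <- permutations q.1, l2 <- permutations q.2]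
                  | q <- [seq q <- splits p | size q.1 == n]].
have LR : perm_eq L R.
  have uL : uniq L.
    rewrite map_inj_in_uniq ?permutations_uniq // => l l' _ _ [E1 E2].
    by rewrite -(cat_take_drop n l) E1 E2 cat_take_drop.
  have sLR : {subset L <= R}.
    move=> q /mapP[l]; rewrite mem_permutations => lp ->.
    have ul : uniq l by rewrite (perm_uniq lp).
    apply/flattenP; pose a x := x \in take n l.
    have e1 : perm_eq (take n l) (filter a p).
      apply: uniq_perm; rewrite ?take_uniq ?filter_uniq // => x.
      rewrite mem_filter /a /= andbC; case: (boolP (x \in take n l)) => //= xt.
        by rewrite -(perm_mem lp) (mem_take xt).
      by rewrite andbF.
    have e2 : perm_eq (drop n l) (filter (predC a) p).
      apply: uniq_perm; rewrite ?drop_uniq ?filter_uniq // => x.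
      have xl : (x \in l) = (x \in take n l) || (x \in drop n l) by rewrite -mem_cat
        cat_take_drop.
      rewrite mem_filter /a /= -(perm_mem lp) xl.
      have : uniq (take n l ++ drop n l) by rewrite cat_take_drop.
      rewrite cat_uniq => /and3P[_ /hasPn h _].
      case: (boolP (x \in drop n l)) => [/h/= /negbTE -> //|_].
      by rewrite orbF andNb.
    exists [seq (l1, l2) | l1 <- permutations (filter a p),
      l2 <- permutations (filter (predC a) p)].
      apply: (map_f (fun q => [seq (l1, l2) | l1 <- permutations q.1, l2 <- permutations q.2])
        (x := (filter a p, filter (predC a) p))).
      rewrite mem_filter mem_splits andbT /= -(perm_size e1) size_takel //.
      by rewrite (perm_size lp).
    by apply/allpairsP; exists (take n l, drop n l); rewrite !mem_permutations.
  (* Since L is duplicate-free and contained in R, equal length makes R a rearrangement of L,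
     without a direct proof that R is duplicate-free. The count is the binomial coefficient times
     the two factorials. *)
  have sz : size R = size L.
    rewrite size_map size_permutations // size_flatten sumnE /shape !big_map.
    rewrite [LHS](eq_big_seq (fun=> n`! * (size p - n)`!))%N; last first.
      move=> q; rewrite mem_filter => /andP[/eqP q1n /splits_subseq[qp q1 q2]].
      have /eqP := perm_size qp; rewrite size_cat q1n => /eqP sq.
      rewrite /= size_allpairs !size_permutations ?(subseq_uniq _ up) // q1n.
      by rewrite -sq addKn.
    rewrite big_const_seq count_predT size_filter count_splits iter_addn_0 mulnC.
    by rewrite -(bin_fact np).
  have [_ e] := uniq_min_size uL sLR (eq_leq sz).
  apply: uniq_perm => //; by apply: (leq_size_uniq uL sLR); rewrite sz.
transitivity (\sum_(q <- L) G q.1 q.2); first by rewrite big_map.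
rewrite (perm_big _ LR) big_flatten big_map big_filter.
by apply: eq_bigr => q _; rewrite big_allpairs.
Qed.

End Splits.

(** * Koszul signs of orderings of positions *)

Section Signs.
Variables (k : fieldType) (V : gvect k) (m : nat) (X : 'I_m -> helt V).
Local Notation pos := (seq 'I_m).
Implicit Types l p : pos.

Definition increasing p := pairwise (fun i j : 'I_m => (i < j)%N) p.
Definition psign (i j : 'I_m) : k := koszul k (hdeg (X i)) (hdeg (X j)).
Definition inv1 (i : 'I_m) l : k := \prod_(j <- l | (j < i)%N) psign i j.
Definition cross l1 l2 : k := \prod_(i <- l1) inv1 i l2.

(* The Koszul sign of the word x_l(1) x_l(2) ... relative to the increasing
   rearrangement of l. *)
Fixpoint lsign l : k := if l is i :: l' then inv1 i l' * lsign l' else 1.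

Lemma inv1_cat i l1 l2 : inv1 i (l1 ++ l2) = inv1 i l1 * inv1 i l2.
Proof. exact: big_cat. Qed.

Lemma cross_cons1 i l1 l2 : cross (i :: l1) l2 = inv1 i l2 * cross l1 l2.
Proof. exact: big_cons. Qed.

(** Inversions lie within l1, within l2, or between the two. The last factor sees the blocks only up
    to rearrangement ([cross_perm]), so it comes out of sums over orderings of each block. *)
Lemma lsign_cat l1 l2 : lsign (l1 ++ l2) = lsign l1 * lsign l2 * cross l1 l2.
Proof.
elim: l1 => [|i l1 IH] /=; first by rewrite /cross big_nil mul1r mulr1.
by rewrite IH inv1_cat cross_cons1; ring.
Qed.

Lemma cross_perm l1 l2 p1 p2 : perm_eq l1 p1 -> perm_eq l2 p2 ->
  cross l1 l2 = cross p1 p2.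
Proof.
move=> e1 e2; rewrite /cross (perm_big _ e1) /=; apply: eq_bigr => i _.
exact: perm_big.
Qed.

Lemma inv1_lt (i : 'I_m) l : all (fun j : 'I_m => (i < j)%N) l -> inv1 i l = 1.
Proof.
move=> /allP H; rewrite /inv1 big_seq_cond big1 // => j /andP[/H ij ji]; lia.
Qed.

Lemma lsign_increasing p : increasing p -> lsign p = 1.
Proof.
elim: p => //= i p IH /andP[ip /IH ->]; by rewrite inv1_lt ?mulr1.
Qed.

(** Exchanging two distinct neighbouring positions creates or removes exactly one inversion; its
    sign is the one given by the symmetry of f, and the two square to 1. *)
Lemma lsign_perm (W : lmodType k) (f : seq (helt V) -> W) l p :
  wsymmetric f -> perm_eq l p ->
  lsign l *: f (map X l) = lsign p *: f (map X p).
Proof.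
move=> fS; apply: (perm_adjacent (f := fun l => lsign l *: f (map X l))) => s t x y xy.
rewrite !map_cat /= fS scalerA; congr (_ *: _).
rewrite !lsign_cat (@cross_perm s (x :: y :: t) s (y :: x :: t)) //; last first.
  by rewrite -(cat1s x) -(cat1s y) perm_catCA.
rewrite /= /inv1 !big_cons -/(psign x y).
have := xy; rewrite -val_eqE /= neq_ltn => /orP[xly|ylx].
- have -> : (y < x)%N = false by lia.
  by rewrite xly /psign [koszul k (hdeg (X y)) (hdeg (X x))]koszulC; ring.
- have -> : (x < y)%N = false by lia.
  rewrite ylx; have := koszulK k (hdeg (X x)) (hdeg (X y)); rewrite -/(psign x y) => E.
  by rewrite -[RHS]mulr1 -E; ring.
Qed.

Lemma cross_consr (i : 'I_m) l1 l2 : all (fun j : 'I_m => (i < j)%N) l1 ->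
  cross l1 (i :: l2) = koszul k (hdeg (X i)) (wdeg (map X l1)) * cross l1 l2.
Proof.
elim: l1 => [|j l1 IH] /=; first by rewrite /cross !big_nil wdeg_nil koszul0r mulr1.
move=> /andP[ij /IH E]; rewrite !cross_cons1 E wdeg_cons koszulDr.
rewrite {1}/inv1 big_cons ij -/(inv1 j l2) /psign [koszul k (hdeg (X j)) _]koszulC.
by ring.
Qed.

(** The first position of an increasing list is smaller than all others: placed left it creates no
    inversion, placed right it is inverted with the whole left block. This is the sign in the
    recursion of [ssum]. *)
Lemma cross_ssum (W : lmodType k) (G : seq (helt V) -> seq (helt V) -> W) p :
  increasing p ->
  \sum_(q <- splits p) cross q.1 q.2 *: G (map X q.1) (map X q.2) = ssum G (map X p).
Proof.
elim: p G => [|i p IH] G /=.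
  by rewrite big_seq1 /cross big_nil scale1r.
move=> /andP[ip incp]; rewrite big_cat !big_map /=; congr (_ + _).
- rewrite -IH //; apply: eq_big_seq => q /splits_subseq[_ _ /mem_subseq q2].
  rewrite cross_cons1 inv1_lt ?mul1r //.
  by apply/allP => j /q2; move: j; apply/allP.
- rewrite -IH //; apply: eq_big_seq => q /splits_subseq[_ /mem_subseq q1 _].
  rewrite cross_consr ?scalerA 1?mulrC //.
  by apply/allP => j /q1; move: j; apply/allP.
Qed.

Lemma prod_inversions l (i0 : 'I_m) :
  \prod_(i < size l) \prod_(j < size l | (i < j)%N && (nth i0 l j < nth i0 l i)%N)
     psign (nth i0 l i) (nth i0 l j) = lsign l.
Proof.
elim: l => [|x l IH]; first by rewrite big_ord0.
rewrite /= big_ord_recl -IH; congr (_ * _).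
- rewrite big_mkcond big_ord_recl /= mul1r -big_mkcond /=.
  by rewrite /inv1 (big_nth i0) big_mkord; apply: eq_bigl => j.
- apply: eq_bigr => i _; rewrite big_mkcond big_ord_recl /= mul1r -big_mkcond /=.
  by apply: eq_bigl => j.
Qed.

Lemma increasing_enum : increasing (enum 'I_m).
Proof.
rewrite /increasing -(pairwise_map val (fun i j : nat => (i < j)%N)) val_enum_ord.
by rewrite -sorted_pairwise ?iota_ltn_sorted //; apply: ltn_trans.
Qed.

Lemma increasing_uniq p : increasing p -> uniq p.
Proof.
by elim: p => //= i p IH /andP[/allP ip /IH ->]; rewrite andbT; apply/negP => /ip; rewrite ltnn.
Qed.

Lemma increasing_subseq p q : subseq p q -> increasing q -> increasing p.
Proof. exact: subseq_pairwise. Qed.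

Lemma increasing_eq l p : increasing l -> increasing p -> perm_eq l p -> l = p.
Proof.
elim: l p => [|x l IH] p; first by rewrite perm_sym => _ _ /perm_nilP ->.
case: p => [|y p]; first by move=> _ _ /perm_nilP.
move=> /= /andP[xl il] /andP[yp ip] E.
have xy : x = y.
  have : x \in y :: p by rewrite -(perm_mem E) mem_head.
  have : y \in x :: l by rewrite (perm_mem E) mem_head.
  rewrite !inE eq_sym; have [//|_ /=] := eqVneq x y.
  by move=> /(allP xl) h1 /(allP yp) h2; lia.
by rewrite -xy in E *; rewrite (IH p) //; move: E; rewrite perm_cons.
Qed.

Lemma sum_perm_list (W : nmodType) (F : pos -> W) :
  \sum_(s : {perm 'I_m}) F [seq s i | i <- enum 'I_m] =
  \sum_(l <- permutations (enum 'I_m)) F l.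
Proof.
transitivity (\sum_(l <- [seq [seq s i | i <- enum 'I_m] | s : {perm 'I_m}]) F l).
  by rewrite big_map big_enum.
apply: perm_big.
set L := [seq _ | s : _].
have uL : uniq L.
  rewrite map_inj_uniq ?enum_uniq // => s s' /eq_in_map E.
  by apply/permP => i; apply: E; rewrite mem_enum.
have sL : {subset L <= permutations (enum 'I_m)}.
  move=> l /mapP[s _ ->]; rewrite mem_permutations.
  apply: uniq_perm; rewrite ?enum_uniq ?(map_inj_uniq (@perm_inj _ s)) ?enum_uniq // => i.
  rewrite mem_enum; apply/mapP; exists ((s^-1)%g i); rewrite ?mem_enum //.
  by rewrite permKV.
have sz : size (permutations (enum 'I_m)) = size L.
  by rewrite size_permutations ?enum_uniq // -cardE card_ord -card_Sn cardE [RHS]size_map.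
have [_ e] := uniq_min_size uL sL (eq_leq sz).
by apply: uniq_perm => //; apply: permutations_uniq.
Qed.

End Signs.
Section ShuffleSums.
Variables (k : fieldType) (V : gvect k).
Implicit Types (w u v : seq (helt V)).

Definition permlist w (s : 'S_(size w)) : seq 'I_(size w) := [seq s i | i <- enum 'I_(size w)].
Local Notation letter w := (tnth (in_tuple w)).

Lemma letters_enum w : map (letter w) (enum 'I_(size w)) = w.
Proof. exact: map_tnth_enum. Qed.

Lemma rearrE w (s : 'S_(size w)) : rearr s = map (letter w) (permlist s).
Proof. by rewrite /permlist -map_comp. Qed.

Lemma size_permlist w (s : 'S_(size w)) : size (permlist s) = size w.
Proof. by rewrite size_map -cardE card_ord. Qed.

Lemma nth_permlist w (s : 'S_(size w)) i0 (i : 'I_(size w)) : nth i0 (permlist s) i = s i.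
Proof. by rewrite (nth_map i0) ?nth_ord_enum // -cardE card_ord. Qed.

Lemma ksgnE w (s : 'S_(size w)) : ksgn s = lsign (letter w) (permlist s).
Proof.
have [i0 _|noi] := pickP 'I_(size w); last first.
  rewrite /ksgn big1; last by move=> i; have := noi i.
  by rewrite /permlist; case: (enum 'I_(size w)) => // i; have := noi i.
rewrite -(prod_inversions _ _ i0) size_permlist.
apply: eq_bigr => i _; apply: eq_big => j; first by rewrite !nth_permlist.
by rewrite !nth_permlist.
Qed.

Lemma is_shuffleE w (s : 'S_(size w)) n : (n <= size w)%N ->
  is_shuffle n s = increasing (take n (permlist s)) && increasing (drop n (permlist s)).
Proof.
move=> nw; have [i0 _|noi] := pickP 'I_(size w); last first.
  have -> : permlist s = [::].
    by rewrite /permlist; case: (enum 'I_(size w)) => // i; have := noi i.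
  by apply/forallP => i; have := noi i.
set l := permlist s.
have szt : size (take n l) = n by rewrite size_takel // size_permlist.
have szd : size (drop n l) = (size w - n)%N by rewrite size_drop size_permlist.
have lE i (iw : (i < size w)%N) : nth i0 l i = s (Ordinal iw).
  by rewrite -(nth_permlist s i0 (Ordinal iw)).
apply/forallP/andP => [H|[/(pairwiseP i0) H1 /(pairwiseP i0) H2] i].
  split; apply/(pairwiseP i0) => i j; rewrite !inE ?szt ?szd => i_ j_ ij.
  - have iw : (i < size w)%N by lia.
    have jw : (j < size w)%N by lia.
    rewrite !nth_take // !lE.
    have /forallP /(_ (Ordinal jw)) /implyP := H (Ordinal iw).
    by apply; rewrite /= ij j_.
  - have iw : (n + i < size w)%N by lia.
    have jw : (n + j < size w)%N by lia.
    rewrite !nth_drop !lE.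
    have /forallP /(_ (Ordinal jw)) /implyP := H (Ordinal iw).
    by apply; rewrite /= ltn_add2l ij leq_addr orbT.
apply/forallP => j; apply/implyP => /andP[ij].
have := ltn_ord i; have := ltn_ord j => jw iw.
case/orP => [jn|ni].
- have := H1 i j; rewrite !inE szt !nth_take ?(ltn_trans ij jn) // !nth_permlist.
  by apply.
- have := H2 (i - n)%N (j - n)%N;
  rewrite !inE szd !nth_drop !subnKC ?(leq_trans ni (ltnW ij)) //.
  by rewrite !nth_permlist; apply; lia.
Qed.

Lemma sum_lists_cut (m : nat) (X : 'I_m -> helt V) (W : lmodType k)
    (G : seq 'I_m -> seq 'I_m -> W) p n :
  increasing p -> (n <= size p)%N ->
  \sum_(l <- permutations p) lsign X l *: G (take n l) (drop n l) =
  \sum_(q <- splits p | size q.1 == n) cross X q.1 q.2 *: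
     \sum_(l1 <- permutations q.1) \sum_(l2 <- permutations q.2)
        (lsign X l1 * lsign X l2) *: G l1 l2.
Proof.
move=> incp np.
transitivity (\sum_(l <- permutations p)
   (lsign X (take n l) * lsign X (drop n l) * cross X (take n l) (drop n l)) *:
   G (take n l) (drop n l)).
  by apply: eq_bigr => l _; rewrite -lsign_cat cat_take_drop.
rewrite (sum_permutations_split (fun l1 l2 =>
   (lsign X l1 * lsign X l2 * cross X l1 l2) *: G l1 l2)) ?increasing_uniq //.
apply: eq_bigr => q _; rewrite scaler_sumr; apply: eq_big_seq => l1.
rewrite mem_permutations => e1; rewrite scaler_sumr; apply: eq_big_seq => l2.
rewrite mem_permutations => e2.
by rewrite (cross_perm _ e1 e2) scalerA mulrC.
Qed.

Lemma sum_increasing (m : nat) (W : nmodType) (F : seq 'I_m -> W) p : increasing p ->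
  \sum_(l <- permutations p | increasing l) F l = F p.
Proof.
move=> incp; rewrite big_mkcond (bigD1_seq p) /= ?incp ?permutations_uniq ?mem_permutations //.
rewrite big1_seq ?addr0 // => l /andP[lp]; rewrite mem_permutations => e.
by case: ifP => // incl; case/eqP: lp; apply: increasing_eq.
Qed.

(** A permutation is a shuffle when both of its blocks are increasing. After extension by zero to
    all orderings and a cut at n, each split keeps only its two increasing orderings, with sign
    [cross]. *)
Lemma sum_shuffles (W : lmodType k) (G : seq (helt V) -> seq (helt V) -> W) w n :
  (n <= size w)%N ->
  \sum_(s : 'S_(size w) | is_shuffle n s)
     ksgn s *: G (take n (rearr s)) (drop n (rearr s)) =
  ssum (fun u v => if size u == n then G u v else 0) w.
Proof.
move=> nw; set X := letter w.
pose G' (l1 l2 : seq 'I_(size w)) :=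
  if increasing l1 && increasing l2 then G (map X l1) (map X l2) else 0.
transitivity (\sum_(s : 'S_(size w))
    lsign X (permlist s) *: G' (take n (permlist s)) (drop n (permlist s))).
  rewrite big_mkcond; apply: eq_bigr => s _.
  rewrite is_shuffleE // /G' ksgnE rearrE -map_take -map_drop.
  by case: ifP => _ //; rewrite scaler0.
rewrite (sum_perm_list (fun l => lsign X l *: G' (take n l) (drop n l))).
rewrite sum_lists_cut ?increasing_enum ?size_enum_ord //.
rewrite -[in RHS](letters_enum w) -cross_ssum ?increasing_enum // big_mkcond.
apply: eq_big_seq => q /splits_subseq[_ q1 q2]; rewrite size_map.
have i1 := increasing_subseq q1 (increasing_enum _).
have i2 := increasing_subseq q2 (increasing_enum _).
case: ifP => _; last by rewrite scaler0.
congr (_ *: _).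
transitivity (\sum_(l1 <- permutations q.1 | increasing l1)
   \sum_(l2 <- permutations q.2 | increasing l2)
     (lsign X l1 * lsign X l2) *: G (map X l1) (map X l2)).
  rewrite [RHS]big_mkcond; apply: eq_bigr => l1 _.
  case: ifP => h1; last first.
    by rewrite big1 // => l2 _; rewrite /G' h1 scaler0.
  rewrite [RHS]big_mkcond; apply: eq_bigr => l2 _; rewrite /G' h1 /=.
  by case: ifP; rewrite ?scaler0.
by rewrite !sum_increasing // !lsign_increasing // mulr1 scale1r.
Qed.

End ShuffleSums.

Section Comult.
Variables (k : fieldType) (V : gvect k).
Implicit Types (w u v : seq (helt V)).

Lemma ssum_bilinear_resp (W : lmodType k) (F : sym V -> sym V -> W) :
  bilinear F -> wresp (ssum (fun u v => F (word u) (word v))).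
Proof.
by move=> [Fl Fr]; apply: ssum_resp => u;
  [apply: (wresp_word (Fl _)) | apply: (wresp_word (Fr _))].
Qed.

Let comult_words w :
  \sum_(n < (size w).+1) \sum_(s : 'S_(size w) | is_shuffle n s)
    ksgn s *: tmk (word (take n (rearr s))) (word (drop n (rearr s))) =
  ssum (fun u v => tmk (word u) (word v)) w.
Proof.
transitivity (\sum_(n < (size w).+1) ssum (fun u v => if size u == n then tmk (word u) (word
  v) else 0) w).
  apply: eq_bigr => n _.
  by rewrite (sum_shuffles (fun u v => tmk (word u) (word v))) // -ltnS.
rewrite -ssum_sum; apply: eq_ssum => u v uv _.
have uw : (size u < (size w).+1)%N by lia.
rewrite (bigD1 (Ordinal uw)) //= eqxx big1 ?addr0 // => i.
by rewrite -val_eqE eq_sym => /negbTE /= ->.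
Qed.

Lemma comult_word w : comult (word w) = ssum (fun u v => tmk (word u) (word v)) w.
Proof.
rewrite /comult (slift_ext comult_words) slift_wordE //.
by apply: ssum_bilinear_resp; apply: bilinear_tmk.
Qed.

Lemma comult_linear : linear (@comult k V).
Proof.
rewrite /comult (slift_ext comult_words); apply: slift_lin.
by apply: ssum_bilinear_resp; apply: bilinear_tmk.
Qed.

Lemma tlift_comult (W : lmodType k) (F : sym V -> sym V -> W) w : bilinear F ->
  tlift F (comult (word w)) = ssum (fun u v => F (word u) (word v)) w.
Proof.
move=> bF; rewrite comult_word (ssum_lin _ _ (tlift_linear bF)).
by apply: ssum_ext => u v; rewrite tlift_tmk.
Qed.

Lemma codext_wordE n l w :
  codext_word n l w = ssum (fun u v => if size u == n then l u * word v else 0) w :> sym V.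
Proof.
rewrite /codext_word; case: leqP => [nw|wn].
  exact: (sum_shuffles (fun u v => l u * word v)).
rewrite (eq_ssum (G' := fun _ _ => 0)) ?ssum0 // => u v uv _.
by case: eqP => // E; lia.
Qed.

End Comult.

Lemma natf_neq0_char0 (k : fieldType) (n : nat) :
  [pchar k] =i pred0 -> (0 < n)%N -> n%:R != 0 :> k.
Proof. by move=> /pcharf0P ->; rewrite -lt0n. Qed.

(** * Sums over compositions and permutations as convolution powers *)

Section BlockSums.
Variables (k : fieldType) (V : gvect k) (A : algType k).
Variable (F : seq (helt V) -> A).

(* Only nonempty blocks contribute: this is the r-th convolution power of F minus
   its value on the empty word times the counit. *)
Fixpoint convpow (r : nat) (w : seq (helt V)) : A :=
  if r is r'.+1 then
    ssum (fun u v => if u == [::] then 0 else F u * convpow r' v) w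
  else (w == [::])%:R.

Hypothesis Fsym : wsymmetric F.

Lemma sum_lsign_perm (m : nat) (X : 'I_m -> helt V) p : increasing p ->
  \sum_(l <- permutations p) lsign X l *: F (map X l) = (size p)`!%:R *: F (map X p).
Proof.
move=> incp; rewrite (eq_big_seq (fun=> F (map X p))).
  rewrite big_const_seq count_predT size_permutations ?increasing_uniq //.
  by rewrite iter_addr_0 scaler_nat.
move=> l; rewrite mem_permutations => lp.
by rewrite (lsign_perm _ Fsym lp) lsign_increasing // scale1r.
Qed.

Lemma sum_tupleS (W : nmodType) (T : finType) r (G : seq T -> W) (P : pred (seq T)) :
  \sum_(t : r.+1.-tuple T | P t) G t =
  \sum_(i : T) \sum_(t : r.-tuple T | P (i :: t)) G (i :: t).
Proof.
rewrite pair_big_dep /=.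
rewrite (reindex (fun q : T * r.-tuple T => [tuple of q.1 :: q.2])) /=; first by [].
exists (fun t => (thead t, [tuple of behead t])) => [[i t] _|t _] /=.
  by rewrite theadE; congr pair; apply: val_inj.
by rewrite [t in RHS]tuple_eta; apply: val_inj.
Qed.

(** Induction on the number of blocks: the first block is split off, its i! orderings contribute
    equally by the symmetry of F, and this cancels 1/i!. The bound M on the entries of the
    composition stays fixed while p shrinks, so that the type of the tuples does not change. *)
Lemma block_convpow (m M : nat) (X : 'I_m -> helt V) r p : [pchar k] =i pred0 ->
  increasing p -> (size p < M)%N ->
  \sum_(t : r.-tuple 'I_M |
        all (fun i : 'I__ => 0 < i)%N t && (sumn [seq val i | i <- t] == size p))
    (\prod_(i <- t) (i`!%:R : k)^-1) *:
    \sum_(l <- permutations p) lsign X l *: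
      \prod_(b <- reshape [seq val i | i <- t] l) F (map X b)
  = convpow r (map X p).
Proof.
move=> char0; elim: r p => [|r IH] p incp pM.
  rewrite (eq_bigr (fun=> \sum_(l <- permutations p) lsign X l *: (1 : A))); last first.
    by move=> t _; rewrite tuple0 big_nil scale1r; apply: eq_bigr => l _; rewrite big_nil.
  case: p incp pM => [|i p] incp pM /=.
    rewrite (big_pred1 [tuple]); last by move=> t; rewrite tuple0 [RHS]eqxx.
    by rewrite big_seq1 scale1r.
  by rewrite big_pred0 // => t; rewrite tuple0.
rewrite (sum_tupleS r (fun t : seq 'I_M => (\prod_(i <- t) (i`!%:R : k)^-1) *:
    \sum_(l <- permutations p) lsign X l *:
      \prod_(b <- reshape [seq val i | i <- t] l) F (map X b))
   (fun t : seq 'I_M => all (fun i : 'I_M => 0 < i)%N t && (sumn [seq val i | i <- t] == size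
     p))).
(* The contribution of a first block of length i. For i = 0, or i larger than the length of p, both
   sides vanish. *)
have step (i : 'I_M) : \sum_(t : r.-tuple 'I_M |
     all (fun i : 'I_M => 0 < i)%N (i :: t) && (sumn [seq val i | i <- i :: t] == size p))
    (\prod_(j <- i :: t) (j`!%:R : k)^-1) *:
    \sum_(l <- permutations p) lsign X l *:
      \prod_(b <- reshape [seq val i | i <- i :: t] l) F (map X b)
   = \sum_(q <- splits p | size q.1 == i) cross X q.1 q.2 *:
        (if q.1 == [::] then 0 else F (map X q.1) * convpow r (map X q.2)).
  have [i0|ipos] := posnP i.
    rewrite big_pred0; last by move=> t; rewrite /= i0.
    rewrite big1 // => q; rewrite i0 => /nilP ->; exact: scaler0.
  have [ip|pi] := leqP i (size p); last first.
    rewrite big_pred0; last first.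
      by move=> t /=; apply/negP => /andP[_ /eqP E]; lia.
    rewrite big1_seq // => q /andP[/eqP qi /splits_subseq[_ /size_subseq q1 _]].
    by have := leq_ltn_trans q1 pi; rewrite qi ltnn.
  transitivity (\sum_(t : r.-tuple 'I_M |
     all (fun i : 'I_M => 0 < i)%N t && (sumn [seq val i | i <- t] == size p - i)%N)
     \sum_(q <- splits p | size q.1 == i) cross X q.1 q.2 *:
        (F (map X q.1) * ((\prod_(j <- t) (j`!%:R : k)^-1) *:
          \sum_(l <- permutations q.2) lsign X l *:
            \prod_(b <- reshape [seq val i | i <- t] l) F (map X b)))).
    apply: eq_big => [t|t _].
      by rewrite /= ipos /=; congr (_ && _); apply/eqP/eqP; lia.
    rewrite big_cons.
    rewrite (eq_bigr (fun l => lsign X l *: (F (map X (take i l)) *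
      \prod_(b <- reshape [seq val j | j <- t] (drop i l)) F (map X b)))); last first.
      by move=> l _; rewrite /= big_cons.
    rewrite (sum_lists_cut X (fun l1 l2 => F (map X l1) *
      \prod_(b <- reshape [seq val i | i <- t] l2) F (map X b)) incp ip).
    rewrite scaler_sumr big_seq_cond [RHS]big_seq_cond;
      apply: eq_bigr => q /andP[/splits_subseq[_ q1 q2] /eqP q1i].
    have i1 := increasing_subseq q1 incp.
    transitivity ((\prod_(j <- t) (j`!%:R : k)^-1 * (i`!%:R)^-1) *: (cross X q.1 q.2 *:
      ((\sum_(l1 <- permutations q.1) lsign X l1 *: F (map X l1)) *
       \sum_(l2 <- permutations q.2) lsign X l2 *:
         \prod_(b <- reshape [seq val i | i <- t] l2) F (map X b)))).
      rewrite [_^-1 * _]mulrC; congr (_ *: (_ *: _)); rewrite mulr_suml; apply: eq_bigr => l1 _.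
      rewrite mulr_sumr; apply: eq_bigr => l2 _.
      by rewrite -scalerAl -scalerAr scalerA.
    rewrite sum_lsign_perm // q1i -scalerAl -scalerAr !scalerA; congr (_ *: _).
    have f0 := natf_neq0_char0 char0 (fact_gt0 i).
    by set P := \prod_(j <- t) _; field.
  rewrite exchange_big big_seq_cond [RHS]big_seq_cond;
    apply: eq_bigr => q /andP[/splits_subseq[qp q1 q2] /eqP q1i].
  rewrite -scaler_sumr -mulr_sumr.
  have sq : size q.2 = (size p - i)%N.
    by have := perm_size qp; rewrite size_cat q1i => <-; rewrite addKn.
  rewrite -sq IH; last by rewrite sq (leq_ltn_trans (leq_subr _ _)).
    by case: eqP => // q10; move: q1i; rewrite q10 /= => E; rewrite -E in ipos.
  exact: increasing_subseq q2 incp.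
rewrite (eq_bigr _ (fun i _ => step i)) (exchange_big_dep xpredT) //=.
rewrite -cross_ssum //=.
apply: eq_big_seq => q /splits_subseq[_ /size_subseq q1 _].
have qM := leq_ltn_trans q1 pM.
(* Each split is counted for exactly one block length, that of its left part. *)
rewrite (big_pred1 (Ordinal qM)) => [|i]; last exact: eq_sym.
by rewrite /=; case: (q.1).
Qed.

End BlockSums.
(** * Degrees and primitive elements *)

Section Degrees.
Variables (k : fieldType) (V : gvect k).
Implicit Types (w u v : seq (helt V)) (x z : helt V) (a b : sym V).

Lemma sproj_wdeg w : sproj (wdeg w) (word w) = word w.
Proof. by rewrite sproj_word eqxx. Qed.

Lemma sproj0 p : sproj p (0 : sym V) = 0.
Proof. exact/lin0/sproj_linear. Qed.

Lemma sprojZ p c a : sproj p a = a -> sproj p (c *: a) = c *: a.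
Proof. by move=> pa; rewrite (linZ _ (sproj_linear p)) pa. Qed.

Lemma sproj_bigsum p I (r : seq I) (P : pred I) (F : I -> sym V) :
  (forall i, P i -> sproj p (F i) = F i) ->
  sproj p (\sum_(i <- r | P i) F i) = \sum_(i <- r | P i) F i.
Proof. by move=> FF; rewrite (lin_sum _ _ _ (sproj_linear p)); apply: eq_bigr. Qed.

Lemma sproj_ssum p (U : gvect k) (G : seq (helt U) -> seq (helt U) ->
  sym V) (w' : seq (helt U)) :
  (forall u v : seq (helt U), wdeg u + wdeg v = wdeg w' -> sproj p (G u v) = G u v) ->
  sproj p (ssum G w') = ssum G w'.
Proof.
move=> GG; rewrite (ssum_lin _ _ (sproj_linear p)).
by apply: eq_ssum => u v _; apply: GG.
Qed.

Lemma sproj_wproj p n a : sproj p (wproj n a) = wproj n (sproj p a).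
Proof.
move: a; apply: sym_eqP.
- exact: linear_comp (sproj_linear p) (wproj_linear n).
- exact: linear_comp (wproj_linear n) (sproj_linear p).
move=> w; rewrite wproj_word sproj_word (lin_if _ _ (sproj_linear p)).
by rewrite (lin_if _ _ (wproj_linear n)) sproj_word wproj_word; do 2 case: eqP.
Qed.

Lemma word_zero s x t : hval x = 0 -> word (s ++ x :: t) = 0.
Proof.
move=> x0; have := @wordL _ _ s t 1 x x x erefl erefl.
by rewrite x0 scaler0 addr0 scale1r => /(_ erefl) /eqP;
  rewrite -[X in X == _]addr0 => /eqP/addrI.
Qed.

Fact gproj_homog p (y : V) : homog p (gproj (ggr V) p y).
Proof. by rewrite /homog gproj_comp eqxx. Qed.
Definition letter_of p (y : V) : helt V :=
  exist (fun z : int * V => homog z.1 z.2) (p, gproj (ggr V) p y) (gproj_homog p y).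

Lemma helt_eq x z : hdeg x = hdeg z -> hval x = hval z -> x = z.
Proof.
case: x z => [[p y] py] [[q y'] qy']; rewrite /hdeg /hval /= => E E'.
by apply: val_inj; rewrite /= E E'.
Qed.

Definition pr1 : sym V -> V := slift (fun w => if w is [:: x] then hval x else 0).

Fact wresp_pr1 : wresp (fun w => if w is [:: x] then hval x else 0 : V).
Proof.
split=> [[|? [|? ?]] [|? ?] a x y z _ _ zE|[|? [|? ?]] t x y] //=;
  by rewrite ?scaler0 ?addr0.
Qed.

Lemma letter_linear p : linear (fun y : V => word [:: letter_of p y]).
Proof.
move=> c y y'; apply: (@wordL _ _ [::] [::]); rewrite //=.
exact: gproj_linear.
Qed.

Lemma wproj1_letter p a : sproj p (wproj 1 a) = word [:: letter_of p (pr1 a)].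
Proof.
have lp : linear pr1 := slift_lin wresp_pr1.
move: a; apply: sym_eqP.
- exact: linear_comp (sproj_linear p) (wproj_linear 1).
- exact: (linear_comp (@letter_linear p) lp).
move=> w; rewrite wproj_word /pr1 slift_wordE; last exact: wresp_pr1.
case: w => [|x [|y w]] /=; rewrite ?sproj0.
- by rewrite (@word_zero [::]) //=; apply/lin0/gproj_linear.
- rewrite sproj_word wdeg1; have xE : gproj (ggr V) (hdeg x) (hval x) = hval x := eqP (valP x).
  have [<-|xp] := eqVneq (hdeg x) p.
    by congr word; congr cons; apply: helt_eq.
  rewrite (@word_zero [::]) //; change (gproj (ggr V) p (hval x) = 0).
  by rewrite -xE gproj_comp eq_sym (negbTE xp).
- by rewrite (@word_zero [::]) //=; apply/lin0/gproj_linear.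
Qed.

(** Turns a homogeneous value in the cogenerators into an actual letter, so that [comult_letter] and
    [counit_letterM] apply to it. *)
Lemma letterP p a : wproj 1 a = a -> sproj p a = a ->
  exists2 x, hdeg x = p & a = word [:: x].
Proof.
move=> a1 ap; exists (letter_of p (pr1 a)) => //.
by rewrite -wproj1_letter a1 ap.
Qed.

Lemma gproj_notin (U : gvect k) (y : U) (s : seq int) p : y = \sum_(q <- s) gproj (ggr U) q y ->
  p \notin s -> gproj (ggr U) p y = 0.
Proof.
move=> yE ps; rewrite yE (lin_sum _ _ _ (gproj_linear _ p)) big1_seq // => q /andP[_ qs].
by rewrite gproj_comp; case: eqP => // pq; rewrite pq qs in ps.
Qed.

(** [parity] is defined from a chosen decomposition. Any two supports are compared with their union,
    outside of which the projections vanish, so the choice does not matter. *)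
Lemma parityE (U : gvect k) (y : U) (s : seq int) : uniq s -> y =
  \sum_(q <- s) gproj (ggr U) q y ->
  parity y = \sum_(q <- s) koszul k q 1 *: gproj (ggr U) q y.
Proof.
move=> us ys; rewrite /parity; case: cid2 => s' us' ys' /=.
suff H (t t' : seq int) : uniq t -> uniq t' -> y = \sum_(q <- t) gproj (ggr U) q y ->
    y = \sum_(q <- t') gproj (ggr U) q y ->
    \sum_(q <- t) koszul k q 1 *: gproj (ggr U) q y =
    \sum_(q <- undup (t ++ t')) koszul k q 1 *: gproj (ggr U) q y.
  rewrite (H s' s) // (H s s') //; apply: perm_big.
  apply: uniq_perm; rewrite ?undup_uniq // => q.
  by rewrite !mem_undup !mem_cat orbC.
move=> ut ut' tE t'E; rewrite [RHS](bigID (mem t)) /= [X in _ + X]big1 ?addr0; last first.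
  by move=> q qt; rewrite (gproj_notin tE) ?scaler0.
rewrite -[RHS]big_filter; apply: perm_big; apply: uniq_perm => //.
  by rewrite filter_uniq ?undup_uniq.
by move=> q; rewrite mem_filter mem_undup mem_cat; case: (q \in t).
Qed.

Lemma parity_homog (U : gvect k) (y : U) p : homog p y -> parity y = koszul k p 1 *: y.
Proof.
move=> /eqP yp; rewrite (@parityE _ _ [:: p]) // big_seq1 ?yp //.
Qed.

Lemma parity_linear (U : gvect k) : linear (@parity k U).
Proof.
move=> c x y.
have [s us xs] := gproj_sum (ggr U) x; have [t ut yt] := gproj_sum (ggr U) y.
pose r := undup (s ++ t).
have E (z : U) (l : seq int) : uniq l -> {subset l <= r} -> z =
  \sum_(q <- l) gproj (ggr U) q z ->
    z = \sum_(q <- r) gproj (ggr U) q z.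
  move=> ul lr zl; rewrite [RHS](bigID (mem l)) /= [X in _ + X]big1 ?addr0.
    rewrite -[RHS]big_filter {1}zl; apply: perm_big; apply: uniq_perm => //.
      by rewrite filter_uniq ?undup_uniq.
    by move=> q; rewrite mem_filter; case: (boolP (q \in l)) => // /lr ->.
  by move=> q; apply: gproj_notin zl.
have xr : x = \sum_(q <- r) gproj (ggr U) q x.
  by apply: (E x s us) => // q qs; rewrite mem_undup mem_cat qs.
have yr : y = \sum_(q <- r) gproj (ggr U) q y.
  by apply: (E y t ut) => // q qs; rewrite mem_undup mem_cat qs orbT.
have ur : uniq r by apply: undup_uniq.
rewrite (parityE ur xr) (parityE ur yr) (parityE ur).
  rewrite scaler_sumr -big_split /=; apply: eq_bigr => q _.
  by rewrite gproj_linear scalerDr !scalerA mulrC.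
rewrite {1}xr {1}yr scaler_sumr -big_split /=; apply: eq_bigr => q _.
by rewrite gproj_linear.
Qed.

Lemma parity_word w : parity (V := symalg V) (word w) = koszul k (wdeg w) 1 *: word w.
Proof. by apply: parity_homog; apply/eqP/sproj_wdeg. Qed.

End Degrees.

Lemma has_degree_word (k : fieldType) (V W : gvect k) d (F : sym V -> sym W) :
  has_degree (V := symalg V) (W := symalg W) d F ->
  forall w, sproj (wdeg w + d) (F (word w)) = F (word w).
Proof.
move=> Fd w; apply/eqP; apply: (Fd (wdeg w)).
by apply/eqP/sproj_wdeg.
Qed.

Lemma word_has_degree (k : fieldType) (V W : gvect k) d (F : sym V -> sym W) :
  linear F -> (forall w, sproj (wdeg w + d) (F (word w)) = F (word w)) ->
  has_degree (V := symalg V) (W := symalg W) d F.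
Proof.
move=> lF Fd p a /eqP ap; apply/eqP; change (sproj (p + d) (F a) = F a).
rewrite -[a]ap; move: a {ap}; apply: sym_eqP.
- exact: linear_comp (linear_comp (sproj_linear _) lF) (sproj_linear p).
- exact: linear_comp lF (sproj_linear p).
move=> w; change (sproj (p + d) (F (sproj p (word w))) = F (sproj p (word w))).
rewrite sproj_word; case: eqP => [<-|_]; first exact: Fd.
by rewrite (lin0 lF) sproj0.
Qed.

Section Primitive.
Variables (k : fieldType) (V : gvect k).
Hypothesis char0 : [pchar k] =i pred0.
Implicit Types (w u v : seq (helt V)) (x z : helt V) (a b : sym V).

Lemma letter_mulC x w : word [:: x] * word w =
  koszul k (hdeg x) (wdeg w) *: (word w * word [:: x]).
Proof. by rewrite !wordM wordC wdeg1. Qed.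

Lemma ssum_mul w : ssum (fun u v => word u * word v) w = (2 ^ size w)%:R *: word w :> sym V.
Proof.
elim: w => [|x w IH] /=; first by rewrite mulr1 scale1r.
rewrite (ssum_ext w (G' := fun u v => word [:: x] * (word u * word v))); last first.
  by move=> u v; rewrite word_cons mulrA.
rewrite [X in _ + X](ssum_ext w (G' := fun u v => word [:: x] * (word u * word v))); last first.
  by move=> u v; rewrite mulrA letter_mulC -scalerAl -mulrA -word_cons.
rewrite -(ssum_lin (F := fun y => word [:: x] * y)); last by apply: linear_mull.
by rewrite IH -scalerAr wordM cat1s -scalerDl expnS mul2n -addnn natrD.
Qed.

Lemma comult1 : comult (1 : sym V) = tmk 1 1.
Proof. by rewrite -word_nil comult_word. Qed.

(* Multiplying the two tensor factors back together gives 2 ^ n on S^n(V). *)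
Lemma primitive_wproj a : comult a = tmk a 1 + tmk 1 a -> wproj 1 a = a.
Proof.
move=> pa.
have E : tlift (fun b c : sym V => b * c) (comult a) = a *+ 2.
  rewrite pa (linD (tlift_linear (bilinear_mul V))) !tlift_tmk; try exact: bilinear_mul.
  by rewrite mulr1 mul1r mulr2n.
apply: wproj_inj => n; rewrite wproj_comp.
have En : wproj n (a *+ 2) = (2 ^ n)%:R *: wproj n a.
  rewrite -E; move: a {pa E}; apply: sym_eqP.
  - apply: (linear_comp (wproj_linear n)).
    exact: linear_comp (tlift_linear (bilinear_mul V)) (@comult_linear k V).
  - by apply: linear_scale; apply: wproj_linear.
  move=> w; rewrite tlift_comult; last exact: bilinear_mul.
  rewrite ssum_mul (linZ _ (wproj_linear n)) wproj_word.
  by case: eqP => [->|]; rewrite ?scaler0.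
case: eqP => [<- //|n1].
move: En; rewrite mulr2n (linD (wproj_linear n)) -mulr2n -scaler_nat => /eqP.
rewrite -subr_eq0 -scalerBl scaler_eq0 => /orP[|/eqP -> //].
(* The scalar is 2 - 2 ^ n: it is 1 for n = 0 and minus a positive integer for n >= 2, hence nonzero
   in characteristic zero. *)
case: n n1 => [|[|n]] // _.
- by rewrite expn0 (natrD _ 1 1) addrK oner_eq0.
- rewrite expnS -[(2 * _)%N]addn0 (_ : (2 * 2 ^ n.+1 + 0 = 2 + (2 * 2 ^ n.+1 - 2))%N);
  last first.
    by rewrite expnS; have := expn_gt0 2 n; lia.
  rewrite natrD opprD addNKr oppr_eq0 => /eqP E0.
  have : (2 * 2 ^ n.+1 - 2)%:R != 0 :> k.
    by apply: natf_neq0_char0 => //; rewrite expnS; have := expn_gt0 2 n; lia.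
  by rewrite E0 eqxx.
Qed.

Definition koszul_act (p : int) : sym V -> sym V :=
  slift (fun w => koszul k p (wdeg w) *: word w).

Fact wresp_koszul_act p : wresp (fun w => koszul k p (wdeg w) *: word w : sym V).
Proof.
split=> [s t a x y z xz yz zE|s t x y].
- rewrite (wordL s t xz yz zE) !wdeg_cat !wdeg_cons xz yz scalerDr !scalerA.
  by rewrite [a * _]mulrC.
- by rewrite wordS !wdeg_cat !wdeg_cons !scalerA mulrC [hdeg y + (hdeg x + _)]addrCA.
Qed.

Lemma koszul_act_word p w : koszul_act p (word w) = koszul k p (wdeg w) *: word w.
Proof. exact/slift_wordE/wresp_koszul_act. Qed.
Lemma koszul_act_linear p : linear (koszul_act p).
Proof. exact/slift_lin/wresp_koszul_act. Qed.

Lemma koszul_act_homog p q a : sproj q a = a -> koszul_act p a = koszul k p q *: a.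
Proof.
move=> <-; move: a; apply: sym_eqP.
- exact: linear_comp (koszul_act_linear p) (sproj_linear q).
- by apply: linear_scale; apply: sproj_linear.
move=> w; rewrite sproj_word; case: eqP => [<-|_]; first exact: koszul_act_word.
by rewrite lin0 ?scaler0 //; apply: koszul_act_linear.
Qed.

(** Multiplication by x tensor 1 + 1 tensor x in the graded tensor square, where [koszul_act] is the
    sign of moving x past the left factor. Thus [comult_letter] is multiplicativity of the coproduct
    on a letter. *)
Definition letter_act x (b c : sym V) : tens (sym V) (sym V) :=
  tmk (word [:: x] * b) c + tmk (koszul_act (hdeg x) b) (word [:: x] * c).

Lemma bilinear_letter_act x : bilinear (letter_act x).
Proof.
have [tl tr] := bilinear_tmk (sym V) (sym V).
split=> b; rewrite /letter_act; apply: linear_add.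
- by apply: (linear_comp (tl _)); apply: linear_mull.
- exact: linear_comp (tl _) (@koszul_act_linear _).
- exact: tr.
- by apply: (linear_comp (tr _)); apply: linear_mull.
Qed.

Lemma comult_letter x a : comult (word [:: x] * a) = tlift (letter_act x) (comult a).
Proof.
have [tl tr] := bilinear_tmk (sym V) (sym V).
have bl := bilinear_letter_act x.
move: a; apply: sym_eqP.
- by apply: (linear_comp (@comult_linear k V)); apply: linear_mull.
- exact: linear_comp (tlift_linear bl) (@comult_linear k V).
move=> w; rewrite wordM cat1s tlift_comult // comult_word /= -ssumD.
apply: ssum_ext => u v; rewrite /letter_act -word_cons -(word_cons x v); congr (_ + _).
by rewrite koszul_act_word (linZ _ (tl _)).
Qed.

End Primitive.
(** * Convolution powers, coalgebra morphisms and coderivations *)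

Section ConvolutionPowers.
Variables (k : fieldType) (V W : gvect k).
Implicit Types (w u v : seq (helt V)) (q : sym V -> sym W).

Local Notation cpw q := (convpow (fun u => q (word u))).

(** Subtracting the counit kills the empty word by a linear operation. The case distinction in
    [convpow] thereby becomes a convolution of linear maps, as [CPS] states. *)
Definition reduced q (a : sym V) : sym W := q (a - (counit a : k) *: (1 : sym V)).

Lemma counit_word w : counit (word w : sym V) = (w == [::])%:R :> k.
Proof. exact: (slift_word (@counit_resp k V) w). Qed.
Lemma counit_linear : linear (@counit k V).
Proof. exact: (slift_linear (@counit_resp k V)). Qed.

Lemma reduced_linear q : linear q -> linear (reduced q).
Proof.
move=> lq; apply: (linear_comp lq); apply: linear_sub => // a x y.
by rewrite counit_linear scalerDl scalerA.
Qed.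

Lemma reduced_word q w : linear q ->
  reduced q (word w) = if w == [::] then 0 else q (word w).
Proof.
move=> lq; rewrite /reduced counit_word; case: eqP => [->|_].
  by rewrite scale1r subrr lin0.
by rewrite scale0r subr0.
Qed.

Definition CP q r : sym V -> sym W := slift (cpw q r).

Lemma bilinear_mul_comp q q' : linear q -> linear q' -> bilinear (fun a b => q a * q' b).
Proof.
move=> lq lq'; split=> c; [exact: linear_mulr | exact: linear_mull].
Qed.

Lemma wresp_cpw q r : linear q -> wresp (cpw q r).
Proof.
move=> lq; elim: r => [|r IH].
  apply: wresp_ext (wresp_word (F := fun a => (counit a : k) *: (1 : sym W)) _).
    by move=> w; rewrite /= counit_word scaler_nat.
  by move=> a x y; rewrite counit_linear scalerDl scalerA.
apply: wresp_ext (ssum_bilinear_resp (F := fun a b => reduced q a * CP q r b) _).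
  move=> w; apply: ssum_ext => u v; rewrite reduced_word // /CP slift_wordE //.
  by case: eqP; rewrite ?mul0r.
by apply: bilinear_mul_comp; [apply: reduced_linear | apply: slift_lin].
Qed.

Lemma CP_word q r w : linear q -> CP q r (word w) = cpw q r w.
Proof. by move=> lq; apply/slift_wordE/wresp_cpw. Qed.
Lemma CP_linear q r : linear q -> linear (CP q r).
Proof. by move=> lq; apply/slift_lin/wresp_cpw. Qed.

Lemma CP0 q a : linear q -> CP q 0 a = (counit a : k) *: 1.
Proof.
move=> lq; move: a; apply: sym_eqP; first exact: CP_linear.
  by move=> a x y; rewrite counit_linear scalerDl scalerA.
by move=> w; rewrite CP_word // counit_word /= scaler_nat.
Qed.

Lemma CPS q r a : linear q ->
  CP q r.+1 a = tlift (fun b c => reduced q b * CP q r c) (comult a).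
Proof.
move=> lq.
have bl : bilinear (fun b c => reduced q b * CP q r c).
  by apply: bilinear_mul_comp; [apply: reduced_linear | apply: CP_linear].
move: a; apply: sym_eqP; first exact: CP_linear.
  exact: linear_comp (tlift_linear bl) (@comult_linear k V).
move=> w; rewrite CP_word // tlift_comult //=; apply: ssum_ext => u v.
by rewrite reduced_word // CP_word //; case: eqP; rewrite ?mul0r.
Qed.

Lemma convpow_big (F : seq (helt V) -> sym W) r w : (size w < r)%N -> convpow F r w = 0.
Proof.
elim: r w => //= r IH w wr.
rewrite (eq_ssum (G' := fun _ _ => 0)) ?ssum0 // => -[|x u] v //= uv _.
by rewrite IH ?mulr0 //; lia.
Qed.

Lemma ssum_convpow (F : seq (helt V) -> sym W) r w :
  ssum (fun u v => F u * convpow F r v) w = F [::] * convpow F r w + convpow F r.+1 w.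
Proof.
have <- : ssum (fun u v => if u == [::] then F u * convpow F r v else 0) w =
    F [::] * convpow F r w by rewrite ssum_nill // => u v /negbTE ->.
by rewrite /= -ssumD; apply: ssum_ext => u v; case: eqP; rewrite ?addr0 ?add0r.
Qed.

Lemma sproj_convpow (F : seq (helt V) -> sym W) r w :
  (forall u, sproj (wdeg u) (F u) = F u) ->
  sproj (wdeg w) (convpow F r w) = convpow F r w.
Proof.
move=> FF; elim: r w => [|r IH] w /=.
  by case: w => [|x w] /=; [rewrite wdeg_nil sproj1 | rewrite sproj0].
apply: sproj_ssum => u v uv; case: eqP => _; first exact: sproj0.
by rewrite -uv; apply: sprojM.
Qed.

Lemma convpowS_cons (F : seq (helt V) -> sym W) r x w :
  convpow F r.+1 (x :: w) = ssum (fun u v => F (x :: u) * convpow F r v) w +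
    ssum (fun u v => koszul k (hdeg x) (wdeg u) *:
      (if u == [::] then 0 else F u * convpow F r (x :: v))) w.
Proof. by []. Qed.

(* Leibniz rule for prepending a letter: all r + 1 terms agree because F is even
   and the coproduct cocommutative. *)
Lemma convpow_cons (F : seq (helt V) -> sym W) r x w :
  (forall u, sproj (wdeg u) (F u) = F u) ->
  convpow F r.+1 (x :: w) = r.+1%:R *: ssum (fun u v => F (x :: u) * convpow F r v) w.
Proof.
move=> FF; elim: r w => [|r IH] w; rewrite convpowS_cons.
  rewrite scale1r [X in _ + X](ssum_ext _ (G' := fun _ _ => 0)) ?ssum0 ?addr0 //.
  by move=> u v; rewrite /= mulr0 if_same scaler0.
rewrite -natr1 scalerDl scale1r addrC; congr (_ + _).
transitivity (r.+1%:R *: ssum (fun u v => ssum (fun v1 v2 =>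
     koszul k (wdeg u) (wdeg v1) *:
       (F (x :: v1) * ((if u == [::] then 0 else F u) * convpow F r v2))) v) w).
  rewrite -ssumZ; apply: ssum_ext => u v; rewrite IH.
  have [->|u0] := eqVneq u [::].
    by rewrite !scaler0; under ssum_ext do rewrite mul0r mulr0 scaler0; rewrite ssum0 scaler0.
  rewrite -scalerAr scalerA mulrC -scalerA; congr (_ *: _).
  rewrite (ssum_lin (F := fun y => F u * y)); last by apply: linear_mull.
  rewrite -ssumZ; apply: ssum_ext => v1 v2.
  rewrite !mulrA (sprojC (FF u) (FF (x :: v1))) -scalerAl scalerA; congr (_ *: _).
  by rewrite wdeg_cons koszulDr mulrA koszulKC mul1r.
congr (_ *: _).
(* Commuting F u past the block that contains x cancels the sign of x against u. What remains is the
   sign of cocommutativity, so the block with x can be moved to the front. *)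
rewrite -(ssum_swap12 (fun u v1 v2 => F (x :: u) * ((if v1 == [::] then 0 else F v1) *
  convpow F r v2))).
apply: ssum_ext => u v.
rewrite -(ssum_lin (F := fun y => F (x :: u) * y)); last by apply: linear_mull.
congr (_ * _); apply: ssum_ext => v1 v2; by case: eqP; rewrite ?mul0r.
Qed.

Definition convsum (c : nat -> k) (F : seq (helt V) -> sym W) w : sym W :=
  \sum_(1 <= r < (size w).+1) c r *: convpow F r w.

Lemma convsumE c F w N : (size w < N)%N -> convsum c F w =
  \sum_(1 <= r < N) c r *: convpow F r w.
Proof.
move=> wN; rewrite [RHS](@big_cat_nat _ _ _ (size w).+1) //= [X in _ + X]big_nat_cond.
rewrite [X in _ + X]big1 ?addr0 // => r /andP[/andP[wr _] _].
by rewrite convpow_big // scaler0.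
Qed.

Lemma wresp_convsum c q : linear q -> wresp (convsum c (fun u => q (word u))).
Proof.
move=> lq.
have H N : wresp (fun w => \sum_(1 <= r < N) c r *: cpw q r w).
  apply: wresp_ext (wresp_word (F := fun a => \sum_(1 <= r < N) c r *: CP q r a) _).
    by move=> w; apply: eq_bigr => r _; rewrite CP_word.
  by apply: linear_suml => r; apply: linear_scale; apply: CP_linear.
(* The truncation in [convsum] depends on the word, but all words in one relator have the same
   length, so a single N serves. *)
split=> [s t a x y z xz yz zE|s t x y].
- have [h _] := H (size (s ++ x :: t)).+1; have := h s t a x y z xz yz zE.
  by rewrite -!convsumE // !size_cat.
- have [_ h] := H (size (s ++ x :: y :: t)).+1; have := h s t x y.
  by rewrite -!convsumE // !size_cat.
Qed.

End ConvolutionPowers.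

Section CoalgebraMorphisms.
Variables (k : fieldType).
Hypothesis char0 : [pchar k] =i pred0.

Lemma fact_inv_neq0 r : (r`!%:R : k) != 0.
Proof. exact: natf_neq0_char0 (fact_gt0 r). Qed.

Section Projection.
Variable V : gvect k.
Implicit Types (w u v : seq (helt V)).

Lemma sproj_wproj1_word u : sproj (wdeg u) (wproj 1 (word u : sym V)) = wproj 1 (word u).
Proof. by rewrite sproj_wproj sproj_wdeg. Qed.

(** The projection onto S^1 sees only one-letter blocks, so a word must have r letters, and its r!
    divisions into single letters all multiply back to it. *)
Lemma CP_wproj1 r (a : sym V) : CP (wproj 1) r a = r`!%:R *: wproj r a.
Proof.
move: a; apply: sym_eqP; first by apply: CP_linear; apply: wproj_linear.
  by apply: linear_scale; apply: wproj_linear.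
move=> w; rewrite CP_word; last exact: wproj_linear.
elim: w r => [|x w IH] [|r]; rewrite ?wproj_word ?scaler0 ?scale1r //.
rewrite convpow_cons; last exact: sproj_wproj1_word.
rewrite ssum_nill => [|[|y u] v // _]; last by rewrite wproj_word mul0r.
rewrite IH !wproj_word /= eqSS; case: eqP => // _.
  by rewrite -scalerAr wordM cat1s scalerA factS natrM.
by rewrite !scaler0 mulr0 scaler0.
Qed.

(* The number of surjections from an m-element set onto an r-element set. *)
Fixpoint surj (m r : nat) : k :=
  match m, r with
  | 0%N, 0%N => 1
  | m'.+1, r'.+1 => r%:R * (surj m' r' + surj m' r'.+1)
  | _, _ => 0
  end.

Lemma surj_big m r : (m < r)%N -> surj m r = 0.
Proof. by elim: m r => [|m IH] [|r] //= mr; rewrite !IH ?addr0 ?mulr0 //; lia. Qed.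

(** Every division of the letters into r ordered nonempty blocks multiplies back to the same word,
    signs included, so it remains to count surjections. *)
Lemma CP_id r w : CP (fun a : sym V => a) r (word w) = surj (size w) r *: word w.
Proof.
rewrite CP_word //; elim: w r => [|x w IH] [|r]; rewrite ?scale1r ?scale0r //.
rewrite convpow_cons; last exact: sproj_wdeg.
rewrite (ssum_ext w (G' := fun u v => word [:: x] * (word u *
  convpow (fun u => word u) r v))); last first.
  by move=> u v; rewrite word_cons mulrA.
rewrite -(ssum_lin (F := fun y => word [:: x] * y)); last by apply: linear_mull.
rewrite ssum_convpow !IH word_nil mul1r -scalerDl -scalerAr wordM cat1s scalerA.
by [].
Qed.

(* Telescoping: the linear part of the polynomial identity
   t ^ m = \sum_r surj m r * 'C(t, r). *)
Lemma sum_surj m N : (m <= N)%N ->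
  \sum_(1 <= r < N.+1) ((-1) ^+ r.-1 / r%:R) * surj m r = (m == 1%N)%:R.
Proof.
case: m => [_|m mN].
  by rewrite big1_seq // => r; rewrite mem_index_iota => /andP[_ /andP[r0 _]];
    rewrite surj_big ?mulr0.
rewrite big_add1 /=.
transitivity (\sum_(0 <= r < N) ((-1) ^+ r * surj m r - (-1) ^+ r.+1 * surj m r.+1)).
  apply: eq_bigr => r _ /=.
  have r0 := natf_neq0_char0 char0 (ltn0Sn r).
  by rewrite mulrA divfK // mulrDr exprS mulN1r mulNr opprK.
have -> : \sum_(0 <= r < N) ((-1) ^+ r * surj m r - (-1) ^+ r.+1 * surj m r.+1) =
          - \sum_(0 <= r < N) ((-1) ^+ r.+1 * surj m r.+1 - (-1) ^+ r * surj m r).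
  by rewrite -sumrN; apply: eq_bigr => r _; rewrite opprB.
rewrite telescope_sumr // (surj_big mN) mulr0 sub0r opprK mul1r.
(* The surviving end of the telescope is [surj m 0], which is 1 exactly for m = 0, that is, for the
   original exponent 1. *)
by case: m mN.
Qed.

End Projection.

Variables (V W : gvect k).
Implicit Types (w u v : seq (helt V)).

Lemma coalg_tlift (Phi : sym V -> sym W) (M : lmodType k) (F : sym W -> sym W -> M) w :
  is_coalg_morphism Phi -> bilinear F ->
  tlift F (comult (Phi (word w))) = ssum (fun u v => F (Phi (word u)) (Phi (word v))) w.
Proof.
move=> [lP _ cP _] bF; rewrite cP tlift_comult.
  rewrite (ssum_lin _ _ (tlift_linear bF)); apply: ssum_ext => u v.
  by rewrite tlift_tmk.
have [tl tr] := bilinear_tmk (sym W) (sym W).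
by split=> b; [apply: linear_comp (tl _) lP | apply: linear_comp (tr _) lP].
Qed.

Lemma CP_coalg (Phi : sym V -> sym W) (U : gvect k) (q : sym W -> sym U) r a :
  is_coalg_morphism Phi -> Phi 1 = 1 -> linear q ->
  CP (fun x => q (Phi x)) r a = CP q r (Phi a).
Proof.
move=> cP P1 lq; have [lP _ _ eP] := cP.
have lqP : linear (fun x => q (Phi x)) by apply: linear_comp.
elim: r a => [|r IH] a; first by rewrite !CP0 // eP.
move: a; apply: sym_eqP; first exact: CP_linear.
  by apply: linear_comp lP; apply: CP_linear.
move=> w; rewrite [RHS]CPS // coalg_tlift //; last first.
  by apply: bilinear_mul_comp; [apply: reduced_linear | apply: CP_linear].
have IHw v : convpow (fun u => q (Phi (word u))) r v = CP q r (Phi (word v)).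
  by rewrite -IH CP_word.
rewrite CP_word //=; apply: ssum_ext => u v; rewrite IHw.
rewrite /reduced eP counit_word; case: eqP => [->|_].
  by rewrite word_nil P1 scale1r subrr (lin0 lq) mul0r.
by rewrite scale0r subr0.
Qed.

Lemma convpow_coalg (Phi : sym V -> sym W) (U : gvect k) (q : sym W -> sym U) r w :
  is_coalg_morphism Phi -> Phi 1 = 1 -> linear q ->
  convpow (fun u => q (Phi (word u))) r w = CP q r (Phi (word w)).
Proof.
move=> cP P1 lq; have [lP _ _ _] := cP.
rewrite -(CP_coalg _ _ cP P1 lq); apply: esym.
exact: (CP_word r w (linear_comp lq lP)).
Qed.

(** Coalgebra morphisms do not lengthen words: j! times the j-th component of Phi is the j-th
    convolution power of its corestriction, and a word with fewer than j letters has no division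
    into j nonempty blocks. *)
Lemma coalg_fil (Phi : sym V -> sym W) w :
  is_coalg_morphism Phi -> Phi 1 = 1 -> fil (size w) (Phi (word w)).
Proof.
move=> cP P1 j wj; have lp := @wproj_linear k W 1.
have [lP _ _ _] := cP.
have /eqP := CP_coalg j (word w) cP P1 lp.
rewrite CP_wproj1 CP_word ?convpow_big //; last exact: linear_comp lP.
by rewrite eq_sym scaler_eq0 (negbTE (fact_inv_neq0 j)) => /eqP.
Qed.

Lemma coalg_wproj0 (Phi : sym V -> sym W) w :
  is_coalg_morphism Phi -> Phi 1 = 1 -> w != [::] -> wproj 0 (Phi (word w)) = 0.
Proof.
move=> cP P1 w0; have [_ _ _ eP] := cP.
have /eqP := CP_wproj1 0 (Phi (word w)); rewrite CP0 ?eP; last exact: wproj_linear.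
by rewrite counit_word (negbTE w0) scale0r scale1r => /eqP.
Qed.

(* exp(p Phi) = exp(p) Phi for the projection p onto cogenerators, and exp(p) = id;
   likewise log(Phi) = log(id) Phi and log(id) = p in coalg_log. *)
Lemma coalg_exp (Phi : sym V -> sym W) w :
  is_coalg_morphism Phi -> Phi 1 = 1 -> w != [::] ->
  convsum (fun r => (r`!%:R)^-1) (fun u => wproj 1 (Phi (word u))) w = Phi (word w).
Proof.
move=> cP P1 w0; have [lP _ _ _] := cP; have lp := @wproj_linear k W 1.
rewrite [RHS](sum_wproj (coalg_fil (w :=
  w) cP P1)) -(big_mkord xpredT (fun j => wproj j (Phi (word w)))).
rewrite big_nat_recl // coalg_wproj0 // add0r /convsum big_add1.
apply: eq_bigr => r _; rewrite (convpow_coalg _ _ cP P1 lp).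
by rewrite CP_wproj1 scalerA mulVf ?scale1r // fact_inv_neq0.
Qed.

Lemma coalg_log (Phi : sym V -> sym W) w :
  is_coalg_morphism Phi -> Phi 1 = 1 ->
  convsum (fun r => (-1) ^+ r.-1 / r%:R) (fun u => Phi (word u)) w = wproj 1 (Phi (word w)).
Proof.
move=> cP P1; have [lP _ _ _] := cP; have lp := @wproj_linear k W 1.
have lid := @linear_idfun k (sym W).
have E r : convpow (fun u => Phi (word u)) r w =
    \sum_(j < (size w).+1) surj j r *: wproj j (Phi (word w)).
  rewrite (convpow_coalg _ _ cP P1 lid).
  rewrite {1}(sum_wproj (coalg_fil (w := w) cP P1)) (lin_sum _ _ _ (CP_linear _ lid)).
  apply: eq_bigr => j _; move: (Phi (word w)); apply: sym_eqP.
  - exact: linear_comp (CP_linear _ lid) (wproj_linear j).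
  - by apply: linear_scale; apply: wproj_linear.
  move=> w'; rewrite wproj_word; case: eqP => [<-|_]; first exact: CP_id.
  by rewrite lin0 ?scaler0 //; apply: CP_linear.
rewrite /convsum; under eq_bigr do rewrite E scaler_sumr.
rewrite exchange_big /=.
transitivity (\sum_(j < (size w).+1) ((j : nat) == 1%N)%:R *: wproj j (Phi (word w))).
  apply: eq_bigr => j _; rewrite -(@sum_surj j (size w)); last by rewrite -ltnS.
  rewrite scaler_suml.
  by apply: eq_bigr => r _; rewrite scalerA.
have fw := coalg_fil (w := w) cP P1.
case: (size w) fw => [|n] fw.
  by rewrite big_ord1 scale0r fw.
rewrite (bigD1 (inord 1)) //= inordK // eqxx scale1r big1 ?addr0 // => i.
by rewrite -val_eqE /= inordK // => /negbTE ->; rewrite scale0r.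
Qed.

End CoalgebraMorphisms.

(** * The exponential of a cogenerator-valued map is a coalgebra morphism *)

Section Exponential.
Variables (k : fieldType) (V W : gvect k).
Hypothesis char0 : [pchar k] =i pred0.
Implicit Types (w u v : seq (helt V)) (q : sym V -> sym W).

Lemma in_powM m n (a b : sym W) : in_pow m a -> in_pow n b -> in_pow (m + n) (a * b).
Proof.
move=> ma nb; have mmn : (m < (m + n).+1)%N by lia.
rewrite /in_pow wprojM (bigD1 (Ordinal mmn)) //= addKn ma nb big1 ?addr0 // => i.
rewrite -val_eqE /= -ma wproj_comp => /negbTE ->; exact: mul0r.
Qed.

Lemma in_pow_convpow (F : seq (helt V) -> sym W) r w :
  (forall u, in_pow 1 (F u)) -> in_pow r (convpow F r w).
Proof.
move=> F1; elim: r w => [|r IH] w.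
  rewrite /in_pow /=; case: eqP => _; last by rewrite lin0 //; apply: wproj_linear.
  by rewrite -word_nil wproj_word.
rewrite /in_pow /= (ssum_lin _ _ (wproj_linear _)); apply: ssum_ext => u v.
case: eqP => _; first exact/lin0/wproj_linear.
by rewrite -add1n; apply: in_powM.
Qed.

Lemma convpow1 (F : seq (helt V) -> sym W) w :
  convpow F 1 w = if w == [::] then 0 else F w.
Proof.
rewrite /= ssum_nilr ?eqxx ?mulr1 // => u v /negbTE ->.
by rewrite mulr0 if_same.
Qed.

Definition expw q w : sym W :=
  if w == [::] then 1 else convsum (fun r => (r`!%:R)^-1) (fun u => q (word u)) w.

(** The r = 0 term is the counit, so adding it merges the empty and the nonempty word into one
    exponential series, truncated anywhere beyond the length of w. *)
Lemma expwE q w N : (size w < N)%N ->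
  expw q w = \sum_(0 <= r < N) (r`!%:R : k)^-1 *: convpow (fun u => q (word u)) r w.
Proof.
move=> wN; rewrite big_ltn; last by lia.
rewrite -(convsumE (fun r => (r`!%:R)^-1)) // fact0 invr1 scale1r /expw.
case: w wN => [|x w] wN; last by rewrite add0r.
by rewrite /convsum big_geq // addr0.
Qed.

Lemma wresp_expw q : linear q -> wresp (expw q).
Proof.
move=> lq; have [fl fs] := wresp_convsum (fun r => (r`!%:R)^-1) lq.
by split=> [[|? s] t a x y z xz yz zE|[|? s] t x y];
  [apply: (fl [::])|apply: (fl (_ :: _))|apply: (fs [::])|apply: (fs (_ :: _))].
Qed.

Definition expm q : sym V -> sym W := slift (expw q).
Lemma expm_word q w : linear q -> expm q (word w) = expw q w.
Proof. by move=> lq; apply/slift_wordE/wresp_expw. Qed.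
Lemma expm_linear q : linear q -> linear (expm q).
Proof. by move=> lq; apply/slift_lin/wresp_expw. Qed.

Lemma coalg_expm (Phi : sym V -> sym W) :
  is_coalg_morphism Phi -> Phi 1 = 1 -> expm (fun a => wproj 1 (Phi a)) = Phi.
Proof.
move=> cP P1; have [lP _ _ _] := cP.
have lq : linear (fun a => wproj 1 (Phi a)) := linear_comp (wproj_linear 1) lP.
apply/funext/sym_eqP => //; first exact: expm_linear.
move=> w; rewrite expm_word // /expw; case: eqP => [->|/eqP w0]; first by rewrite word_nil P1.
exact: coalg_exp.
Qed.

Section Exp.
Variable q : sym V -> sym W.
Hypotheses (lq : linear q) (q_deg : forall w, sproj (wdeg w) (q (word w)) = q (word w)).
Hypotheses (q_cogen : forall a, wproj 1 (q a) = q a) (q1 : q 1 = 0).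
Local Notation E := (expw q).

(** The differential equation of the exponential: by [convpow_cons] prepending a letter brings out a
    factor r + 1, which turns 1/(r+1)! into 1/r!. *)
Lemma expw_cons x w : E (x :: w) = ssum (fun u v => q (word (x :: u)) * E v) w.
Proof.
have c0 : convpow (fun u => q (word u)) 0 (x :: w) = 0 by [].
rewrite (expwE _ (ltnSn _)) big_nat_recl // c0 scaler0 add0r.
under eq_bigr do rewrite (convpow_cons _ _ _ q_deg).
rewrite (eq_ssum (G' := fun u v => \sum_(0 <= r < (size w).+1)
   (r`!%:R : k)^-1 *: (q (word (x :: u)) * convpow (fun u => q (word u)) r v))).
  rewrite ssum_sum; apply: eq_bigr => r _; rewrite ssumZ scalerA; congr (_ *: _).
  have f0 := fact_inv_neq0 char0 r; have r0 := natf_neq0_char0 char0 (ltn0Sn r).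
  by rewrite factS natrM invfM mulrAC mulVf ?mul1r.
move=> u v uv _; rewrite (@expwE q v (size w).+1); last by lia.
by rewrite mulr_sumr; apply: eq_bigr => r _; rewrite scalerAr.
Qed.

Lemma sproj_expw w : sproj (wdeg w) (E w) = E w.
Proof.
rewrite (expwE _ (ltnSn _)); apply: sproj_bigsum => r _.
by apply: sprojZ; apply: sproj_convpow.
Qed.

Lemma wproj1_expw w : wproj 1 (E w) = q (word w).
Proof.
have [->|w0] := eqVneq w [::]; first by rewrite word_nil q1 [E [::]]/= wproj1_1.
have p r : wproj 1 (convpow (fun u => q (word u)) r w) = if r == 1%N then q (word w) else 0.
  have /esym Er := @in_pow_convpow (fun u => q (word u)) r w (fun u => q_cogen _).
  rewrite Er wproj_comp eq_sym; case: eqP => // r1.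
  by rewrite -Er r1 convpow1 (negbTE w0).
(* The slack of 2 guarantees that the terms r = 0 and r = 1 can be split off, even for a short
   word. *)
have wN : (size w < 2 + size w)%N by lia.
rewrite (expwE q wN) (lin_sum _ _ _ (wproj_linear 1)).
under eq_bigr do rewrite (linZ _ (wproj_linear 1)) p.
rewrite big_ltn // scaler0 add0r big_ltn // eqxx (_ : 1`!%:R =
  1 :> k) // invr1 scale1r big1_seq ?addr0 // => r.
by rewrite mem_index_iota => /andP[_ /andP[r1 _]]; rewrite gtn_eqF ?scaler0.
Qed.

Lemma counit_letterM (z : helt W) (b : sym W) : counit (word [:: z] * b) = 0.
Proof.
move: b; apply: sym_eqP.
- by apply: (linear_comp (@counit_linear k W)); apply: linear_mull.
- exact: linear_zero.
by move=> w; rewrite wordM counit_word.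
Qed.

Lemma counit_expw w : counit (E w) = (w == [::])%:R.
Proof.
case: w => [|x w]; first by rewrite -[E _]/1 -word_nil counit_word.
rewrite expw_cons (ssum_lin _ _ (@counit_linear k W)) /=.
rewrite (ssum_ext w (G' := fun _ _ => 0)) ?ssum0 // => u v.
have [z _ ->] := letterP (q_cogen _) (q_deg (x :: u)).
exact: counit_letterM.
Qed.

(** In the recursion [expw_cons] the factor q(x u) is a letter, hence primitive, and the exponential
    of the shorter rest is known by induction. The letter joins the left leg by coassociativity and
    the right leg by cocommutativity. *)
Lemma comult_expw w : comult (E w) = ssum (fun u v => tmk (E u) (E v)) w.
Proof.
have [tl tr] := bilinear_tmk (sym W) (sym W).
have [n] := ubnP (size w); elim: n w => // n IH [|x w] wn.
  by rewrite -[E [::]]/1 comult1.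
rewrite expw_cons (ssum_lin _ _ (@comult_linear k W)) /=.
transitivity (ssum (fun u v => ssum (fun v1 v2 =>
    tmk (q (word (x :: u)) * E v1) (E v2) +
    koszul k (hdeg x + wdeg u) (wdeg v1) *: tmk (E v1) (q (word (x :: u)) * E v2)) v) w).
  apply: eq_ssum => u v uv _.
  have [z zx zE] := letterP (q_cogen _) (q_deg (x :: u)).
  rewrite zE comult_letter IH; last by move: wn => /=; lia.
  rewrite (ssum_lin _ _ (tlift_linear (bilinear_letter_act z))).
  apply: ssum_ext => v1 v2; rewrite tlift_tmk; last exact: bilinear_letter_act.
  rewrite /letter_act (koszul_act_homog _ (sproj_expw v1)) (linZ _ (tl _)).
  by rewrite zx wdeg_cons.
rewrite (ssum_ext w (G' := fun u v => ssum (fun v1 v2 => tmk (q (word (x :: u)) *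
  E v1) (E v2)) v +
   ssum (fun v1 v2 => koszul k (hdeg x +
     wdeg u) (wdeg v1) *: tmk (E v1) (q (word (x :: u)) * E v2)) v)); last first.
  by move=> u v; rewrite ssumD.
rewrite ssumD; congr (_ + _).
  rewrite -ssum_coassoc; apply: ssum_ext => u v; rewrite expw_cons.
  by rewrite (ssum_lin (F := fun a => tmk a (E v))).
transitivity (ssum (fun u v => ssum (fun v1 v2 => koszul k (hdeg x) (wdeg u) *:
     tmk (E u) (q (word (x :: v1)) * E v2)) v) w).
  rewrite [RHS]ssum_swap12; apply: ssum_ext => u v; apply: ssum_ext => v1 v2.
  by rewrite scalerA koszulD mulrC.
apply: ssum_ext => u v; rewrite expw_cons ssumZ.
by rewrite (ssum_lin (F := fun a => tmk (E u) a)).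
Qed.

Lemma expm_coalg : is_coalg_morphism (expm q).
Proof.
have lE := expm_linear lq.
have [tl tr] := bilinear_tmk (sym W) (sym W).
have bE : bilinear (fun a b => tmk (expm q a) (expm q b)).
  by split=> b; [apply: linear_comp (tl _) lE | apply: linear_comp (tr _) lE].
split=> //.
- apply: word_has_degree => // w; rewrite addr0 expm_word //; exact: sproj_expw.
- apply: sym_eqP.
  + exact: linear_comp (@comult_linear k W) lE.
  + exact: linear_comp (tlift_linear bE) (@comult_linear k V).
  move=> w; rewrite tlift_comult // expm_word // comult_expw.
  by apply: ssum_ext => u v; rewrite !expm_word.
- apply: sym_eqP; first exact: linear_comp (@counit_linear k W) lE.
    exact: counit_linear.
  by move=> w; rewrite expm_word // counit_expw counit_word.
Qed.

Lemma expm1 : expm q 1 = 1.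
Proof. by rewrite -word_nil expm_word. Qed.

Lemma wproj1_expm a : wproj 1 (expm q a) = q a.
Proof.
move: a; apply: sym_eqP => //.
  by apply: linear_comp (wproj_linear 1) _; apply: expm_linear.
by move=> w; rewrite expm_word // wproj1_expw.
Qed.

End Exp.

(** Uniqueness in the cofree property: each morphism is the exponential of its corestriction. *)
Lemma coalg_inj (Phi Psi : sym V -> sym W) :
  is_coalg_morphism Phi -> Phi 1 = 1 -> is_coalg_morphism Psi -> Psi 1 = 1 ->
  (forall a, wproj 1 (Phi a) = wproj 1 (Psi a)) -> Phi = Psi.
Proof.
by move=> cP P1 cQ Q1 /funext E; rewrite -(coalg_expm cP P1) E coalg_expm.
Qed.

End Exponential.

(** * Coderivations are determined by their corestrictions *)

Section Coderivations.
Variables (k : fieldType) (V : gvect k).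
Hypothesis char0 : [pchar k] =i pred0.
Implicit Types (w u v : seq (helt V)).

Local Notation par := (parity (V := symalg V)).
Definition coder_act (D : sym V -> sym V) (a b : sym V) : tens (sym V) (sym V) :=
  tmk (D a) b + tmk (par a) (D b).

Lemma bilinear_coder_act D : linear D -> bilinear (coder_act D).
Proof.
have [tl tr] := bilinear_tmk (sym V) (sym V).
have lp : linear (fun a : sym V => par a : sym V) := @parity_linear k (symalg V).
move=> lD; split=> b; apply: linear_add.
- exact: linear_comp (tl _) lD.
- exact: linear_comp (tl _) lp.
- exact: tr.
- exact: linear_comp (tr _) lD.
Qed.

Lemma coder_comult D w : is_coderivation D ->
  comult (D (word w)) =
  ssum (fun u v => tmk (D (word u)) (word v) +
                   koszul k (wdeg u) 1 *: tmk (word u) (D (word v))) w.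
Proof.
have [tl tr] := bilinear_tmk (sym V) (sym V).
move=> [lD _ ->]; rewrite -/(coder_act D) tlift_comult; last exact: bilinear_coder_act.
apply: ssum_ext => u v; congr (_ + _); rewrite parity_word.
by rewrite (linZ _ (tl _)).
Qed.

(** If the two agree on shorter words, their difference on w is primitive. By [primitive_wproj] it
    lies in S^1, where it vanishes by assumption. *)
Lemma coder_inj D D' : is_coderivation D -> is_coderivation D' ->
  (forall w, wproj 1 (D (word w)) = wproj 1 (D' (word w))) -> D = D'.
Proof.
have [tl tr] := bilinear_tmk (sym V) (sym V).
move=> cD cD' E; have [lD _ _] := cD; have [lD' _ _] := cD'.
apply/funext/sym_eqP => // w.
have [n] := ubnP (size w); elim: n w => // n IH w wn.
apply/eqP; rewrite -subr_eq0; set y := D _ - _.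
have p1 : wproj 1 y = 0 by rewrite /y (linB (wproj_linear 1)) E subrr.
rewrite -p1; apply/eqP/esym/primitive_wproj => //.
rewrite /y (linB (@comult_linear k V)) !coder_comult // -ssumB.
rewrite (ssum_ext w (G' := fun u v => tmk (D (word u) - D' (word u)) (word v) +
    koszul k (wdeg u) 1 *: tmk (word u) (D (word v) - D' (word v)))); last first.
  by move=> u v; rewrite (linB (tl _)) (linB (tr _)) scalerBr opprD addrACA.
have tl0 b : tmk 0 b = 0 := lin0 (tl b).
have tr0 a : tmk a 0 = 0 := lin0 (tr a).
have IH' u : (size u < size w)%N -> D (word u) - D' (word u) = 0.
  by move=> uw; rewrite IH ?subrr //; lia.
rewrite ssumD; congr (_ + _).
  (* By induction only the unshuffle with u the whole word survives; symmetrically for the other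
     summand. What is left is y tensor 1 + 1 tensor y. *)
  rewrite (eq_ssum (G' := fun u v => if v == [::] then tmk (D (word u) - D' (word u)) (word
    v) else 0)).
    by rewrite ssum_nilr // => u v /negbTE ->.
  move=> u v uv _; case: eqP => [->//|/eqP v0].
  by rewrite IH' ?tl0 //; case: v v0 uv => //= z v _; lia.
rewrite (eq_ssum (G' := fun u v => if u == [::] then tmk (word u) (D (word v) - D' (word v))
  else 0)).
  by rewrite ssum_nill // => u v /negbTE ->.
move=> u v uv _; case: eqP => [->|/eqP u0]; first by rewrite wdeg_nil koszul0 scale1r.
by rewrite IH' ?tr0 ?scaler0 //; case: u u0 uv => //= z u _; lia.
Qed.

Section Coext.
Variable l : sym V -> sym V.
Hypothesis ll : linear l.

(* The coderivation with corestriction l. *)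
Definition coext : sym V -> sym V :=
  slift (ssum (fun u v => l (word u) * word v)).

Fact coext_bilinear : bilinear (fun a b => l a * b).
Proof. by split=> c; [apply: linear_mulr | apply: linear_mull]. Qed.

Lemma coext_word w : coext (word w) = ssum (fun u v => l (word u) * word v) w.
Proof. exact: (slift_wordE w (ssum_bilinear_resp coext_bilinear)). Qed.
Lemma coext_linear : linear coext.
Proof. exact: (slift_lin (ssum_bilinear_resp coext_bilinear)). Qed.

Hypothesis l_cogen : forall a, wproj 1 (l a) = l a.

Lemma wproj1_coext w : wproj 1 (coext (word w)) = l (word w).
Proof.
rewrite coext_word (ssum_lin _ _ (wproj_linear 1)) ssum_nilr.
  by rewrite word_nil mulr1 l_cogen.
move=> u v v0; have sv : in_pow (size v) (word v) by rewrite /in_pow wproj_word eqxx.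
rewrite -(in_powM (l_cogen _) sv) wproj_comp; case: eqP => // /eqP.
by move: v0; rewrite -size_eq0; case: (size v).
Qed.

Hypothesis l_deg : forall w, sproj (wdeg w + 1) (l (word w)) = l (word w).

(** The value l(u) is a letter of degree |u| + 1. Its part in the left leg is settled by
    coassociativity. In the right leg cocommutativity absorbs the sign coming from |u|, and the
    extra degree 1 leaves exactly the parity sign of a degree-one coderivation. *)
Lemma coext_coder : is_coderivation coext.
Proof.
have [tl tr] := bilinear_tmk (sym V) (sym V).
have lc := coext_linear.
split=> //.
- apply: word_has_degree => // w; rewrite coext_word.
  apply: sproj_ssum => u v <-; rewrite addrAC; apply: sprojM => //; exact: sproj_wdeg.
apply: sym_eqP.
- exact: linear_comp (@comult_linear k V) lc.
- exact: linear_comp (tlift_linear (bilinear_coder_act lc)) (@comult_linear k V).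
move=> w; rewrite -/(coder_act coext) tlift_comult; last exact: bilinear_coder_act.
rewrite coext_word (ssum_lin _ _ (@comult_linear k V)).
transitivity (ssum (fun u v => ssum (fun v1 v2 =>
    tmk (l (word u) * word v1) (word v2) +
    koszul k (wdeg u + 1) (wdeg v1) *: tmk (word v1) (l (word u) * word v2)) v) w).
  apply: ssum_ext => u v.
  have [z zu zE] := letterP (l_cogen _) (l_deg u).
  rewrite zE comult_letter tlift_comult; last exact: bilinear_letter_act.
  apply: ssum_ext => v1 v2; rewrite /letter_act koszul_act_word zu.
  by rewrite (linZ _ (tl _)).
rewrite (ssum_ext w (G' := fun u v => ssum (fun v1 v2 => tmk (l (word u) *
  word v1) (word v2)) v +
   ssum (fun v1 v2 => koszul k (wdeg u +
     1) (wdeg v1) *: tmk (word v1) (l (word u) * word v2)) v)); last first.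
  by move=> u v; rewrite ssumD.
rewrite ssumD [RHS]ssumD; congr (_ + _).
  rewrite -ssum_coassoc; apply: ssum_ext => u v; rewrite coext_word.
  by rewrite (ssum_lin (F := fun a => tmk a (word v))).
transitivity (ssum (fun u v => ssum (fun v1 v2 => koszul k (wdeg u) 1 *:
     tmk (word u) (l (word v1) * word v2)) v) w).
  rewrite [RHS]ssum_swap12; apply: ssum_ext => u v; apply: ssum_ext => v1 v2.
  by rewrite scalerA koszulD [koszul k 1 _]koszulC.
apply: ssum_ext => u v; rewrite ssumZ coext_word parity_word (linZ _ (tl _)).
by rewrite (ssum_lin (F := fun a => tmk (word u) a)).
Qed.

Hypothesis l1 : l 1 = 0.

Lemma coext1 : coext 1 = 0.
Proof. by rewrite -word_nil coext_word /= word_nil l1 mul0r. Qed.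

Lemma coext_fil w : fil (size w) (coext (word w)).
Proof.
move=> j wj; rewrite coext_word (ssum_lin _ _ (wproj_linear j)).
rewrite (eq_ssum (G' := fun _ _ => 0)) ?ssum0 // => -[|x u] v /= uv _.
  by rewrite word_nil l1 mul0r lin0 //; apply: wproj_linear.
have sv : in_pow (size v) (word v) by rewrite /in_pow wproj_word eqxx.
by rewrite -(in_powM (l_cogen _) sv) wproj_comp; case: eqP => // E; lia.
Qed.

End Coext.

Lemma coder_coext D : is_coderivation D -> coext (fun a => wproj 1 (D a)) = D.
Proof.
move=> cD; have [lD dD _] := cD.
have ll : linear (fun a => wproj 1 (D a)) := linear_comp (wproj_linear 1) lD.
have l_cogen a : wproj 1 (wproj 1 (D a)) = wproj 1 (D a) by rewrite wproj_comp eqxx.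
apply: coder_inj => //.
  apply: coext_coder => // w.
  by rewrite sproj_wproj (has_degree_word dD).
by move=> w; rewrite wproj1_coext.
Qed.

End Coderivations.
(** * Double suspension and hbar *)

Section SymMapTheory.
Variables (k : fieldType) (V W : gvect k) (d : int) (f : V -> W).
Hypotheses (fd : has_degree d f) (lf : linear f).
Hypothesis d_even : forall p q, koszul k (p + d) q = koszul k p q.
Implicit Types (w u v : seq (helt V)) (a b : sym V).

Lemma wresp_sym_map : wresp (fun w => word (map (helt_map fd) w) : sym W).
Proof.
split=> [s t a x y z xz yz zE|s t x y]; rewrite !map_cat /=.
- apply: wordL; rewrite /hdeg /=; first by congr (_ + _).
    by congr (_ + _).
  by change (f (hval z) = a *: f (hval x) + f (hval y)); rewrite zE lf.
- by rewrite wordS /hdeg /= d_even koszulC d_even koszulC.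
Qed.

Lemma sym_map_word w : sym_map fd (word w) = word (map (helt_map fd) w).
Proof. exact/slift_wordE/wresp_sym_map. Qed.
Lemma sym_map_linear : linear (sym_map fd).
Proof. exact/slift_lin/wresp_sym_map. Qed.
Lemma sym_map1 : sym_map fd 1 = 1.
Proof. by rewrite -word_nil sym_map_word. Qed.

Lemma sym_mapM a b : sym_map fd (a * b) = sym_map fd a * sym_map fd b.
Proof.
move: a b; apply: sym_eqP2.
- split=> c.
  + exact: linear_comp sym_map_linear ((bilinear_mul V).1 c).
  + exact: linear_comp sym_map_linear ((bilinear_mul V).2 c).
- by split=> c; [apply: linear_mulr|apply: linear_mull]; apply: sym_map_linear.
by move=> u v; rewrite wordM !sym_map_word wordM map_cat.
Qed.

Lemma wdeg_map w : wdeg (map (helt_map fd) w) = wdeg w + d *+ size w.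
Proof.
elim: w => [|x w IH]; first by rewrite !wdeg_nil.
by rewrite /= !wdeg_cons IH mulrS addrACA.
Qed.

Lemma koszul_map p w : koszul k p (wdeg (map (helt_map fd) w)) = koszul k p (wdeg w).
Proof.
rewrite wdeg_map; elim: (size w) => [|n IH]; first by rewrite addr0.
by rewrite mulrSr addrA koszulC d_even koszulC.
Qed.

Lemma ssum_map (M : lmodType k) (G : seq (helt W) -> seq (helt W) -> M) w :
  ssum G (map (helt_map fd) w) =
  ssum (fun u v => G (map (helt_map fd) u) (map (helt_map fd) v)) w.
Proof.
elim: w G => //= x w IH G; rewrite !IH; congr (_ + _).
by apply: ssum_ext => u v; rewrite koszul_map /hdeg /= d_even.
Qed.

Lemma wproj_sym_map n a : wproj n (sym_map fd a) = sym_map fd (wproj n a).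
Proof.
move: a; apply: sym_eqP.
- exact: linear_comp (wproj_linear n) sym_map_linear.
- exact: linear_comp sym_map_linear (wproj_linear n).
move=> w; rewrite sym_map_word !wproj_word (lin_if _ _ sym_map_linear) sym_map_word.
by rewrite size_map.
Qed.

Lemma sproj_sym_map p n a : sproj p a = a -> wproj n a = a ->
  sproj (p + d *+ n) (sym_map fd a) = sym_map fd a.
Proof.
move=> pa na; rewrite -[a]pa -[a]na; move: a {pa na}; apply: sym_eqP.
- apply: (linear_comp (sproj_linear _)); apply: (linear_comp sym_map_linear).
  exact: linear_comp (sproj_linear p) (wproj_linear n).
- apply: (linear_comp sym_map_linear).
  exact: linear_comp (sproj_linear p) (wproj_linear n).
move=> w; rewrite wproj_word (lin_if _ _ (sproj_linear p)) sproj_word.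
case: eqP => [<-|_]; last by rewrite (lin0 sym_map_linear) sproj0.
case: eqP => [<-|_]; last by rewrite (lin0 sym_map_linear) sproj0.
by rewrite sym_map_word -wdeg_map sproj_wdeg.
Qed.

End SymMapTheory.

Lemma helt_mapK (k : fieldType) (V W : gvect k) (d d' : int) (f : V -> W) (g : W -> V)
  (fd : has_degree d f) (gd : has_degree d' g) : d + d' = 0 -> cancel f g ->
  cancel (helt_map fd) (helt_map gd).
Proof.
move=> dd fK x; apply: helt_eq; rewrite /hdeg /hval /=; last exact: fK.
by rewrite -addrA dd addr0.
Qed.

(* A double suspension U = V[-2]; both halves are the identity in the applications. *)
Record eshift (k : fieldType) (V U : gvect k) := EShift {
  es_to : V -> U;
  es_from : U -> V;
  es_to_degree : has_degree 2 es_to;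
  es_from_degree : has_degree (-2) es_from;
  es_to_linear : linear es_to;
  es_from_linear : linear es_from;
  es_toK : cancel es_to es_from;
  es_fromK : cancel es_from es_to
}.

Section EShift.
Variables (k : fieldType) (V U : gvect k) (e : eshift V U).

Definition esS : sym V -> sym U := sym_map (es_to_degree e).
Definition esT : sym U -> sym V := sym_map (es_from_degree e).
Definition esM : seq (helt U) -> seq (helt V) := map (helt_map (es_from_degree e)).

Fact even2 p q : koszul k (p + 2) q = koszul k p q.
Proof. by rewrite koszulD -[2]/((1.*2)%:Z) koszul_even mulr1. Qed.
Fact evenN2 p q : koszul k (p + (-2)) q = koszul k p q.
Proof. by rewrite koszulD -[-2]/(- (1.*2)%:Z) koszul_evenN mulr1. Qed.

Lemma esS_linear : linear esS. Proof. exact: (sym_map_linear _ (es_to_linear e) even2). Qed.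
Lemma esT_linear : linear esT. Proof. exact: (sym_map_linear _ (es_from_linear e) evenN2). Qed.
Lemma esS_word w : esS (word w) = word (map (helt_map (es_to_degree e)) w).
Proof. exact: (sym_map_word _ (es_to_linear e) even2). Qed.
Lemma esT_word w : esT (word w) = word (esM w).
Proof. exact: (sym_map_word _ (es_from_linear e) evenN2). Qed.
Lemma esSM a b : esS (a * b) = esS a * esS b.
Proof. exact: (sym_mapM _ (es_to_linear e) even2). Qed.
Lemma wproj_esS n a : wproj n (esS a) = esS (wproj n a).
Proof. exact: (wproj_sym_map _ (es_to_linear e) even2). Qed.
Lemma wproj_esT n a : wproj n (esT a) = esT (wproj n a).
Proof. exact: (wproj_sym_map _ (es_from_linear e) evenN2). Qed.
Lemma esS1 : esS 1 = 1. Proof. exact: (sym_map1 _ (es_to_linear e) even2). Qed.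
Lemma esT1 : esT 1 = 1. Proof. exact: (sym_map1 _ (es_from_linear e) evenN2). Qed.

Lemma esSK : cancel esS esT.
Proof.
apply: sym_eqP; first exact: linear_comp esT_linear esS_linear.
  exact: linear_idfun.
move=> w; rewrite esS_word esT_word /esM mapK //.
by apply: helt_mapK; [|apply: es_toK].
Qed.

Lemma esTK : cancel esT esS.
Proof.
apply: sym_eqP; first exact: linear_comp esS_linear esT_linear.
  exact: linear_idfun.
move=> w; rewrite esT_word esS_word mapK //.
by apply: helt_mapK; [|apply: es_fromK].
Qed.

Lemma size_esM w : size (esM w) = size w. Proof. exact: size_map. Qed.
Lemma ssum_esM (M : lmodType k) (G : seq (helt V) -> seq (helt V) -> M) w :
  ssum G (esM w) = ssum (fun u v => G (esM u) (esM v)) w.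
Proof. exact: (ssum_map _ evenN2). Qed.
Lemma wdeg_esM w : wdeg (esM w) = wdeg w - (size w).*2%:Z.
Proof. by rewrite /esM wdeg_map mulNrn; congr (_ - _); rewrite -mulr_natr; lia. Qed.
Lemma sproj_esS p n a : sproj p a = a -> wproj n a = a ->
  sproj (p + n.*2%:Z) (esS a) = esS a.
Proof.
move=> pa na; have := sproj_sym_map (es_to_degree e) (es_to_linear e) even2 pa na.
by have -> : 2 *+ n = n.*2%:Z :> int by rewrite -mulr_natr; lia.
Qed.
Lemma sproj_esT p n a : sproj p a = a -> wproj n a = a ->
  sproj (p - n.*2%:Z) (esT a) = esT a.
Proof.
move=> pa na; have := sproj_sym_map (es_from_degree e) (es_from_linear e) evenN2 pa na.
by have -> : - 2 *+ n = - n.*2%:Z :> int by rewrite mulNrn -mulr_natr; lia.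
Qed.

End EShift.
Definition noninc (k : fieldType) (V W : gvect k) (Psi : sym V -> sym W) :=
  forall w, fil (size w) (Psi (word w)).

Lemma noninc_wproj (k : fieldType) (V W : gvect k) (Psi : sym V -> sym W) i j a :
  linear Psi -> noninc Psi -> (j < i)%N -> wproj i (Psi (wproj j a)) = 0.
Proof.
move=> lP nP ji; move: a; apply: sym_eqP.
- exact: linear_comp (linear_comp (wproj_linear i) lP) (wproj_linear j).
- exact: linear_zero.
move=> w; change (wproj i (Psi (wproj j (word w))) = 0); rewrite wproj_word.
case: eqP => [E|_]; last by rewrite (lin0 lP) lin0 //; apply: wproj_linear.
by apply: nP; rewrite E.
Qed.

Lemma noninc_fil (k : fieldType) (V W : gvect k) (Psi : sym V -> sym W) j a :
  linear Psi -> noninc Psi -> fil j a -> fil j (Psi a).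
Proof.
move=> lP nP fa i ji; rewrite (sum_wproj fa) (lin_sum _ _ _ lP) (lin_sum _ _ _ (wproj_linear
  i)).
by rewrite big1 // => l _; apply: noninc_wproj => //; have := ltn_ord l; lia.
Qed.

Lemma noninc_comp (k : fieldType) (V1 V2 V3 : gvect k) (Psi : sym V2 ->
  sym V3) (Phi : sym V1 -> sym V2) :
  linear Psi -> noninc Psi -> noninc Phi -> noninc (fun x => Psi (Phi x)).
Proof. by move=> lP nP nF w; apply: noninc_fil (nF w). Qed.

Section Hbar.
Variables (k : fieldType) (V1 U1 V2 U2 : gvect k).
Variables (e1 : eshift V1 U1) (e2 : eshift V2 U2).
Implicit Types (Psi Phi : sym V1 -> sym V2) (w u v : seq (helt U1)) (x : sym U1).

Local Notation conj Psi := (fun x => esS e2 (Psi (esT e1 x))).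

(* The coefficient of hbar^n lowers the word length by n. *)
Definition hbar Psi : hmap (sym U1) (sym U2) := fun x n =>
  slift (fun w => if (n <= size w)%N then wproj (size w - n) (conj Psi (word w)) else 0) x.

Lemma conj_linear Psi : linear Psi -> linear (conj Psi).
Proof. by move=> lP; apply: (linear_comp (esS_linear e2)); apply: (linear_comp lP);
  apply: esT_linear. Qed.

Lemma wresp_size (M : lmodType k) (F : nat -> seq (helt U1) -> M) :
  (forall n, wresp (F n)) -> wresp (fun w => F (size w) w).
Proof.
move=> FF; split=> [s t a x y z xz yz zE|s t x y].
- by have [fl _] := FF (size (s ++ z :: t)); rewrite (fl s t a x y z xz yz zE) !size_cat.
- by have [_ fs] := FF (size (s ++ x :: y :: t)); rewrite fs !size_cat.
Qed.

Lemma wresp_hbar Psi n : linear Psi ->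
  wresp (fun w => if (n <= size w)%N then wproj (size w - n) (conj Psi (word w)) else 0).
Proof.
move=> lP; apply: (wresp_size (F :=
  fun m w => if (n <= m)%N then wproj (m - n) (conj Psi (word w)) else 0)) => m.
apply: (wresp_word (F := fun x => if (n <= m)%N then wproj (m - n) (conj Psi x) else 0)).
by apply: linear_cond; apply: linear_comp (wproj_linear _) _; apply: conj_linear.
Qed.

Lemma hbar_word Psi w n : linear Psi ->
  hbar Psi (word w) n = if (n <= size w)%N then wproj (size w - n) (conj Psi (word w)) else 0.
Proof. by move=> lP; apply/slift_wordE/wresp_hbar. Qed.
Lemma hbar_linear Psi n : linear Psi -> linear (fun x => hbar Psi x n).
Proof. by move=> lP; apply/slift_lin/wresp_hbar. Qed.

Lemma hbar_pow Psi j x n : linear Psi -> in_pow j x ->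
  hbar Psi x n = if (n <= j)%N then wproj (j - n) (conj Psi x) else 0.
Proof.
move=> lP <-; move: x; apply: sym_eqP.
- exact: linear_comp (hbar_linear n lP) (wproj_linear j).
- apply: linear_cond; apply: linear_comp (wproj_linear _) _.
  exact: linear_comp (conj_linear lP) (wproj_linear j).
move=> w; rewrite wproj_word; case: eqP => [<-|_]; first exact: hbar_word.
rewrite (lin0 (hbar_linear n lP)) (lin0 (conj_linear lP)) (lin0 (wproj_linear _)).
by rewrite if_same.
Qed.

Lemma hbar_ext Psi Phi : Psi =1 Phi -> hbar Psi = hbar Phi.
Proof. by move=> /funext ->. Qed.

Lemma conj_fil Psi w : noninc Psi -> fil (size w) (conj Psi (word w)).
Proof.
move=> nP j wj; rewrite wproj_esS esT_word nP ?size_esM //.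
exact/lin0/esS_linear.
Qed.

Lemma hbar_inj Psi Phi : linear Psi -> linear Phi -> noninc Psi -> noninc Phi ->
  hbar Psi = hbar Phi -> Psi = Phi.
Proof.
move=> lP lF nP nF E; apply/funext => y.
rewrite -(esSK e1 y); move: (esS e1 y) => x {y}.
rewrite -[LHS](esSK e2) -[RHS](esSK e2); congr (esT e2 _).
move: x; apply: (sym_eqP (conj_linear lP) (conj_linear lF)) => w.
apply: wproj_inj => j; have [jw|wj] := leqP j (size w); last by rewrite !conj_fil.
have /(congr1 (fun f => f (size w - j)%N)) : hbar Psi (word w) = hbar Phi (word w) by rewrite E.
by rewrite !hbar_word // leq_subr subKn.
Qed.

End Hbar.

(** The component of the composite that shortens by n is a sum over intermediate lengths: Phi
    shortens by n - i and Psi by i, which is the Cauchy product in hbar. *)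
Lemma hcomp_hbar (k : fieldType) (V1 U1 V2 U2 V3 U3 : gvect k)
  (e1 : eshift V1 U1) (e2 : eshift V2 U2) (e3 : eshift V3 U3)
  (Psi : sym V2 -> sym V3) (Phi : sym V1 -> sym V2) :
  linear Psi -> linear Phi -> noninc Psi -> noninc Phi ->
  hcomp (U := symalg U1) (V := symalg U2) (W := symalg U3) (hbar e2 e3 Psi) (hbar e1 e2 Phi)
  = hbar e1 e3 (fun x => Psi (Phi x)).
Proof.
move=> lP lF nP nF; apply/funext => x; apply/funext => n; move: x.
have lPF : linear (fun x => Psi (Phi x)) by apply: linear_comp.
apply: (sym_eqP (W := sym U3)).
- apply: linear_suml => i.
  exact: linear_comp (hbar_linear _ _ _ lP) (hbar_linear _ _ _ lF).
- exact: hbar_linear.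
move=> w; rewrite /hcomp /hext hbar_word //.
set y := esS e2 (Phi (esT e1 (word w))).
have fy : fil (size w) y := conj_fil _ _ nF.
have t i : hbar e2 e3 Psi (hbar e1 e2 Phi (word w) (n - i)%N) i =
    if ((n - i <= size w) && (i <= size w - (n - i)))%N then
      wproj (size w - (n - i) - i) (esS e3 (Psi (esT e2 (wproj (size w - (n - i)) y)))) else 0.
  rewrite hbar_word //; case: ifP => /= h; last by rewrite (lin0 (hbar_linear _ _ _ lP)).
  have p : in_pow (size w - (n - i)) (wproj (size w - (n - i)) y) by rewrite /in_pow
    wproj_comp eqxx.
  by rewrite (hbar_pow _ _ _ lP p).
rewrite (eq_bigr _ (fun (i : 'I_n.+1) _ => t i)).
case: ifP => nw; last first.
  rewrite big1 // => i _; case: ifP => // /andP[h1 h2].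
  by have := ltn_ord i; lia.
have -> : esS e3 (Psi (Phi (esT e1 (word w)))) =
   \sum_(j < (size w).+1) esS e3 (Psi (esT e2 (wproj j y))).
  rewrite -(lin_sum _ _ _ (conj_linear e2 e3 lP)) -(sum_wproj fy) /y.
  by rewrite esSK.
rewrite (lin_sum _ _ _ (wproj_linear _)).
rewrite -(big_mkord xpredT (fun j => wproj (size w - n) (esS e3 (Psi (esT e2 (wproj j y)))))).
rewrite (@big_cat_nat _ _ _ (size w - n)) //=; last by lia.
(* Intermediate lengths below the target length contribute nothing, since Psi does not lengthen
   words. *)
rewrite [X in _ = X + _]big1_seq ?add0r; last first.
  move=> j; rewrite mem_index_iota => /andP[_ /andP[_ jw]];
    rewrite wproj_esS -wproj_esT noninc_wproj //.
  exact/lin0/esS_linear.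
(* The other intermediate lengths are i + (size w - n), where i is the power of hbar contributed by
   Psi. *)
have E : ((size w).+1 = n.+1 + (size w - n))%N by lia.
rewrite E -[X in index_iota X](add0n (size w - n)%N) big_addn addnK big_mkord.
apply: eq_bigr => i _; have := ltn_ord i => il.
rewrite ifT; last by apply/andP; split; lia.
have -> : (size w - (n - i) = i + (size w - n))%N by lia.
by rewrite addKn.
Qed.
Lemma sum_ord_support (M : nmodType) (F : nat -> M) a b :
  (forall i, (b <= i)%N -> F i = 0) ->
  \sum_(i < a) F i = \sum_(i < b) (if (i < a)%N then F i else 0).
Proof.
move=> F0.
rewrite (big_ord_widen _ _ (leq_addr b a)).
rewrite (big_ord_widen _ (fun i => if (i < a)%N then F i else 0) (leq_addl a b)).
rewrite big_mkcond [RHS]big_mkcond; apply: eq_bigr => i _.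
by case: ltnP => ia; case: ltnP => // ib; apply: F0.
Qed.

(** * Exponential and logarithm commute with passage to power series in hbar *)

Section BlockSumHbar.
Variables (k : fieldType) (V1 U1 V2 U2 : gvect k).
Hypothesis char0 : [pchar k] =i pred0.
Variables (e1 : eshift V1 U1) (e2 : eshift V2 U2).
Variable Psi : sym V1 -> sym V2.
Hypotheses (lP : linear Psi) (nP : noninc Psi).
Implicit Types (w b : seq (helt U1)).
Local Notation F w := (esS e2 (Psi (esT e1 (word w)))).
Local Notation A := (symalg U2).

(** Homogenization as in the Rees construction: an element of S^(<= m) becomes the series whose
    hbar^n coefficient is its part of length m - n. It is multiplicative ([hmul_filtered]), which
    reduces products in A[[hbar]] to products in S(U). *)
Definition filtered (m : nat) (a : sym U2) : nat -> sym U2 :=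
  fun n => if (n <= m)%N then wproj (m - n) a else 0.

Lemma hmul_filtered m m' (a a' : sym U2) : fil m a -> fil m' a' ->
  hmul (A := A) (filtered m a) (filtered m' a') = filtered (m + m') (a * a').
Proof.
move=> fa fa'; apply/funext => n; rewrite /hmul /filtered.
case: leqP => [nm|mn]; last first.
  rewrite big1 // => i _; case: leqP => im; last exact: mul0r.
  by case: leqP => im'; [lia | exact: mulr0].
rewrite wprojM.
rewrite (@sum_ord_support _ (fun i => (if (i <= m)%N then wproj (m - i) a else 0) *
   (if (n - i <= m')%N then wproj (m' - (n - i)) a' else 0)) n.+1 m.+1); last first.
  by move=> i im; rewrite leqNgt im mul0r.
rewrite (@sum_ord_support _ (fun j => wproj j a * wproj (m + m' - n - j) a') _ m.+1);
  last first.
  by move=> i im; rewrite fa ?mul0r.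
(* On the left i is a drop in length, on the right a length; the reversal i to m - i matches
   them. *)
rewrite [RHS](reindex_inj rev_ord_inj) /=; apply: eq_bigr => i _.
have := ltn_ord i; rewrite ltnS => im; rewrite im subSS.
case: (leqP (n - i) m') => h1; case: ltnP => h2; case: ltnP => h3 //; rewrite ?mulr0 //;
  try lia.
- by congr (wproj _ a * wproj _ a'); lia.
- by rewrite (fa' (m + m' - n - (m - i))%N) ?mulr0 //; lia.
Qed.

Lemma prod_filtered (bs : seq (seq (helt U1))) :
  fil (sumn (map size bs)) (\prod_(b <- bs) F b) /\
  \big[@hmul k A/@hone k A]_(b <- bs) hbar e1 e2 Psi (word b) =
  filtered (sumn (map size bs)) (\prod_(b <- bs) F b).
Proof.
elim: bs => [|b bs [fI I]] /=.
  rewrite !big_nil; split; first by rewrite -word_nil; apply: fil_word.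
  apply/funext => n; rewrite /hone /filtered; case: n => [|n] //=.
  by rewrite -word_nil wproj_word.
rewrite !big_cons I; have fb := conj_fil e1 e2 (w := b) nP.
split; first exact: filM.
have -> : hbar e1 e2 Psi (word b) = filtered (size b) (F b).
  by apply/funext => n; rewrite hbar_word.
exact: hmul_filtered.
Qed.

Lemma filtered_linear m n : linear (fun a => filtered m a n).
Proof. by apply: linear_cond; apply: wproj_linear. Qed.

Lemma convpow_conj r w :
  convpow (fun u => F u) r w = esS e2 (convpow (fun u => Psi (word u)) r (esM e1 w)).
Proof.
elim: r w => [|r IH] w /=.
  by case: w => [|x w] /=; rewrite ?esS1 // (lin0 (esS_linear e2)).
rewrite ssum_esM (ssum_lin _ _ (esS_linear e2)); apply: ssum_ext => u v.
rewrite -!size_eq0 size_esM; case: eqP => _; first by rewrite (lin0 (esS_linear e2)).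
by rewrite IH esSM esT_word.
Qed.

(** The blocks of a word have total length [size w], so by [prod_filtered] each product of series is
    the homogenization of one product in S(U). Homogenization is linear and leaves the sum, and
    [block_convpow] evaluates what remains. *)
Lemma block_sum_hbar c w n :
  block_sum (A := A) c (hbar e1 e2 Psi) w n =
  if (n <= size w)%N then
    wproj (size w - n) (esS e2 (convsum c (fun u => Psi (word u)) (esM e1 w)))
  else 0.
Proof.
rewrite -/(filtered _ _ _); set X := tnth (in_tuple w).
have fS : wsymmetric (fun u => F u).
  exact: (wresp_word (conj_linear e1 e2 lP)).2.
have -> : esS e2 (convsum c (fun u => Psi (word u)) (esM e1 w)) =
   \sum_(1 <= r < (size w).+1) c r *: convpow (fun u => F u) r w.
  rewrite /convsum size_esM (lin_sum _ _ _ (esS_linear e2)).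
  by apply: eq_bigr => r _; rewrite (linZ _ (esS_linear e2)) convpow_conj.
rewrite (lin_sum _ _ _ (filtered_linear _ n)) /block_sum.
apply: eq_bigr => r _; rewrite (linZ _ (filtered_linear _ n)); congr (_ *: _).
rewrite -[in RHS](letters_enum w).
have ie := increasing_enum (size w).
have se : size (enum 'I_(size w)) = size w by rewrite size_enum_ord.
rewrite -(block_convpow fS X r char0 ie (ltnSn _)).
rewrite (lin_sum _ _ _ (filtered_linear _ n)) se.
apply: eq_bigr => t /andP[_ /eqP tw].
rewrite (linZ _ (filtered_linear _ n)); congr (_ *: _).
rewrite -(sum_perm_list (fun l => lsign X l *:
   \prod_(b <- reshape [seq val i | i <- t] l) F (map X b))).
rewrite (lin_sum _ _ _ (filtered_linear _ n)); apply: eq_bigr => s _.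
rewrite (linZ _ (filtered_linear _ n)) ksgnE; congr (_ *: _).
have [_ ->] := prod_filtered (reshape [seq val i | i <- t] (rearr s)).
have srs : size (rearr s) = size w by rewrite rearrE size_map size_permlist.
rewrite -/(shape _) reshapeKl ?srs ?tw // rearrE -map_reshape big_map.
by rewrite letters_enum.
Qed.

End BlockSumHbar.

Section ExpLogHbar.
Variables (k : fieldType) (V1 U1 V2 U2 : gvect k).
Hypothesis char0 : [pchar k] =i pred0.
Variables (e1 : eshift V1 U1) (e2 : eshift V2 U2).
Implicit Type Psi : sym V1 -> sym V2.

Lemma hexp_hbar Psi : linear Psi -> noninc Psi ->
  hexp (A := symalg U2) (hbar e1 e2 Psi) = hbar e1 e2 (expm Psi).
Proof.
move=> lP nP; apply/funext => x; apply/funext => n; rewrite /hexp /hbar.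
congr (slift _ x); apply/funext => w; rewrite esT_word expm_word // /expw.
case: w => [|y w].
  rewrite /= esS1 /hone; case: n => //=.
  by rewrite -word_nil wproj_word.
by rewrite block_sum_hbar.
Qed.

Lemma hlog_hbar Psi : is_coalg_morphism Psi -> Psi 1 = 1 ->
  hlog (A := symalg U2) (hbar e1 e2 Psi) = hbar e1 e2 (fun a => wproj 1 (Psi a)).
Proof.
move=> cP P1; have [lP _ _ _] := cP.
have nP : noninc Psi by move=> w; apply: coalg_fil.
apply/funext => x; apply/funext => n; rewrite /hlog /hbar.
congr (slift _ x); apply/funext => w; rewrite esT_word -coalg_log //.
case: w => [|y w]; last by rewrite block_sum_hbar.
rewrite /convsum /= big_geq // (lin0 (esS_linear e2)) (lin0 (wproj_linear _)).
by rewrite if_same.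
Qed.

End ExpLogHbar.

(** * Pure maps and corestrictions of coalgebra morphisms *)

Section PureMorphisms.
Variables (k : fieldType) (V1 U1 V2 U2 : gvect k).
Hypothesis char0 : [pchar k] =i pred0.
Variables (e1 : eshift V1 U1) (e2 : eshift V2 U2).
Implicit Types (phi : hmap (sym U1) (sym U2)) (q E : sym V1 -> sym V2).

Lemma hsum_wresp phi : hlinear (V := symalg U1) (W := symalg U2) phi ->
  wresp (fun w => \sum_(n < size w) phi (word w) n).
Proof.
move=> lphi; apply: (wresp_size (F := fun m w => \sum_(n < m) phi (word w) n)) => m.
apply: (wresp_word (F := fun x => \sum_(n < m) phi x n)).
by apply: linear_suml => n; apply: lphi.
Qed.

(** Sets hbar = 1 and removes the suspension. For pure phi nothing is lost, since the power of hbar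
    is recovered from the word length ([hat_hbar]). *)
Definition hat phi : sym V1 -> sym V2 := fun y => esT e2 (hsum phi (esS e1 y)).

Lemma hat_linear phi : hlinear (V := symalg U1) (W := symalg U2) phi -> linear (hat phi).
Proof.
move=> lphi; apply: (linear_comp (esT_linear e2)); apply: linear_comp (esS_linear e1).
exact/slift_lin/hsum_wresp.
Qed.

Lemma hsum_word phi w : hlinear (V := symalg U1) (W := symalg U2) phi ->
  is_pure_map phi ->
  hsum phi (word w) = if size w is m.+1 then phi (word w) m else 0.
Proof.
move=> lphi pphi; rewrite /hsum slift_wordE; last exact: hsum_wresp.
have pw : in_pow (size w) (word w) by rewrite /in_pow wproj_word eqxx.
case: (size w) pw => [|m] pw; first by rewrite big_ord0.
rewrite big_ord_recr /= big1 ?add0r // => i _.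
by have [_ ->] := pphi i _ _ pw => //; have := ltn_ord i; lia.
Qed.

Lemma hat_hbar phi : hlinear (V := symalg U1) (W := symalg U2) phi ->
  is_pure_map phi -> hbar e1 e2 (hat phi) = phi.
Proof.
move=> lphi pphi; have lh := hat_linear lphi.
apply/funext => x; apply/funext => n; move: x.
apply: (sym_eqP (W := sym U2)) => [||w]; first exact: hbar_linear.
  exact: lphi.
have pw : in_pow (size w) (word w) by rewrite /in_pow wproj_word eqxx.
rewrite hbar_word // /hat !esTK hsum_word //.
case sw: (size w) => [|m].
  have [_ ->] := pphi n _ _ pw; last by rewrite sw.
  by rewrite (lin0 (wproj_linear _)) if_same.
have [/(_ sw) p1 _] := pphi m _ _ pw.
have [->|nm] := eqVneq n m; first by rewrite leqnSn subSnn p1.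
have [_ ->] := pphi n _ _ pw; last by move=> E; case/eqP: nm; lia.
rewrite -p1 wproj_comp; case: leqP => // nm1.
by case: eqP => // ?; case/eqP: nm; lia.
Qed.

Lemma cogen_noninc (q : sym V1 -> sym V2) :
  (forall a, wproj 1 (q a) = q a) -> q 1 = 0 -> noninc q.
Proof.
move=> q_cogen q1 [|x w]; first by rewrite word_nil q1; apply: fil0.
by apply: fil_le (in_pow_fil (q_cogen _)).
Qed.

Section OfPhi.
Variable phi : hmap (sym U1) (sym U2).
Hypotheses (lphi : hlinear (V := symalg U1) (W := symalg U2) phi)
  (dphi : hdegree (V := symalg U1) (W := symalg U2) 0 phi) (pphi : is_pure_map phi).

Lemma hat_word w : hat phi (word w) =
  if size w is m.+1 then esT e2 (phi (esS e1 (word w)) m) else 0.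
Proof.
rewrite /hat esS_word hsum_word // size_map.
by case: (size w) => // ; apply/lin0/esT_linear.
Qed.

Lemma hat_cogen a : wproj 1 (hat phi a) = hat phi a.
Proof.
have lh := hat_linear lphi.
move: a; apply: sym_eqP => // [|w]; first exact: linear_comp (wproj_linear 1) lh.
rewrite hat_word; case sw: (size w) => [|m]; first exact/lin0/wproj_linear.
rewrite wproj_esT; congr (esT _ _).
have pw : in_pow (size w) (esS e1 (word w)).
  by rewrite /in_pow wproj_esS wproj_word eqxx.
by have [/(_ sw)] := pphi m pw.
Qed.

Lemma hat1 : hat phi 1 = 0.
Proof. by rewrite -word_nil hat_word. Qed.

Lemma hat_degree w : sproj (wdeg w) (hat phi (word w)) = hat phi (word w).
Proof.
rewrite hat_word; case sw: (size w) => [|m]; first exact: sproj0.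
have pw : in_pow (size w) (word w) by rewrite /in_pow wproj_word eqxx.
have pw' : in_pow (size w) (esS e1 (word w)) by rewrite /in_pow wproj_esS pw.
have [/(_ sw) p1 _] := pphi m pw'.
have d1 := sproj_esS e1 (sproj_wdeg w) pw.
have /eqP d2 := dphi m (introT eqP d1).
have := sproj_esT e2 d2 p1.
(* Suspending m + 1 letters adds 2(m + 1), the coefficient of hbar^m has degree -2m, and
   desuspending the single output letter subtracts 2. *)
by rewrite sw; have -> : wdeg w + (m.+1).*2%:Z + (0 - m.*2%:Z) - 1.*2%:Z = wdeg w by lia.
Qed.

Lemma hat_expm_coalg : is_coalg_morphism (expm (hat phi)).
Proof. exact: (expm_coalg char0 (hat_linear lphi) hat_degree hat_cogen). Qed.

Lemma hat_expm1 : expm (hat phi) 1 = 1.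
Proof. exact/expm1/hat_linear. Qed.

Lemma hexp_hat : hexp (A := symalg U2) phi = hbar e1 e2 (expm (hat phi)).
Proof.
rewrite -hexp_hbar ?hat_hbar //; first exact: hat_linear.
by apply: cogen_noninc; [apply: hat_cogen | apply: hat1].
Qed.

Lemma hbar_hat_expm : hbar e1 e2 (fun a => wproj 1 (expm (hat phi) a)) = phi.
Proof.
rewrite -[RHS]hat_hbar //; apply: hbar_ext => a.
exact: (wproj1_expm (hat_linear lphi) hat_cogen hat1).
Qed.

End OfPhi.

Section OfCoalg.
Variable E : sym V1 -> sym V2.
Hypotheses (cE : is_coalg_morphism E) (E1 : E 1 = 1).

Lemma coalg_noninc : noninc E.
Proof. by move=> w; apply: coalg_fil. Qed.

Lemma coalg_p1_linear : linear (fun a => wproj 1 (E a)).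
Proof. by have [lE _ _ _] := cE; apply: linear_comp (wproj_linear 1) lE. Qed.

Lemma coalg_p1_noninc : noninc (fun a => wproj 1 (E a)).
Proof.
apply: cogen_noninc => [a|]; first by rewrite wproj_comp eqxx.
by rewrite E1 wproj1_1.
Qed.

Lemma hexp_hbar_coalg :
  hexp (A := symalg U2) (hbar e1 e2 (fun a => wproj 1 (E a))) = hbar e1 e2 E.
Proof.
rewrite hexp_hbar //; last exact: coalg_p1_noninc.
  by rewrite coalg_expm.
exact: coalg_p1_linear.
Qed.

Lemma hbar_pure : is_pure_map (hbar e1 e2 (fun a => wproj 1 (E a))).
Proof.
move=> n j x xj; have lp := coalg_p1_linear.
have Ex : hbar e1 e2 (fun a => wproj 1 (E a)) x n =
    if (j == n.+1) then esS e2 (wproj 1 (E (esT e1 x))) else 0.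
  rewrite (hbar_pow e1 e2 n lp xj) wproj_esS wproj_comp.
  case: (j =P n.+1) => [->|jn]; first by rewrite leqnSn subSnn.
  case: leqP => // nj; case: eqP => ?; first by case: jn; lia.
  exact/lin0/esS_linear.
rewrite Ex; split=> [->|/eqP/negbTE -> //].
by rewrite eqxx /in_pow wproj_esS wproj_comp eqxx.
Qed.

Lemma hbar_hdegree : hdegree (V := symalg U1) (W := symalg U2) 0
  (hbar e1 e2 (fun a => wproj 1 (E a))).
Proof.
move=> n; have lp := coalg_p1_linear; have [lE dE _ _] := cE.
apply: word_has_degree => [|w]; first exact: hbar_linear.
rewrite hbar_word // wproj_esS wproj_comp esT_word.
case: leqP => nw; last exact: sproj0.
case: eqP => wn; last by rewrite (lin0 (esS_linear e2)) sproj0.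
have := has_degree_word dE (esM e1 w); rewrite addr0 wdeg_esM => dw.
have d1 : sproj (wdeg w - (size w).*2%:Z) (wproj 1 (E (word (esM e1 w)))) =
  wproj 1 (E (word (esM e1 w))).
  by rewrite sproj_wproj dw.
have p1 : wproj 1 (wproj 1 (E (word (esM e1 w)))) = wproj 1 (E (word (esM e1 w))).
  by rewrite wproj_comp eqxx.
have := sproj_esS e2 d1 p1.
by have -> : wdeg w - (size w).*2%:Z + 1.*2%:Z = wdeg w + (0 - n.*2%:Z) by lia.
Qed.

Lemma hbar_bv_morphism (Delta : hmap (sym U1) (sym U1)) (Delta' : hmap (sym U2) (sym U2)) :
  hcomp (U := symalg U1) (V := symalg U1) (W := symalg U2) (hbar e1 e2 E) Delta =
  hcomp (U := symalg U1) (V := symalg U2) (W := symalg U2) Delta' (hbar e1 e2 E) ->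
  is_bv_morphism (A := symalg U2) Delta Delta' (hbar e1 e2 (fun a => wproj 1 (E a))) /\
  is_pure_map (hbar e1 e2 (fun a => wproj 1 (E a))).
Proof.
move=> comm; split; last exact: hbar_pure.
split.
- by move=> n; apply: hbar_linear; apply: coalg_p1_linear.
- exact: hbar_hdegree.
- move=> n; have p0 : in_pow 0 (1 : sym U1) by rewrite /in_pow -word_nil wproj_word.
  by have [_ ->] := hbar_pure n p0.
- by rewrite hexp_hbar_coalg.
- by move=> n j x nj xj; have [_ ->] := hbar_pure n xj => //; lia.
Qed.

End OfCoalg.
End PureMorphisms.

Lemma coalg_comp (k : fieldType) (V1 V2 V3 : gvect k) (Psi : sym V2 ->
  sym V3) (Phi : sym V1 -> sym V2) :
  is_coalg_morphism Psi -> is_coalg_morphism Phi -> is_coalg_morphism (fun x => Psi (Phi x)).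
Proof.
move=> cP cF; have [lP dP cP' eP] := cP; have [lF dF cF' eF] := cF.
have [tl tr] := bilinear_tmk (sym V3) (sym V3).
have bP : bilinear (fun a b => tmk (Psi a) (Psi b)).
  by split=> c; [apply: linear_comp (tl _) lP | apply: linear_comp (tr _) lP].
have lPF : linear (fun x => Psi (Phi x)) := linear_comp lP lF.
have bPF : bilinear (fun a b => tmk (Psi (Phi a)) (Psi (Phi b))).
  by split=> c; [apply: linear_comp (tl _) lPF | apply: linear_comp (tr _) lPF].
split=> [//|p v pv|x|x]; last by rewrite eP eF.
- by rewrite addr0; have := dP _ _ (dF _ _ pv); rewrite !addr0.
- move: x; apply: sym_eqP.
  + exact: linear_comp (@comult_linear k V3) lPF.
  + exact: linear_comp (tlift_linear bPF) (@comult_linear k V1).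
  by move=> w; rewrite cP' coalg_tlift // tlift_comult.
Qed.

Lemma coalg_id (k : fieldType) (V : gvect k) : is_coalg_morphism (fun x : sym V => x).
Proof.
split=> [//|p v pv|x|//]; first by rewrite addr0.
move: x; apply: sym_eqP => [||w]; first exact: comult_linear.
  exact: linear_comp (tlift_linear (bilinear_tmk _ _)) (@comult_linear k V).
by rewrite tlift_comult ?comult_word //; apply: bilinear_tmk.
Qed.

(** The exponentials are the series of the full morphisms, these multiply, and the logarithm
    projects again. The three shifts are arbitrary, so arrows between different suspensions of one
    space can be composed, as [counit_iso] requires. *)
Lemma bv_comp_hbar (k : fieldType) (X Y Z : bv_data k) (V1 V2 V3 : gvect k)
  (e1 : eshift V1 (bvU X)) (e2 : eshift V2 (bvU Y)) (e3 : eshift V3 (bvU Z))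
  (Psi : sym V2 -> sym V3) (Phi : sym V1 -> sym V2) : [pchar k] =i pred0 ->
  is_coalg_morphism Psi -> Psi 1 = 1 -> is_coalg_morphism Phi -> Phi 1 = 1 ->
  bv_comp (X := X) (Y := Y) (Z := Z) (hbar e2 e3 (fun a => wproj 1 (Psi a))) (hbar e1 e2 (fun
    a => wproj 1 (Phi a))) =
  hbar e1 e3 (fun a => wproj 1 (Psi (Phi a))).
Proof.
move=> char0 cP P1 cF F1; rewrite /bv_comp !hexp_hbar_coalg //.
have [lP _ _ _] := cP; have [lF _ _ _] := cF.
rewrite hcomp_hbar //; try exact: coalg_noninc.
by rewrite hlog_hbar //; [apply: coalg_comp | rewrite F1].
Qed.

Lemma bv_id_hbar (k : fieldType) (X : bv_data k) (V : gvect k) (e : eshift V (bvU X)) :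
  bv_id (X := X) = hbar e e (fun a => wproj 1 a).
Proof.
have lp := @wproj_linear k V 1.
apply/funext => x; apply/funext => n; move: x; apply: (sym_eqP (W := sym (bvU X))) => [||w].
- by case: n => [|n]; [apply: wproj_linear | apply: linear_zero].
- exact: hbar_linear.
rewrite hbar_word // wproj_esS wproj_comp (lin_if _ _ (esS_linear e)) -wproj_esS esTK.
case: n => [|n]; rewrite /= ?subn0.
  by rewrite wproj_word; case: eqP => // ->.
rewrite wproj_word; case: leqP => // nw; case: eqP => wn.
  by rewrite ifF //; apply/eqP; lia.
by [].
Qed.
(** * Differential operators *)

Section DifferentialOperators.
Variables (k : fieldType) (U : gvect k).
Local Notation A := (symalg U).
Implicit Types (w u v r : seq (helt U)) (P Q l : sym U -> sym U) (s : seq (int * sym U)).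
Local Notation nc := (nested_comm (A := A)).

Lemma nested_comm_ext d P Q s b : P =1 Q -> nc d P s b = nc d Q s b.
Proof. by move=> /funext ->. Qed.

Lemma nested_commD d P Q c s b :
  nc d (fun x => c *: P x + Q x) s b = c *: nc d P s b + nc d Q s b.
Proof.
elim: s d P Q b => [|[p a] s IH] d P Q b //=.
rewrite -IH; apply: nested_comm_ext => x.
rewrite mulrDr -scalerAr scalerDr opprD addrACA scalerBr !scalerA.
by rewrite [c * _]mulrC.
Qed.

Lemma nested_comm0 d s b : nc d (fun _ => 0) s b = 0.
Proof.
elim: s d b => [|[p a] s IH] d b //=.
by rewrite -[RHS](IH (d + p) b); apply: nested_comm_ext => x; rewrite mulr0 scaler0 subrr.
Qed.

Lemma nested_comm_ssum d (G : seq (helt U) -> seq (helt U) -> sym U -> sym U) w s b :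
  nc d (fun x => ssum (fun u v => G u v x) w) s b = ssum (fun u v => nc d (G u v) s b) w.
Proof.
elim: w G => //= x w IH G.
rewrite -(IH (fun u v => G (x :: u) v)).
rewrite (ssum_ext w (G' := fun u v => nc d (fun y => koszul k (hdeg x) (wdeg u) *: G u (x ::
  v) y) s b)); last first.
  move=> u v; rewrite -[LHS]addr0 -[X in _ + X = _](nested_comm0 d s b) -nested_commD.
  by apply: nested_comm_ext => y; rewrite addr0.
rewrite -(IH (fun u v y => koszul k (hdeg x) (wdeg u) *: G u (x :: v) y)).
rewrite -[X in _ = X + _]scale1r -nested_commD; apply: nested_comm_ext => y.
by rewrite scale1r.
Qed.

Lemma nested_comm_mull d e (y : sym U) P s b :
  sproj e y = y -> all (fun pa => homog (V := A) pa.1 pa.2) s ->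
  nc d (fun x => y * P x) s b = y * nc (d - e) P s b.
Proof.
move=> ye; elim: s d P b => [|[p a] s IH] d P b //= /andP[/eqP pa hs].
have -> : d - e + p = d + p - e by rewrite addrAC.
rewrite -IH //; apply: nested_comm_ext => x.
rewrite mulrBr; congr (_ - _); rewrite -scalerAr !mulrA; apply/eqP.
rewrite (sprojC pa ye) -scalerAl scalerA; apply/eqP; congr (_ *: _).
have -> : d = d - e + e by rewrite subrK.
by rewrite koszulD addrK mulrAC -mulrA [koszul k p e]koszulC koszulK mulr1.
Qed.

Lemma ssum_cat (M : lmodType k) (G : seq (helt U) -> seq (helt U) -> M) r w :
  ssum G (r ++ w) = ssum (fun r1 r2 => ssum (fun u v =>
     koszul k (wdeg r2) (wdeg u) *: G (r1 ++ u) (r2 ++ v)) w) r.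
Proof.
elim: r G => [|x r IH] G /=.
  by apply: ssum_ext => u v; rewrite wdeg_nil koszul0 scale1r.
rewrite !IH; congr (_ + _); apply: ssum_ext => r1 r2.
rewrite -ssumZ; apply: ssum_ext => u v.
rewrite !scalerA wdeg_cat koszulDr wdeg_cons koszulD; congr (_ *: _); ring.
Qed.

(* Commuting with multiplication by a word r replaces l by l o L_(r1), for
   the nonempty left parts r1 of the unshuffles of r. *)
Lemma coext_comm l d r b : linear l ->
  (forall w, sproj (wdeg w + d) (l (word w)) = l (word w)) ->
  coext l (word r * b) - koszul k d (wdeg r) *: (word r * coext l b) =
  ssum (fun r1 r2 => if r1 == [::] then 0 else
     (koszul k (wdeg r2) (d + wdeg r1) *: word r2) * coext (fun x => l (word r1 * x)) b) r.
Proof.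
move=> ll ld; have lc := coext_linear ll.
have llr r1 : linear (fun x => l (word r1 * x)).
  by apply: (linear_comp ll); apply: linear_mull.
move: b; apply: sym_eqP.
- apply: linear_sub; first by apply: linear_comp lc _; apply: linear_mull.
  by apply: linear_scale; apply: linear_mull.
- move=> c x y; rewrite -ssumZ -ssumD; apply: ssum_ext => r1 r2.
  case: eqP => _; first by rewrite scaler0 addr0.
  by rewrite (coext_linear (llr r1)) mulrDr -scalerAr.
move=> w; rewrite wordM !coext_word // ssum_cat.
pose T r1 r2 := (koszul k (wdeg r2) (d +
  wdeg r1) *: word r2) * coext (fun x => l (word r1 * x)) (word w).
rewrite [X in X - _ = _](ssum_ext r (G' := fun r1 r2 => (if r1 == [::] then T [::] r2 else 0) +
    (if r1 == [::] then 0 else T r1 r2))); last first.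
  move=> r1 r2; have -> : (if r1 == [::] then T [::] r2 else 0) +
    (if r1 == [::] then 0 else T r1 r2) = T r1 r2.
    by case: eqP => [->|_]; rewrite ?addr0 ?add0r.
  rewrite /T coext_word // (ssum_lin (F :=
    fun y => (koszul k (wdeg r2) (d + wdeg r1) *: word r2) * y)); last by apply: linear_mull.
  apply: ssum_ext => u v; rewrite -!wordM mulrA.
  have -> : l (word r1 * word u) * word r2 =
    koszul k (wdeg r1 + wdeg u + d) (wdeg r2) *: (word r2 * l (word r1 * word u)).
    by rewrite wordM -wdeg_cat; apply: sprojC; [apply: ld | apply: sproj_wdeg].
  rewrite -!scalerAl scalerA mulrA; congr (_ *: _).
  have -> : wdeg r1 + wdeg u + d = wdeg u + (d + wdeg r1) by ring.
  rewrite koszulD ![koszul k (wdeg r2) _]koszulC mulrA koszulK mul1r; done.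
(* The term with r1 empty is the product that the graded commutator subtracts. *)
rewrite ssumD ssum_nill; last by move=> u v /negbTE ->.
rewrite eqxx addrAC -[RHS]add0r; congr (_ + _); apply/eqP; rewrite subr_eq0; apply/eqP.
rewrite /T wdeg_nil addr0 koszulC -scalerAl; congr (_ *: (_ * _)).
rewrite coext_word //; apply: ssum_ext => u v; by rewrite word_nil mul1r.
Qed.

(** Induction on the length N from which l vanishes. Each commutator replaces l by l(r1 -) with r1
    nonempty, which lowers the bound; the left factor r2 passes through the remaining commutators by
    [nested_comm_mull]. *)
Lemma coext_diffop N l d s b : linear l ->
  (forall w, sproj (wdeg w + d) (l (word w)) = l (word w)) ->
  (forall w, (N <= size w)%N -> l (word w) = 0) ->
  size s = N -> all (fun pa => homog (V := A) pa.1 pa.2) s ->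
  nc d (coext l) s b = 0.
Proof.
elim: N l d s b => [|N IH] l d s b ll ld lN.
  move/size0nil => -> _ /=.
  move: b; apply: sym_eqP; [exact: coext_linear | exact: linear_zero | move=> w].
  by rewrite coext_word // (ssum_ext w (G' := fun _ _ => 0)) ?ssum0 // => u v;
    rewrite lN ?mul0r.
case: s => [//|[p a] s] [sN] /= /andP[/eqP pa hs].
pose Pa (a : sym U) x := coext l (a * x) - koszul k d p *: (a * coext l x).
rewrite -/(Pa a) -[a]pa; move: a {pa}.
have lc := coext_linear ll.
have lPa : linear (fun a => nc (d + p) (Pa (sproj p a)) s b).
  move=> c x y; rewrite -nested_commD; apply: nested_comm_ext => z.
  rewrite /Pa sproj_linear !mulrDl -!scalerAl lc scalerBr scalerDr opprD addrACA.
  by rewrite !scalerA [c * _]mulrC.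
apply: (sym_eqP lPa (@linear_zero _ _ _)) => r.
change (nc (d + p) (Pa (sproj p (word r))) s b = 0).
rewrite sproj_word; case: eqP => [rp|_]; last first.
  rewrite -[RHS](nested_comm0 (d + p) s b); apply: nested_comm_ext => x.
  by rewrite /Pa !mul0r (lin0 lc) scaler0 subrr.
rewrite (@nested_comm_ext (d + p) _ (fun x => ssum (fun r1 r2 => if r1 == [::] then 0 else
     (koszul k (wdeg r2) (d + wdeg r1) *: word r2) * coext (fun x => l (word r1 * x)) x) r));
       last first.
  by move=> x; rewrite /Pa -rp coext_comm.
rewrite nested_comm_ssum (eq_ssum (G' := fun _ _ => 0)) ?ssum0 // => r1 r2 _ r12.
case: eqP => [_|/eqP r10]; first exact: nested_comm0.
rewrite (@nested_comm_mull _ (wdeg r2)) //; last first.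
  by rewrite sprojZ // sproj_wdeg.
have -> : d + p - wdeg r2 = d + wdeg r1 by rewrite -rp -r12; ring.
rewrite IH ?mulr0 //.
- by apply: (linear_comp ll); apply: linear_mull.
- move=> w; rewrite wordM.
  have -> : wdeg w + (d + wdeg r1) = wdeg (r1 ++ w) + d by rewrite wdeg_cat; ring.
  exact: ld.
- move=> w Nw; rewrite wordM lN // size_cat; case: r1 r10 {r12} => //= y r1 _; lia.
Qed.

(** Expanding the commutators, every term other than Q(w1 w2) applies Q to a shorter word and
    vanishes. *)
Lemma nested_comm_letters Q d w1 w2 : linear Q ->
  (forall w, (size w < size w1 + size w2)%N -> Q (word w) = 0) ->
  nc d Q [seq (hdeg a, word [:: a]) | a <- w1] (word w2) = Q (word (w1 ++ w2)).
Proof.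
elim: w1 w2 d Q => [|x w1 IH] w2 d Q lQ Q0 //=.
rewrite IH.
- rewrite !wordM cat1s [Q (word (w1 ++ w2))]Q0 ?mulr0 ?scaler0 ?subr0 //.
  by rewrite size_cat.
- apply: linear_sub; first by apply: (linear_comp lQ); apply: linear_mull.
  by apply: linear_scale; apply: linear_mull.
- move=> w ww; rewrite wordM !Q0 ?mulr0 ?scaler0 ?subr0 //=; lia.
Qed.

(** Strong induction on the length: for a word with more than n letters, n + 1 commutators with its
    first letters, applied to the rest, compute Q of the word, since Q already vanishes on shorter
    words; the order of Q makes this zero. *)
Lemma diffop_eq0 n d Q : is_diffop (A := A) d n Q ->
  (forall w, (size w <= n)%N -> Q (word w) = 0) -> forall w, Q (word w) = 0.
Proof.
move=> [lQ dQ] Q0 w; have [m] := ubnP (size w); elim: m w => // m IH w wm.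
have [wn|nw] := leqP (size w) n; first exact: Q0.
rewrite -(cat_take_drop n.+1 w) -(nested_comm_letters d) //.
  rewrite dQ // ?size_map ?size_takel //.
  by apply/allP => pa /mapP[x _ ->] /=; apply/eqP; rewrite -{1}wdeg1; apply: sproj_wdeg.
by rewrite -size_cat cat_take_drop => w' w'w; apply: IH; lia.
Qed.

Lemma is_diffopB n d P Q : is_diffop (A := A) d n P -> is_diffop (A := A) d n Q ->
  is_diffop (A := A) d n (fun x => P x - Q x).
Proof.
move=> [lP dP] [lQ dQ]; split; first exact: linear_sub.
move=> s sn hs b.
rewrite (@nested_comm_ext d _ (fun x => (-1) *: Q x + P x)); last first.
  by move=> x; rewrite scaleN1r addrC.
by rewrite nested_commD dP // dQ // scaler0 addr0.
Qed.

End DifferentialOperators.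
(** * Pure BV operators *)

Section HCompositionLaws.
Variable k : fieldType.

Lemma sum_triangle (M : nmodType) n (f : nat -> nat -> M) :
  \sum_(i < n.+1) \sum_(j < (n - i).+1) f i j = \sum_(s < n.+1) \sum_(i < s.+1) f i (s - i)%N.
Proof.
transitivity (\sum_(i < n.+1) \sum_(s < n.+1 | (i <= s)%N) f i (s - i)%N).
  apply: eq_bigr => i _; have := ltn_ord i => il.
  rewrite -(big_geq_mkord i n.+1 xpredT (fun s => f i (s - i)%N)).
  have E := big_addn 0 n.+1 i xpredT (fun s => f i (s - i)%N); rewrite add0n in E.
  rewrite E big_mkord subSn //.
  by apply: eq_bigr => j _; rewrite addnK.
rewrite (exchange_big_dep xpredT) //=; apply: eq_bigr => s _.
rewrite (big_ord_widen n.+1 (fun i => f i (s - i)%N)) //.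
Qed.

Lemma hcomp_assoc (U1 U2 U3 U4 : gvect k) (P : hmap U3 U4) (Q : hmap U2 U3) (R : hmap U1 U2) :
  hlinear P -> hcomp P (hcomp Q R) = hcomp (hcomp P Q) R.
Proof.
move=> lP; apply/funext => x; apply/funext => n; rewrite /hcomp /hext.
transitivity (\sum_(i < n.+1) \sum_(j < (n - i).+1) P (Q (R x (n - i - j)%N) j) i).
  by apply: eq_bigr => i _; rewrite (lin_sum _ _ _ (lP i)).
rewrite (sum_triangle n (fun i j => P (Q (R x (n - i - j)%N) j) i)).
apply: eq_bigr => s _; apply: eq_bigr => i _.
by rewrite -subnDA subnKC // -ltnS.
Qed.

Definition hunit (U : gvect k) : hmap U U := fun x n => if n is 0%N then x else 0.

Lemma hcomp_unitl (U1 U2 : gvect k) (P : hmap U1 U2) : hcomp (@hunit U2) P = P.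
Proof.
apply/funext => x; apply/funext => n; rewrite /hcomp /hext big_ord_recl /= subn0.
by rewrite big1 ?addr0.
Qed.

Lemma hcomp_unitr (U1 U2 : gvect k) (P : hmap U1 U2) : hlinear P -> hcomp P (@hunit U1) = P.
Proof.
move=> lP; apply/funext => x; apply/funext => n; rewrite /hcomp /hext big_ord_recr /= subnn.
rewrite big1 ?add0r // => i _; have := ltn_ord i => il.
by case E : (n - i)%N => [|m]; [lia | rewrite /= (lin0 (lP i))].
Qed.

Lemma hbar_id (V U : gvect k) (e : eshift V U) :
  hbar e e (fun x => x) = @hunit (symalg U).
Proof.
have lid := @linear_idfun k (sym V).
apply/funext => x; apply/funext => n; move: x; apply: (sym_eqP (W := sym U)) => [||w].
- exact: hbar_linear.
- by case: n => [|n]; [apply: linear_idfun | apply: linear_zero].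
rewrite hbar_word // esTK wproj_word.
case: n => [|n]; first by rewrite subn0 eqxx.
by case: leqP => // nw; rewrite ifF //; apply/eqP; lia.
Qed.

End HCompositionLaws.

Section BVObjects.
Variables (k : fieldType) (V U : gvect k) (e : eshift V U).
Hypothesis char0 : [pchar k] =i pred0.

Lemma in_pow_word w : in_pow (size w) (word w : sym V).
Proof. by rewrite /in_pow wproj_word eqxx. Qed.

Section Coext.
Variable l : sym V -> sym V.
Hypotheses (ll : linear l) (l_cogen : forall a, wproj 1 (l a) = l a).
Hypothesis l_deg : forall w, sproj (wdeg w + 1) (l (word w)) = l (word w).

Lemma wproj_coext w n : (n <= size w)%N ->
  wproj (size w - n) (coext l (word w)) =
  ssum (fun u v => if size u == n.+1 then l (word u) * word v else 0) w.
Proof.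
move=> nw; rewrite coext_word // (ssum_lin _ _ (wproj_linear _)).
apply: eq_ssum => u v uv _.
rewrite -(in_powM (l_cogen _) (in_pow_word v)) wproj_comp.
by case: eqP => h; case: eqP => // h'; exfalso; lia.
Qed.

(* The corestriction of the n-th coefficient of hbar (coext l), see hbar_coext. *)
Definition hcoef n : sym U -> sym U := fun x => esS e (l (esT e (wproj n.+1 x))).

Lemma hcoef_linear n : linear (hcoef n).
Proof. exact: linear_comp (conj_linear e e ll) (wproj_linear n.+1). Qed.

Lemma hcoef_word n w : hcoef n (word w) =
  if size w == n.+1 then esS e (l (word (esM e w))) else 0.
Proof.
rewrite /hcoef wproj_word; case: eqP => _; first by rewrite esT_word.
by rewrite (lin0 (conj_linear e e ll)).
Qed.

Lemma hbar_coext n x : hbar e e (coext l) x n = coext (hcoef n) x.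
Proof.
have lc := coext_linear ll.
move: x; apply: (sym_eqP (W := sym U)) => [||w]; first exact: hbar_linear.
  exact/coext_linear/hcoef_linear.
rewrite hbar_word // coext_word; last exact: hcoef_linear.
case: leqP => nw; last first.
  rewrite (eq_ssum (G' := fun _ _ => 0)) ?ssum0 // => u v uv _.
  by rewrite hcoef_word; case: eqP => [E|_]; [lia | rewrite mul0r].
rewrite wproj_esS esT_word -(size_esM e w) wproj_coext ?size_esM //.
rewrite ssum_esM (ssum_lin _ _ (esS_linear e)); apply: ssum_ext => u v.
rewrite hcoef_word size_esM; case: eqP => _; last by rewrite mul0r (lin0 (esS_linear e)).
by rewrite esSM -!esT_word esTK.
Qed.

Lemma hcoef_degree n w : sproj (wdeg w + (1 - n.*2%:Z)) (hcoef n (word w)) = hcoef n (word w).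
Proof.
rewrite hcoef_word; case: eqP => wn; last exact: sproj0.
have := sproj_esS e (l_deg (esM e w)) (l_cogen _); rewrite wdeg_esM wn.
by have -> : wdeg w - n.+1.*2%:Z + 1 + 1.*2%:Z = wdeg w + (1 - n.*2%:Z) by lia.
Qed.

Lemma hbar_coext_diffop n :
  is_diffop (A := symalg U) (1 - n.*2%:Z) n.+1 (fun x => hbar e e (coext l) x n).
Proof.
split; first exact/hbar_linear/coext_linear.
move=> s sn hs b; rewrite (@nested_comm_ext _ _ _ _ (coext (hcoef n))); last exact: hbar_coext.
(* [hcoef n] lives on words of length n + 1, so it vanishes from length n + 2 on, and n + 2 is the
   number of commutators in order at most n + 1. *)
apply: (@coext_diffop _ _ n.+2) => //; first exact: hcoef_linear.
- exact: hcoef_degree.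
- by move=> w nw; rewrite hcoef_word; case: eqP => // E; lia.
Qed.

Lemma hbar_coext_degree :
  hdegree (V := symalg U) (W := symalg U) 1 (hbar e e (coext l)).
Proof.
move=> n; apply: word_has_degree => [|w]; first exact/hbar_linear/coext_linear.
rewrite hbar_coext coext_word; last exact: hcoef_linear.
apply: sproj_ssum => u v <-.
rewrite addrAC; apply: sprojM; [exact: hcoef_degree | exact: sproj_wdeg].
Qed.

Hypothesis l1 : l 1 = 0.

Lemma coext_noninc : noninc (coext l).
Proof. by move=> w; apply: coext_fil. Qed.

Lemma coext_wproj0 a : wproj 0 (coext l a) = 0.
Proof.
move: a; apply: sym_eqP => [||w]; last 1 first.
- rewrite coext_word // (ssum_lin _ _ (wproj_linear 0)) (ssum_ext w (G' :=
  fun _ _ => 0)) ?ssum0 // => u v.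
  by rewrite -(in_powM (l_cogen _) (in_pow_word v)) wproj_comp.
- exact: linear_comp (wproj_linear 0) (coext_linear ll).
- exact: linear_zero.
Qed.

Lemma hbar_coext_pure : (forall x, coext l (coext l x) = 0) -> is_pure_bv (hbar e e (coext l)).
Proof.
move=> D2; have lc := coext_linear ll; have nc := coext_noninc.
split; first split.
- by move=> n; apply: hbar_linear.
- exact: hbar_coext_degree.
- exact: hbar_coext_diffop.
- move=> a n; rewrite hcomp_hbar //.
  rewrite (hbar_ext e e (Phi := fun _ => 0)) //.
  have l0 : linear (fun _ : sym V => 0 : sym V) := @linear_zero _ _ _.
  move: a; apply: (sym_eqP (W := sym U)) => [||w]; [exact: hbar_linear|exact: linear_zero|].
  by rewrite hbar_word // (lin0 (esS_linear e)) (lin0 (wproj_linear _)) if_same.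
- move=> n; rewrite hbar_coext coext1 //; first exact: hcoef_linear.
  by rewrite -word_nil hcoef_word.
move=> n j x xj; rewrite (hbar_pow e e n lc xj); split=> [->|jn].
  by rewrite leqnSn subSnn /in_pow wproj_comp eqxx.
(* Only j = n is left; the target is then S^0, which a coextension never reaches. *)
case: leqP => // nj; have -> : (j - n = 0)%N by lia.
by rewrite wproj_esS coext_wproj0 (lin0 (esS_linear e)).
Qed.

End Coext.

Section OfDelta.
Variable Delta : hmap (sym U) (sym U).
Hypothesis pD : is_pure_bv Delta.

Let lD n : linear (fun x => Delta x n).
Proof. by have [[lD _ _ _ _] _] := pD; apply: lD. Qed.

(** Collects Delta_m on S^m for all m into one map. The predecessor occurs because Delta_m is the
    coefficient of hbar^(m-1); on the empty word it picks the coefficient of hbar^0, whose value at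
    1 is zero. *)
Definition components : sym V -> sym V :=
  slift (fun w => esT e (Delta (esS e (word w)) (size w).-1)).

Fact components_resp : wresp (fun w : seq (helt V) => esT e (Delta (esS e (word w)) (size
  w).-1)).
Proof.
apply: (wresp_size (F := fun m w => esT e (Delta (esS e (word w)) m.-1))) => m.
apply: (wresp_word (F := fun x => esT e (Delta (esS e x) m.-1))).
apply: (linear_comp (esT_linear e)); exact: linear_comp (lD _) (esS_linear e).
Qed.

Lemma components_word w : components (word w) = esT e (Delta (esS e (word w)) (size w).-1).
Proof. exact/slift_wordE/components_resp. Qed.
Lemma components_linear : linear components.
Proof. exact/slift_lin/components_resp. Qed.
Lemma components1 : components 1 = 0.
Proof.
have [[_ _ _ _ D1] _] := pD.
by rewrite -word_nil components_word word_nil esS1 D1 (lin0 (esT_linear e)).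
Qed.

Lemma components_cogen a : wproj 1 (components a) = components a.
Proof.
have lc := components_linear.
move: a; apply: sym_eqP => // [|w]; first exact: linear_comp (wproj_linear 1) lc.
rewrite components_word wproj_esT; congr (esT _ _).
have pw : in_pow (size w) (esS e (word w)) by rewrite /in_pow wproj_esS in_pow_word.
case: w pw => [|x w] pw.
  have [[_ _ _ _ D1] _] := pD.
  by rewrite word_nil esS1 D1 (lin0 (wproj_linear 1)).
by have [_ D0] := pD; have [/(_ erefl)] := D0 (size w) _ _ pw.
Qed.

Lemma components_degree w : sproj (wdeg w + 1) (components (word w)) = components (word w).
Proof.
case: w => [|x w]; first by rewrite word_nil components1 sproj0.
have p1 := components_cogen (word (x :: w)); move: p1.
rewrite components_word wproj_esT => /(can_inj (esTK e)) p1.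
have [[_ dD _ _ _] _] := pD.
have d1 := sproj_esS e (sproj_wdeg (x :: w)) (in_pow_word (x :: w)).
have /eqP d2 := dD (size w) _ _ (introT eqP d1).
have := sproj_esT e d2 p1.
by have -> : wdeg (x :: w) + (size (x :: w)).*2%:Z + (1 - (size w).*2%:Z) - 1.*2%:Z =
  wdeg (x :: w) + 1
  by rewrite /=; lia.
Qed.

Lemma pure_bv_coext : hbar e e (coext components) = Delta.
Proof.
have [[_ _ DD _ D1] D0] := pD; have lc := components_linear.
apply/funext => x; apply/funext => n; apply: esym; apply/eqP; rewrite -subr_eq0; apply/eqP.
move: x; apply: (sym_eqP (W := sym U)) => [||w]; last 1 first.
- apply: (diffop_eq0 (n := n.+1)
    (is_diffopB (DD n) (hbar_coext_diffop lc components_cogen components_degree n))).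
  move=> {}w wn; rewrite (hbar_coext lc components_cogen) (coext_word (hcoef_linear lc n)).
  have pw : in_pow (size w) (word w : sym U) by rewrite /in_pow wproj_word eqxx.
  (* On length n + 1 only the unshuffle with empty right block contributes, and it returns Delta
     itself; on shorter words both operators vanish. *)
  have [wn1|wn1] := eqVneq (size w) n.+1.
    rewrite (eq_ssum (G' := fun u v => if v == [::] then hcoef components n (word u) *
      word v else 0)).
      rewrite ssum_nilr => [|u v /negbTE -> //].
      rewrite eqxx word_nil mulr1 hcoef_word // wn1 eqxx components_word size_esM wn1.
      by rewrite -esT_word !esTK subrr.
    move=> u v uv _; case: eqP => // v0.
    rewrite hcoef_word //; case: eqP => [h|_]; last exact: mul0r.
    by case: v v0 uv => //= z v _; lia.
  rewrite (eq_ssum (G' := fun _ _ => 0)); last first.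
    by move=> u v uv _; rewrite hcoef_word //; case: eqP => [E|_]; [lia | rewrite mul0r].
  rewrite ssum0 subr0; have [_ -> //] := D0 n _ _ pw.
  by move/eqP: wn1; lia.
- by apply: linear_sub; [apply: lD | apply: hbar_linear; apply: coext_linear].
- exact: linear_zero.
Qed.

End OfDelta.
End BVObjects.
(** * The functors *)

Section Functors.
Variable k : fieldType.
Hypothesis char0 : [pchar k] =i pred0.

Definition susp_shift (g : gvect k) : eshift (shift 1 g) (shift (-1) g) :=
  @EShift k (shift 1 g) (shift (-1) g) (fun v => v) (fun v => v)
    (@susp_degree k g) (@desusp_degree k g) (fun _ _ _ => erefl) (fun _ _ _ => erefl)
    (fun _ => erefl) (fun _ => erefl).
Definition down_shift (U : gvect k) : eshift (shift 1 (shift 1 U)) U :=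
  @EShift k (shift 1 (shift 1 U)) U (fun v => v) (fun v => v)
    (@down_degree k U) (@up_degree k U) (fun _ _ _ => erefl) (fun _ _ _ => erefl)
    (fun _ => erefl) (fun _ => erefl).

Lemma coder_p1_linear (V : gvect k) (D : sym V -> sym V) :
  is_coderivation D -> linear (fun a => wproj 1 (D a)).
Proof. by move=> [lD _ _]; apply: linear_comp (wproj_linear 1) lD. Qed.

Lemma coder_p1_cogen (V : gvect k) (D : sym V -> sym V) a :
  wproj 1 (wproj 1 (D a)) = wproj 1 (D a).
Proof. by rewrite wproj_comp eqxx. Qed.

Lemma coder_p1_degree (V : gvect k) (D : sym V -> sym V) w : is_coderivation D ->
  sproj (wdeg w + 1) (wproj 1 (D (word w))) = wproj 1 (D (word w)).
Proof. by move=> [_ dD _]; rewrite sproj_wproj (has_degree_word dD). Qed.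

Lemma coder_noninc (V : gvect k) (D : sym V -> sym V) :
  is_coderivation D -> D 1 = 0 -> noninc D.
Proof.
move=> cD D1; rewrite -(coder_coext char0 cD); apply: coext_noninc.
- exact: coder_p1_linear.
- by move=> a; apply: coder_p1_cogen.
- by rewrite D1 (lin0 (wproj_linear 1)).
Qed.

Lemma hbar_coder_pure (V U : gvect k) (e : eshift V U) (D : sym V -> sym V) :
  is_coderivation D -> D 1 = 0 -> (forall x, D (D x) = 0) -> is_pure_bv (hbar e e D).
Proof.
move=> cD D1 D2; rewrite -(coder_coext char0 cD); apply: hbar_coext_pure.
- exact: coder_p1_linear.
- by move=> a; apply: coder_p1_cogen.
- by move=> w; apply: coder_p1_degree.
- by rewrite D1 (lin0 (wproj_linear 1)).
- by move=> x; rewrite (coder_coext char0 cD).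
Qed.

(** D is the coextension of its corestriction, and the summand of arity n + 1 replaces n + 1 letters
    by one. Hence it is the part of D that shortens words by n ([wproj_coext]). *)
Lemma bv_of_linf_objE (g : obj (Linf k)) : is_obj (Linf k) g ->
  bvDelta (bv_of_linf_obj g) = hbar (susp_shift (linfV g)) (susp_shift (linfV g)) (linfD g).
Proof.
move=> [cD D2 D1].
have lp := coder_p1_linear cD.
pose e := susp_shift (linfV g).
pose L n w := if (n <= size w)%N then wproj (size w - n) (linfD g (word w)) else 0 : sym
  (shift 1 (linfV g)).
have E n : codext_word (V := shift 1 (linfV g)) n.+1 (fun w => wproj 1 (linfD g (word w))) =
  L n.
  apply/funext => w; rewrite codext_wordE /L; case: leqP => nw.
    rewrite -[in RHS](coder_coext char0 cD) wproj_coext //.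
    by move=> a; apply: coder_p1_cogen.
  rewrite (eq_ssum (G' := fun _ _ => 0)) ?ssum0 // => u v uv _.
  by case: eqP => // h; lia.
have [lD _ _] := cD.
have rL n : wresp (L n).
  apply: (wresp_size (F := fun m w => if (n <= m)%N then wproj (m - n) (linfD g (word w))
    else 0 : sym (shift 1 (linfV g)))) => m.
  apply: (wresp_word (F := fun x => if (n <= m)%N then wproj (m - n) (linfD g x) else 0)).
  by apply: linear_cond; apply: linear_comp (wproj_linear _) lD.
apply/funext => x; apply/funext => n.
transitivity (esS e (slift (L n) (esT e x))); first by rewrite -E.
move: x; apply: (sym_eqP (W := sym (shift (-1) (linfV g)))) => [||w].
- exact: (linear_comp (esS_linear e) (linear_comp (slift_lin (rL n)) (esT_linear e))).
- exact: hbar_linear.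
rewrite hbar_word // esT_word slift_wordE // /L size_esM wproj_esS.
by case: ifP => // _; apply: lin0 (esS_linear e).
Qed.

Lemma bv_of_linf_arrE (g h : obj (Linf k)) (Phi : arr (Linf k) g h) : linear Phi ->
  bv_of_linf_arr Phi =
  hbar (susp_shift (linfV g)) (susp_shift (linfV h)) (fun a => wproj 1 (Phi a)).
Proof.
move=> lP; have lq : linear (fun a => wproj 1 (Phi a)) := linear_comp (wproj_linear 1) lP.
pose eg := susp_shift (linfV g); pose eh := susp_shift (linfV h).
apply/funext => x; apply/funext => n.
change (esS eh (wproj 1 (Phi (wproj n.+1 (esT eg x)))) =
  hbar eg eh (fun a => wproj 1 (Phi a)) x n).
move: x; apply: (sym_eqP (W := sym (shift (-1) (linfV h)))) => [||w].
- apply: (linear_comp (esS_linear eh)); apply: (linear_comp lq).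
  exact: linear_comp (wproj_linear _) (esT_linear eg).
- exact: hbar_linear.
rewrite hbar_word // wproj_esS wproj_comp esT_word wproj_word size_esM.
have [m mE] : exists m, m = size w by exists (size w).
rewrite -!mE; have [->|wn] := eqVneq m n.+1; first by rewrite leqnSn subSnn.
rewrite (lin0 lq) (lin0 (esS_linear eh)); case: leqP => // nw.
by case: eqP => [?|_]; [case/eqP: wn; lia | rewrite (lin0 (esS_linear eh))].
Qed.

Lemma hbar_comm (V1 U1 V2 U2 : gvect k) (e1 : eshift V1 U1)
    (e2 : eshift V2 U2) (D1 : sym V1 -> sym V1) (D2 : sym V2 -> sym V2) (E : sym V1 -> sym V2) :
  is_coderivation D1 -> D1 1 = 0 -> is_coderivation D2 -> D2 1 = 0 ->
  is_coalg_morphism E -> E 1 = 1 -> (forall x, E (D1 x) = D2 (E x)) ->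
  hcomp (U := symalg U1) (V := symalg U1) (W := symalg U2) (hbar e1 e2 E) (hbar e1 e1 D1) =
  hcomp (U := symalg U1) (V := symalg U2) (W := symalg U2) (hbar e2 e2 D2) (hbar e1 e2 E).
Proof.
move=> c1 D11 c2 D21 cE E1 comm.
have [l1 _ _] := c1; have [l2 _ _] := c2; have [lE _ _ _] := cE.
have n1 := coder_noninc c1 D11; have n2 := coder_noninc c2 D21.
have nE := coalg_noninc char0 cE E1.
by rewrite !hcomp_hbar //; apply: hbar_ext.
Qed.

(** Reduces the laws of [BVfree] to composition of coalgebra morphisms. The objects need not be
    pure, so Delta need not come from a coderivation, and compatibility is kept as an identity of
    power series. *)
Lemma BVfree_arrP (X Y : obj (BVfree k)) (phi : arr (BVfree k) X Y) : is_arr phi ->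
  exists E : sym (shift 1 (shift 1 (bvU X))) -> sym (shift 1 (shift 1 (bvU Y))),
    [/\ is_coalg_morphism E, E 1 = 1,
        phi = hbar (down_shift (bvU X)) (down_shift (bvU Y)) (fun a => wproj 1 (E a)) &
        hcomp (U := symalg (bvU X)) (V := symalg (bvU X)) (W := symalg (bvU Y))
          (hbar (down_shift (bvU X)) (down_shift (bvU Y)) E) (bvDelta X) =
        hcomp (U := symalg (bvU X)) (V := symalg (bvU Y)) (W := symalg (bvU Y))
          (bvDelta Y) (hbar (down_shift (bvU X)) (down_shift (bvU Y)) E)].
Proof.
move=> [[lphi dphi phi1 comm _] pphi].
pose e1 := down_shift (bvU X); pose e2 := down_shift (bvU Y).
exists (expm (hat e1 e2 phi)); split.
- exact: hat_expm_coalg.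
- exact: hat_expm1.
- by rewrite hbar_hat_expm.
- by move: comm; rewrite (hexp_hat char0 e1 e2 lphi pphi).
Qed.

Lemma hbar_hlinear (V1 U1 V2 U2 : gvect k) (e1 : eshift V1 U1) (e2 : eshift V2 U2) (E : sym
  V1 -> sym V2) :
  linear E -> hlinear (V := symalg U1) (W := symalg U2) (hbar e1 e2 E).
Proof. by move=> lE n; apply: hbar_linear. Qed.

Lemma BVfree_category : is_category (BVfree k).
Proof.
split.
- move=> X [lD _ _ _ _] /=; pose e := down_shift (bvU X).
  rewrite (bv_id_hbar e); apply: hbar_bv_morphism => //; first exact: coalg_id.
  by rewrite hbar_id hcomp_unitl hcomp_unitr.
- move=> X Y Z psi phi oX oY oZ /BVfree_arrP[E' [cE' E'1 -> comm']] /BVfree_arrP[E [cE E1 ->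
  comm]].
  have [lE _ _ _] := cE; have [lE' _ _ _] := cE'; have [lZ _ _ _ _] := oZ.
  have nE := coalg_noninc char0 cE E1; have nE' := coalg_noninc char0 cE' E'1.
  rewrite /= bv_comp_hbar //; apply: (@hbar_bv_morphism _ _ _ _ _ _ _ _ (fun x => E' (E x)))
    => //.
  + exact: coalg_comp.
  + by rewrite E1.
  (* Compatibility of the composite follows by pasting the two commuting squares with associativity
     of [hcomp]. *)
  rewrite -(hcomp_hbar (down_shift (bvU X)) (down_shift (bvU Y)) (down_shift (bvU Z))) //.
  rewrite -hcomp_assoc; last exact: hbar_hlinear.
  rewrite comm hcomp_assoc; last exact: hbar_hlinear.
  by rewrite comm' hcomp_assoc.
- move=> X Y phi _ _ /BVfree_arrP[E [cE E1 -> _]] /=.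
  by rewrite (bv_id_hbar (down_shift (bvU X))) (bv_id_hbar (down_shift (bvU Y)))
    !bv_comp_hbar //; apply: coalg_id.
- move=> X Y Z T f3 f2 f1 _ _ _ _ /BVfree_arrP[E3 [c3 E31 -> _]]
    /BVfree_arrP[E2 [c2 E21 -> _]] /BVfree_arrP[E1 [c1 E11 -> _]] /=.
  have c32 := coalg_comp c3 c2; have c21 := coalg_comp c2 c1.
  rewrite (bv_comp_hbar (X := X) (Y := Y) (Z := Z)) // (bv_comp_hbar (X := Y) (Y := Z) (Z :=
    T)) //.
  rewrite (@bv_comp_hbar _ X Z T _ _ _ _ _ _ E3 (fun x => E2 (E1 x))) ?E11 //.
  by rewrite (@bv_comp_hbar _ X Y T _ _ _ _ _ _ (fun x => E3 (E2 x)) E1) ?E21.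
Qed.

Lemma Linf_category : is_category (Linf k).
Proof.
split=> //.
- by move=> X _; split=> //; apply: coalg_id.
- move=> X Y Z g f _ _ _ [cg Dg g1] [cf Df f1]; split=> /=.
  + exact: coalg_comp.
  + by move=> x; rewrite Df Dg.
  + by rewrite f1.
Qed.

Lemma bv_of_linf_pure (g : obj (Linf k)) : is_obj (Linf k) g ->
  is_pure_bv (bvDelta (bv_of_linf_obj g)).
Proof. by move=> og; rewrite bv_of_linf_objE //; case: og => cD D2 D1;
  apply: hbar_coder_pure. Qed.

Lemma bv_of_linf_arr_is (g h : obj (Linf k)) (Phi : arr (Linf k) g h) :
  is_obj (Linf k) g -> is_obj (Linf k) h -> is_arr Phi -> is_arr (farr (bv_of_linf k) Phi).
Proof.
move=> og oh [cP DP P1]; have [lP _ _ _] := cP; rewrite /= bv_of_linf_arrE //.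
apply: (@hbar_bv_morphism _ _ _ _ _ char0 (susp_shift (linfV g)) (susp_shift (linfV h)) _ cP P1
  (bvDelta (bv_of_linf_obj g)) (bvDelta (bv_of_linf_obj h))).
rewrite (bv_of_linf_objE og) (bv_of_linf_objE oh).
by case: og => cD D2 D1; case: oh => cD' D2' D1'; apply: hbar_comm.
Qed.

Lemma bv_of_linf_id (g : obj (Linf k)) :
  bv_of_linf_arr (idarr (Linf k) g) = bv_id (X := bv_of_linf_obj g).
Proof.
rewrite bv_of_linf_arrE; last exact: linear_idfun.
by rewrite (@bv_id_hbar _ (bv_of_linf_obj g) _ (susp_shift (linfV g))).
Qed.

Lemma bv_of_linf_comp (g h i : obj (Linf k)) (Psi : arr (Linf k) h i) (Phi : arr (Linf k) g h) :
  is_arr Psi -> is_arr Phi ->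
  bv_of_linf_arr (comp Psi Phi) =
  bv_comp (X := bv_of_linf_obj g) (Y := bv_of_linf_obj h) (Z := bv_of_linf_obj i)
    (bv_of_linf_arr Psi) (bv_of_linf_arr Phi).
Proof.
move=> [cP _ P1] [cF _ F1]; have [lP _ _ _] := cP; have [lF _ _ _] := cF.
rewrite !bv_of_linf_arrE //; last exact: linear_comp lP lF.
by rewrite (@bv_comp_hbar _ (bv_of_linf_obj g) (bv_of_linf_obj h) (bv_of_linf_obj i)).
Qed.

Lemma bv_of_linf_functor : is_functor (bv_of_linf k).
Proof.
split=> [g og|g h f og oh af|g _|g h i f2 f1 _ _ _ a2 a1].
- by have [] := bv_of_linf_pure og.
- exact: bv_of_linf_arr_is.
- exact: bv_of_linf_id.
- exact: bv_of_linf_comp.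
Qed.

Lemma pure_bv_of_linf_functor : is_functor (pure_bv_of_linf k).
Proof.
split=> [g og|g h f og oh af|g _|g h i f2 f1 _ _ _ a2 a1].
- by have pg := bv_of_linf_pure og; split=> //; case: pg.
- exact: bv_of_linf_arr_is.
- exact: bv_of_linf_id.
- exact: bv_of_linf_comp.
Qed.

End Functors.

(** * The derived-bracket functor and the natural isomorphisms *)

Section WeakInverse.
Variable k : fieldType.
Hypothesis char0 : [pchar k] =i pred0.

(** Purity makes Delta_n vanish on words with fewer than n letters, so by [nested_comm_letters] the
    derived bracket is just the value of Delta_n on the product of its arguments. *)
Lemma linf_of_bv_objE (X : obj (PureBV k)) : is_pure_bv (bvDelta X) ->
  linfD (linf_of_bv_obj X) = coext (components (down_shift (bvU X)) (bvDelta X)).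
Proof.
move=> pX; pose e := down_shift (bvU X).
have [_ D0] := pX; have lD n : linear (fun x => bvDelta X x n).
  by have [[lD _ _ _ _] _] := pX; apply: lD.
have l1 := components1 e pX.
rewrite /= /coext; congr slift; apply/funext => w.
have derE v : v != [::] ->
    Defs.up (derived_bracket (bvDelta X) (size v) (map (helt_map (@down_degree k (bvU X))) v)) =
    components e (bvDelta X) (word v).
  move=> v0; rewrite components_word //; congr (Defs.up _).
  rewrite /derived_bracket -word_nil nested_comm_letters //.
    by rewrite cats0 esS_word.
  move=> w'; rewrite size_map addn0 => w'v.
  have p' : in_pow (size w') (word w' : sym (bvU X)) by rewrite /in_pow wproj_word eqxx.
  have [_ -> //] := D0 (size v).-1 _ _ p'.
  by rewrite prednK //; case: v v0 {w'v}.
under eq_bigr do rewrite codext_wordE.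
rewrite -ssum_sum; apply: eq_ssum => u v uv _.
have [->|u0] := eqVneq u [::].
  by rewrite word_nil l1 mul0r big1_seq // => -[|n] //; rewrite mem_index_iota.
have su : (0 < size u)%N by case: u u0 {uv}.
(* Summing over all arities selects each nonempty u exactly once, at n = size u. *)
rewrite (bigD1_seq (size u)) ?iota_uniq ?mem_index_iota //=; last first.
  by rewrite su ltnS -uv leq_addr.
rewrite eqxx derE // big1 ?addr0 // => i; rewrite eq_sym => /negbTE -> //.
Qed.

Lemma linf_of_bv_linf (X : obj (PureBV k)) : is_pure_bv (bvDelta X) ->
  is_linf (linf_of_bv_obj X) /\
  bvDelta X = hbar (down_shift (bvU X)) (down_shift (bvU X)) (linfD (linf_of_bv_obj X)).
Proof.
move=> pX; pose e := down_shift (bvU X).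
have lc := components_linear e pX; have c1 := components1 e pX.
have cc := components_cogen e pX; have cd := components_degree e pX.
have E : bvDelta X = hbar e e (linfD (linf_of_bv_obj X)).
  by rewrite linf_of_bv_objE // pure_bv_coext.
split=> //; split.
- by rewrite linf_of_bv_objE //; apply: coext_coder.
- rewrite linf_of_bv_objE //.
  set D := coext _; have lD : linear D := coext_linear lc.
  have nD : noninc D by apply: coext_noninc.
  have l0 : linear (fun _ : sym (shift 1 (shift 1 (bvU X))) => 0 : sym (shift 1 (shift 1 (bvU
    X)))) := @linear_zero _ _ _.
  (* The square of D is recovered from the square of Delta by injectivity of [hbar] on maps that do
     not lengthen words. *)
  suff H : (fun x => D (D x)) = (fun _ => 0) by move=> x;
    rewrite -[D (D x)]/((fun x => D (D x)) x) H.
  apply: (hbar_inj (e1 := e) (e2 := e)) => //; first exact: (linear_comp lD lD).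
  + exact: noninc_comp.
  + by move=> w; apply: fil0.
  rewrite -(hcomp_hbar e e e) //.
  have DE : hbar e e D = bvDelta X by rewrite E linf_of_bv_objE.
  rewrite DE; apply/funext => x; apply/funext => n.
  have [[_ _ _ D2 _] _] := pX; rewrite D2; apply: esym.
  move: x; apply: (sym_eqP (W := sym (bvU X))) => [||w];
    [exact: hbar_linear|exact: linear_zero|].
  by rewrite hbar_word // (lin0 (esS_linear e)) (lin0 (wproj_linear _)) if_same.
- by rewrite linf_of_bv_objE //; apply: coext1.
Qed.

(** [linf_of_bv_arr] chooses a morphism with the prescribed projection. E witnesses that there is
    one, and [coalg_inj] shows that the chosen one is E. *)
Lemma linf_of_bv_arrE (X Y : obj (PureBV k))
    (E : sym (shift 1 (shift 1 (bvU X))) -> sym (shift 1 (shift 1 (bvU Y)))) :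
  is_coalg_morphism E -> E 1 = 1 ->
  linf_of_bv_arr (X := X) (Y := Y)
    (hbar (down_shift (bvU X)) (down_shift (bvU Y)) (fun a => wproj 1 (E a))) = E.
Proof.
move=> cE E1; pose e1 := down_shift (bvU X); pose e2 := down_shift (bvU Y).
set phi := hbar _ _ _.
have lp := coalg_p1_linear cE.
have lphi : hlinear (V := symalg (bvU X)) (W := symalg (bvU Y)) phi by apply: hbar_hlinear.
have pphi : is_pure_map phi by apply: hbar_pure.
have hE : hat e1 e2 phi = fun a => wproj 1 (E a).
  apply: (hbar_inj (e1 := e1) (e2 := e2)) => //.
  - exact: hat_linear.
  - by apply: cogen_noninc; [move=> a; apply: hat_cogen | apply: hat1].
  - exact: coalg_p1_noninc.
  - exact: hat_hbar.
have mem : [/\ is_coalg_morphism E, E 1 = 1 & forall x,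
  wproj 1 (E x) = Defs.up (hsum phi (Defs.down x))].
  by split=> // x; rewrite -[RHS]/(hat e1 e2 phi x) hE.
rewrite /linf_of_bv_arr.
set P := (X in xget _ X).
have [cG G1 Gp] : P (xget (fun _ => 0) P) by apply: (xgetPex (fun _ => 0) (P := P)); exists E.
by apply: coalg_inj => // a; rewrite Gp; case: mem => _ _ ->.
Qed.

Lemma linf_of_bv_functor : is_functor (linf_of_bv k).
Proof.
split.
- by move=> X [_ pX]; have [] := linf_of_bv_linf pX.
- move=> X Y phi [_ pX] [_ pY] /BVfree_arrP[//|E [cE E1 -> comm]].
  have [[cD D2 D1] DE] := linf_of_bv_linf pX.
  have [[cD' D2' D1'] DE'] := linf_of_bv_linf pY.
  rewrite /= linf_of_bv_arrE //; split=> // x.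
  have [lE _ _ _] := cE; have [lD _ _] := cD; have [lD' _ _] := cD'.
  have nE := coalg_noninc char0 cE E1.
  have nD := coder_noninc char0 cD D1; have nD' := coder_noninc char0 cD' D1'.
  move: comm; rewrite {1}DE {1}DE' !hcomp_hbar //.
  move/(hbar_inj (linear_comp lE lD) (linear_comp lD' lE)).
  move=> /(_ (noninc_comp lE nE nD) (noninc_comp lD' nD' nE)) H.
  exact: (congr1 (@^~ x) H).
- move=> X _; rewrite /= (bv_id_hbar (down_shift (bvU X))).
  by rewrite (@linf_of_bv_arrE X X (fun a => a)) //; apply: coalg_id.
- move=> X Y Z psi phi _ _ _ /BVfree_arrP[//|E' [cE' E'1 -> _]] /BVfree_arrP[//|E [cE E1 -> _]].
  rewrite /= (bv_comp_hbar (X := X) (Y := Y) (Z := Z)) // !linf_of_bv_arrE ?E1 //.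
  exact: coalg_comp.
Qed.

Section Transport.
Variables (V V' U : gvect k) (e : eshift V U) (e' : eshift V' U).

(** With the shifts used below it has the identity of the underlying space on letters: g[1] and
    g[-1][1][1] have the same grading only up to integer arithmetic, so they are different terms and
    the identification must be an explicit map. *)
Definition theta : sym V -> sym V' := fun x => esT e' (esS e x).

Lemma theta_linear : linear theta.
Proof. exact: linear_comp (esT_linear e') (esS_linear e). Qed.
Lemma theta1 : theta 1 = 1. Proof. by rewrite /theta esS1 esT1. Qed.
Lemma wproj_theta n a : wproj n (theta a) = theta (wproj n a).
Proof. by rewrite /theta wproj_esT wproj_esS. Qed.

Lemma theta_word w : theta (word w) =
  word (map (helt_map (es_from_degree e')) (map (helt_map (es_to_degree e)) w)).
Proof. by rewrite /theta esS_word esT_word. Qed.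

Lemma theta_noninc : noninc theta.
Proof. by move=> w; rewrite theta_word; apply: fil_word; rewrite !size_map. Qed.

Lemma theta_coalg : is_coalg_morphism theta.
Proof.
have [tl tr] := bilinear_tmk (sym V') (sym V').
have lt := theta_linear.
split=> //.
- apply: word_has_degree => // w; rewrite theta_word.
  have := sproj_wdeg (map (helt_map (es_from_degree e')) (map (helt_map (es_to_degree e)) w)).
  rewrite !wdeg_map size_map.
  by have -> : wdeg w + 2 *+ size w + -2 *+ size w = wdeg w + 0 by rewrite mulNrn addrK addr0.
- have bt : bilinear (fun a b => tmk (theta a) (theta b)).
    by split=> c; [apply: linear_comp (tl _) lt | apply: linear_comp (tr _) lt].
  apply: sym_eqP.
  + exact: linear_comp (@comult_linear k V') lt.
  + exact: linear_comp (tlift_linear bt) (@comult_linear k V).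
  move=> w; rewrite theta_word tlift_comult // comult_word ssum_map; last first.
    exact: evenN2.
  rewrite ssum_map; last exact: even2.
  by apply: ssum_ext => u v; rewrite !theta_word.
- apply: sym_eqP; first exact: linear_comp (@counit_linear k V') lt.
    exact: counit_linear.
  by move=> w; rewrite theta_word !counit_word; case: w.
Qed.

End Transport.

Lemma thetaK (V V' U : gvect k) (e : eshift V U) (e' : eshift V' U) :
  cancel (theta e e') (theta e' e).
Proof. by move=> x; rewrite /theta esTK esSK. Qed.

Lemma hbar_theta (V1 V1' U1 V2 V2' U2 : gvect k) (e1 : eshift V1 U1) (e1' : eshift V1' U1)
    (e2 : eshift V2 U2) (e2' : eshift V2' U2) (Psi : sym V1 -> sym V2) :
  hbar e1 e2 Psi = hbar e1' e2' (fun x => theta e2 e2' (Psi (theta e1' e1 x))).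
Proof.
apply/funext => x; apply/funext => n; rewrite /hbar; apply: (congr1 (fun f => slift f x)).
by apply/funext => w; rewrite /theta !esTK.
Qed.

Section UnitIso.
Variable g : obj (Linf k).
Hypothesis og : is_obj (Linf k) g.
Local Notation e := (susp_shift (linfV g)).
Local Notation e' := (down_shift (shift (-1) (linfV g))).
Local Notation GFg := (linf_of_bv_obj (bv_of_linf_obj g)).

(** Both codifferentials have the BV operator of g as their series, the right one because [hbar]
    sees a map only after suspension ([hbar_theta]); injectivity of [hbar] concludes. *)
Lemma linfD_theta : linfD GFg = fun x => theta e e' (linfD g (theta e' e x)).
Proof.
have [[cD' D2' D1'] DE'] := linf_of_bv_linf (bv_of_linf_pure char0 og).
have [cD D2 D1] := og; have [lD _ _] := cD; have [lD' _ _] := cD'.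
have lt := theta_linear e e'; have lt' := theta_linear e' e.
apply: (hbar_inj (e1 := e') (e2 := e')) => //.
- exact: linear_comp (linear_comp lt lD) lt'.
- exact: coder_noninc.
- apply: (@noninc_comp _ _ _ _ (fun y => theta e e' (linfD g y)) (theta e' e)).
  + exact: linear_comp lt lD.
  + by apply: noninc_comp => //; [apply: theta_noninc | apply: coder_noninc].
  + exact: theta_noninc.
rewrite -(hbar_theta e e' e e') -bv_of_linf_objE //.
Qed.

Lemma theta_linf_morphism : is_linf_morphism (g := g) (h := GFg) (theta e e').
Proof.
split; [exact: theta_coalg | | exact: theta1].
by move=> x; rewrite linfD_theta thetaK.
Qed.

Lemma theta'_linf_morphism : is_linf_morphism (g := GFg) (h := g) (theta e' e).
Proof.
split; [exact: theta_coalg | | exact: theta1].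
by move=> x; rewrite linfD_theta thetaK.
Qed.

End UnitIso.

Lemma unit_iso : nat_iso (idfunctor (Linf k)) (compfunctor (linf_of_bv k) (pure_bv_of_linf k)).
Proof.
exists (fun g => theta (susp_shift (linfV g)) (down_shift (shift (-1) (linfV g)))).
exists (fun g => theta (down_shift (shift (-1) (linfV g))) (susp_shift (linfV g))).
split=> [g og|g h Phi og oh [cP DP P1]].
  split; [exact: theta_linf_morphism | exact: theta'_linf_morphism | |].
  - by apply/funext => x; apply: thetaK.
  - by apply/funext => x; apply: thetaK.
have [lP _ _ _] := cP.
set t1 := theta _ _; set t2 := theta _ _.
pose t1' := theta (down_shift (shift (-1) (linfV g))) (susp_shift (linfV g)).
(* The round trip on arrows is conjugation by the identifications: rewriting the series of Phi with
   the other suspension conjugates Phi, and [linf_of_bv_arrE] reads off the result. *)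
have E : farr (compfunctor (linf_of_bv k) (pure_bv_of_linf k)) Phi = fun x => t2 (Phi (t1' x)).
  rewrite /= bv_of_linf_arrE //.
  rewrite (hbar_theta (susp_shift (linfV g)) (down_shift (shift (-1) (linfV g)))
     (susp_shift (linfV h)) (down_shift (shift (-1) (linfV h)))).
  rewrite -(@linf_of_bv_arrE (bv_of_linf_obj g) (bv_of_linf_obj h) (fun x => t2 (Phi (t1' x)))).
  - by congr linf_of_bv_arr; apply: hbar_ext => x; rewrite wproj_theta.
  - apply: (@coalg_comp _ _ _ _ (fun y => t2 (Phi y)) t1'); last exact: theta_coalg.
    by apply: coalg_comp => //; apply: theta_coalg.
  - by rewrite /t1' theta1 P1 /t2 theta1.
by rewrite E; apply/funext => x; rewrite /= /t1' thetaK.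
Qed.

(** The spaces U[1][-1] and U both come with a double suspension from the same U[2]. The isomorphism
    is the series of the identity of S(U[2]), read with different shifts at the two ends, so
    naturality reduces to composing E with an identity. *)
Lemma counit_iso : nat_iso (compfunctor (pure_bv_of_linf k) (linf_of_bv k)) (idfunctor
  (PureBV k)).
Proof.
pose s (X : obj (PureBV k)) := susp_shift (shift 1 (bvU X)).
pose d (X : obj (PureBV k)) := down_shift (bvU X).
pose F (X : obj (PureBV k)) := bv_of_linf_obj (linf_of_bv_obj X).
have cid (X : obj (PureBV k)) := coalg_id (shift 1 (shift 1 (bvU X))).
exists (fun X => hbar (s X) (d X) (fun a => wproj 1 a)).
exists (fun X => hbar (d X) (s X) (fun a => wproj 1 a)).
split=> [X [_ pX]|X Y phi [_ pX] [_ pY] /BVfree_arrP[//|E [cE E1 -> comm]]].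
- have [oG DE] := linf_of_bv_linf pX; have [cD D2 D1] := oG.
  have DF := bv_of_linf_objE char0 oG.
  split.
  + apply: (@hbar_bv_morphism _ _ _ _ _ char0 (s X) (d X) _ (cid X) erefl
      (bvDelta (F X)) (bvDelta X)).
    by rewrite DF DE; apply: hbar_comm.
  + apply: (@hbar_bv_morphism _ _ _ _ _ char0 (d X) (s X) _ (cid X) erefl
      (bvDelta X) (bvDelta (F X))).
    by rewrite DF DE; apply: hbar_comm.
  + rewrite /= (@bv_comp_hbar _ (F X) X (F X) _ _ _ (s X) (d X) (s X) (fun x => x) (fun x =>
    x)) //.
    by rewrite (@bv_id_hbar _ (F X) _ (s X)).
  + rewrite /= (@bv_comp_hbar _ X (F X) X _ _ _ (d X) (s X) (d X) (fun x => x) (fun x => x)) //.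
    by rewrite (@bv_id_hbar _ X _ (d X)).
have [lE _ _ _] := cE.
have -> : farr (compfunctor (pure_bv_of_linf k) (linf_of_bv k))
    (hbar (d X) (d Y) (fun a => wproj 1 (E a))) = hbar (s X) (s Y) (fun a => wproj 1 (E a)).
  by rewrite /= linf_of_bv_arrE // bv_of_linf_arrE.
rewrite /= (@bv_comp_hbar _ (F X) X Y _ _ _ (s X) (d X) (d Y) E (fun x => x)) //.
by rewrite (@bv_comp_hbar _ (F X) (F Y) Y _ _ _ (s X) (s Y) (d Y) (fun x => x) E).
Qed.

End WeakInverse.

Theorem theorem4p8 (k : fieldType) (char0 : [pchar k]%R =i pred0) :
  is_category (Linf k) /\ is_category (BVfree k) /\
  is_functor (bv_of_linf k) /\
  is_equivalence (pure_bv_of_linf k) /\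
  is_functor (linf_of_bv k) /\
  weak_inverse (pure_bv_of_linf k) (linf_of_bv k).
Proof.
have FG : weak_inverse (pure_bv_of_linf k) (linf_of_bv k).
  by split; [apply: unit_iso | apply: counit_iso].
split; first exact: Linf_category.
split; first exact: BVfree_category.
split; first exact: bv_of_linf_functor.
split; last by split; first exact: linf_of_bv_functor.
split; first exact: pure_bv_of_linf_functor.
by exists (linf_of_bv k); split; first exact: linf_of_bv_functor.
Qed.
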